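(* Let $M\subset\mathbb C^{2p}$ be a real analytic submanifold that is a higher order perturbation of a non-resonant product quadric and admits the maximum number of deck transformations. Suppose that its associated $\sigma$ is formally equivalent (by a formal change of coordinates taking $\rho_0$ to $\rho$) to $$\hat\sigma\colon\ \xi_j'=\hat M_j(\xi\eta)\xi_j,\quad\eta_j'=\hat M_j^{-1}(\xi\eta)\eta_j,\quad 1\le j\le p,$$ where $\log\hat M$ is tangent to the identity and for each $j$ the $j$th component of $\log\hat M(\zeta)-\zeta$ is independent of $\zeta_j$. Let $\hat\Lambda_{1j}$ be defined by $\hat M_j=\hat\Lambda_{1j}^2$, $\hat\Lambda_{1j}(0)=\lambda_j$, and let $$\hat\tau_{1j}\colon\ \xi_j'=\hat\Lambda_{1j}(\xi\eta)\eta_j,\quad\eta_j'=\hat\Lambda_{1j}^{-1}(\xi\eta)\xi_j,\quad \xi_k'=\xi_k,\ \eta_k'=\eta_k\ (k\ne j),\qquad \hat\tau_1=\hat\tau_{11}\cdots\hat\tau_{1p}.$$ Then the formal normal form of $M$ is completely determined by $\hat M$ and a formal invertible mapping $\Phi\in\mathcal C^{\mathsf c}(\hat\tau_{11},\dots,\hat\tau_{1p})$ commuting with $\hat\tau_1$, in the following sense: the family $\{\tau_{11},\dots,\tau_{1p},\rho_0\}$ of $M$ is formally equivalent to $\{\Phi\hat\tau_{11}\Phi^{-1},\dots,\Phi\hat\tau_{1p}\Phi^{-1},\rho\}$ for such a $\Phi$, and two real analytic submanifolds of $\mathbb C^{2p}$ that are higher order perturbations of non-resonant product quadrics, admit the maximum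 number of deck transformations, have associated $\sigma$ formally equivalent (by formal changes of coordinates taking $\rho_0$ to $\rho$) to a map $\hat\sigma$ of this form with $\log\hat M$ satisfying the stated conditions, and have the same $(\hat M,\Phi)$, are formally equivalent. Moreover, $\Phi$ is uniquely determined by $M$ up to the equivalence relation $\Phi\sim R_\epsilon\Phi R_\epsilon^{-1}$, where $R_\epsilon\colon\xi_j'=\epsilon_j\xi_j,\ \eta_j'=\epsilon_j\eta_j$ $(1\le j\le p)$ and $R_\epsilon^2=I$. Furthermore, if a normal form $\xi_j'=M_j(\xi\eta)\xi_j$, $\eta_j'=M_j^{-1}(\xi\eta)\eta_j$ of $\sigma$ can be achieved by a convergent transformation, then the normal form of $M$ determined by $(\hat M,\Phi)$, i.e. the normal form $\{\Phi\hat\tau_{11}\Phi^{-1},\dots,\Phi\hat\tau_{1p}\Phi^{-1},\rho\}$ of its family $\{\tau_{11},\dots,\tau_{1p},\rho_0\}$, can be achieved by a convergent transformation too.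
   Context: SUBMANIFOLDS AND INVOLUTIONS. Write $z=(z',z'')\in\mathbb C^p\times\mathbb C^p$. For $M\colon z_{p+j}=E_j(z',\bar z')$ (germ at $0$, $E_j$ vanishing at $0$ with first derivatives, $q_j(\bar z')$ the part of the quadratic part of $E_j$ in $\bar z'$ only), the complexification is $\mathcal M=\{z_{p+j}=E_j(z',w'),\ w_{p+j}=\bar E_j(w',z')\}$ with coordinates $(z',w')$, $\pi_1(z,w)=z$, $\rho_0(z',w')=(\bar w',\bar z')$. Deck transformations are germs of biholomorphisms $F$ of $(\mathcal M,0)$ with $\pi_1F=\pi_1$. $M$ admits the maximum number of deck transformations if $q^{-1}(0)=\{0\}$ and there are exactly $2^p$ of them; then they form an abelian group of involutions with unique generators $\tau_{11},\dots,\tau_{1p}$ each fixing a hypersurface pointwise; $\tau_1=\tau_{11}\cdots\tau_{1p}$, $\tau_2=\rho_0\tau_1\rho_0$, $\sigma=\tau_1\tau_2$. PRODUCT QUADRICS. Let $e_*+h_*+2s_*=p$; indices range over $1\le e\le e_*$, $e_*<h\le e_*+h_*$, $e_*+h_*<s\le p-s_*$. A product quadric is $z_{p+e}=(z_e+2\gamma_e\bar z_e)^2$, $z_{p+h}=(z_h+2\gamma_h\bar z_h)^2$, $z_{p+s}=(z_s+2\gamma_s\bar z_{s+s_*})^2$, $z_{p+s+s_*}=(z_{s+s_*}+2(1-\bar\gamma_s)\bar z_s)^2$ with $0<\gamma_e<1/2$, $1/2<\gamma_h<\infty$, $\operatorname{Re}\gamma_s>1/2$, $\operatorname{Im}\gamma_s>0$.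 A higher order perturbation has $E_j$ equal to these quadratic polynomials plus terms of order $\ge3$. Put $\gamma_e=(\lambda_e+\lambda_e^{-1})^{-1}$, $\lambda_e>1$; $\gamma_h=(\lambda_h+\bar\lambda_h)^{-1}$, $|\lambda_h|=1$, $\arg\lambda_h\in(0,\pi/2)$; $\gamma_s=(1+\lambda_s^{-2})^{-1}$, $|\lambda_s|>1$, $\arg\lambda_s\in(0,\pi/2)$; $\lambda_{s+s_*}=\bar\lambda_s^{-1}$; $\mu_j=\lambda_j^2$. The linear part of $\sigma$ has eigenvalues $\mu_j^{\pm1}$; non-resonant means $\mu^Q\neq1$ for $Q\in\mathbb Z^p\setminus\{0\}$. The standard anti-holomorphic involution is $\rho\colon \xi_e'=\bar\eta_e,\eta_e'=\bar\xi_e;\ \xi_h'=\bar\xi_h,\eta_h'=\bar\eta_h;\ \xi_s'=\bar\xi_{s+s_*},\eta_s'=\bar\eta_{s+s_*},\xi_{s+s_*}'=\bar\xi_s,\eta_{s+s_*}'=\bar\eta_s$. NOTATION. $\xi\eta=(\xi_1\eta_1,\dots,\xi_p\eta_p)$. $(\log\hat M)_j(\zeta)=\log(\hat M_j(\zeta)/\hat M_j(0))$ for $j\le e_*$ and $-i\log(\hat M_j(\zeta)/\hat M_j(0))$ for $j>e_*$; tangent to the identity means $\log\hat M(\zeta)=\zeta+O(|\zeta|^2)$. Let $Z_j$ be the linear map changing the sign of $\eta_j$ and fixing all other coordinates. $\mathcal C^{\mathsf c}(Z_1,\dots,Z_p)$ is the set of formal maps $I+(U,V)$ of $\mathbb C^{2p}$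 tangent to the identity at $0$ whose coefficients (of $\xi^P\eta^Q$) satisfy $U_{j,PQ}=0$ for $Q\in2\mathbb N^p$, $|P|+|Q|>1$, and $V_{j,P(e_j+Q')}=0$ for $Q'\in2\mathbb N^p$, $|P|+|Q'|\ge1$, $1\le j\le p$ (here $e_j$ is the $j$th unit vector). Let $F$ be the formal biholomorphism $F(\xi,\eta)=(\xi+\hat\Lambda_1(\xi\eta)\eta,\ \eta-\hat\Lambda_1(\xi\eta)^{-1}\xi)$ with $\hat\Lambda_1=\operatorname{diag}(\hat\Lambda_{11},\dots,\hat\Lambda_{1p})$; it satisfies $F\hat\tau_{1j}=Z_jF$. Then $\mathcal C^{\mathsf c}(\hat\tau_{11},\dots,\hat\tau_{1p})=\{F^{-1}\psi F\colon\psi\in\mathcal C^{\mathsf c}(Z_1,\dots,Z_p)\}$. Two families of involutions $\{\tau_{1j}\},\rho$ and $\{\tilde\tau_{1j}\},\tilde\rho$ are formally equivalent if a formal biholomorphism conjugates $\rho$ to $\tilde\rho$ and the set $\{\tau_{1j}\}$ to the set $\{\tilde\tau_{1j}\}$; formal equivalence of submanifolds is by formal biholomorphisms of $(\mathbb C^{2p},0)$.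
   Formalization: Existence of Φ is stated under an added sign condition, needed for it to hold: for each hyperbolic j, after normalizing σ, the η_j-coefficient of the ξ_j-component of τ_1 is a positive multiple of λ_j. Without it the claim fails already for p=1. *)

(* Defs.v *)
From HB Require Import structures.
From mathcomp Require Import all_boot all_order all_fingroup all_algebra.
From mathcomp Require Import boolp classical_sets functions cardinality reals.
From mathcomp Require Import complex.
From mathcomp Require Import mpoly.
Set Implicit Arguments.
Unset Strict Implicit.
Unset Printing Implicit Defensive.
Import Order.TTheory GRing.Theory Num.Theory.
Local Open Scope ring_scope.

Section PowerSeries.
Variable R : realType.
Local Notation C := R[i].

(* A formal power series is its family of coefficients; a germ of holomorphic
   function at 0 is a convergent one. *)
Definition series (n : nat) := 'X_{1..n} -> C.

(* Formal maps from (C^k, 0) to C^n, given by their components. *)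
Definition formal_map (k n : nat) := 'I_n -> series k.

Definition trunc n (d : nat) (f : series n) : {mpoly C[n]} :=
  \sum_(m : 'X_{1..n < d.+1}) f m *: 'X_[m].

(* The coefficient of degree |m| of a product, a composition (with inner series
   vanishing at 0), an inverse or a logarithm only depends on the truncations
   in degree <= |m|, so that all the operations are computed on polynomials. *)
Definition psmul n (f g : series n) : series n :=
  fun m => (trunc (mdeg m) f * trunc (mdeg m) g)@_m.

Definition pscomp n k (f : series n) (G : formal_map k n) : series k :=
  fun m => (trunc (mdeg m) f \mPo [tuple trunc (mdeg m) (G i) | i < n])@_m.

(* 1 / f, for f with f(0) <> 0: geometric series in 1 - f / f(0). *)
Definition psinv n (f : series n) : series n :=
  fun m => let u := 1 - (f 0%MM)^-1 *: trunc (mdeg m) f in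
    (f 0%MM)^-1 * (\sum_(0 <= k < (mdeg m).+1) u ^+ k)@_m.

(* log (f / f(0)), for f with f(0) <> 0: Mercator series in f / f(0) - 1. *)
Definition pslog n (f : series n) : series n :=
  fun m => let u := (f 0%MM)^-1 *: trunc (mdeg m) f - 1 in
    (\sum_(1 <= k < (mdeg m).+1) ((-1) ^+ k.+1 / k%:R) *: u ^+ k)@_m.

Definition psscale n (c : C) (f : series n) : series n := fun m => c * f m.

Definition psX n (i : 'I_n) : series n := fun m => (m == U_(i)%MM)%:R.

(* \bar f, such that \bar f (\bar x) is the conjugate of f x. *)
Definition psconj n (f : series n) : series n := fun m => (f m)^*.

(* Absolute convergence on a polydisc of radius r > 0. *)
Definition convergent n (f : series n) : Prop :=
  exists2 r : C, 0 < r &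
    exists B : C, forall d : nat,
      \sum_(m : 'X_{1..n < d}) `|f m| * r ^+ mdeg m <= B.

Definition mcomp k m n (F : formal_map m n) (G : formal_map k m) : formal_map k n :=
  fun i => pscomp (F i) G.

Definition mid n : formal_map n n := @psX n.

Definition mconj k n (F : formal_map k n) : formal_map k n := fun i => psconj (F i).

Definition mconvergent k n (F : formal_map k n) : Prop := forall i, convergent (F i).

Definition jacobian0 n (F : formal_map n n) : 'M[C]_n := \matrix_(i, j) F i U_(j)%MM.

(* Formal biholomorphisms of (C^n, 0). *)
Definition biholo n (F : formal_map n n) : Prop :=
  (forall i, F i 0%MM = 0) /\ jacobian0 F \in unitmx.

Definition minv n (F : formal_map n n) : formal_map n n :=
  if pselect (exists G, mcomp F G = @mid n /\ mcomp G F = @mid n) is left e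
  then projT1 (cid e) else F.

Definition tangent_to_id n (F : formal_map n n) : Prop :=
  forall i (m : 'X_{1..n}), (mdeg m <= 1)%N -> F i m = psX i m.

(* An antiholomorphic map x |-> a (\bar x) is represented by its holomorphic
   part a. Composing it after, resp. before, a holomorphic map F gives the
   antiholomorphic map with holomorphic part a o \bar F, resp. F o a. *)
Definition conj_anti n (G a a' : formal_map n n) : Prop :=
  mcomp G a = mcomp a' (mconj G).

(* Families of involutions t together with an antiholomorphic involution a:
   G conjugates a to a' and the set {t_j} to the set {t'_j}. *)
Definition conj_family n q (G : formal_map n n)
    (t : 'I_q -> formal_map n n) (a : formal_map n n)
    (t' : 'I_q -> formal_map n n) (a' : formal_map n n) : Prop :=
  [/\ biholo G, conj_anti G a a',
      forall j, exists k, mcomp G (t j) = mcomp (t' k) G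
    & forall k, exists j, mcomp G (t j) = mcomp (t' k) G].

Definition compose_all n q (t : 'I_q -> formal_map n n) : formal_map n n :=
  \big[@mcomp n n n/@mid n]_(j < q) t j.

End PowerSeries.

Arguments mid {R n}.

Section Submanifolds.
Variables (R : realType) (p : nat).
Local Notation C := R[i].

(* C^p x C^p: the first half is z' (or xi), the second one z'', w' or eta. *)
Definition glue k (A B : formal_map R k p) : formal_map R k (p + p) :=
  fun i => match fintype.split i with inl j => A j | inr j => B j end.

Definition fst_coord (j : 'I_p) : series R (p + p) := psX R (lshift p j).
Definition snd_coord (j : 'I_p) : series R (p + p) := psX R (rshift p j).

(* Holomorphic part of rho_0 (z', w') = (\bar w', \bar z'). *)
Definition rho0 : formal_map R (p + p) (p + p) := glue snd_coord fst_coord.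

(* M is z_{p+j} = E_j(z', \bar z'), where E_j(z', w') is a convergent series.
   In the coordinates (z', w') of the complexification, graph E is pi_1 and
   conj_graph E is (z', w') |-> (w', \bar E(w', z')). *)
Definition graph (E : formal_map R (p + p) p) : formal_map R (p + p) (p + p) :=
  glue fst_coord E.
Definition conj_graph (E : formal_map R (p + p) p) : formal_map R (p + p) (p + p) :=
  mcomp (mconj (graph E)) rho0.

(* Psi maps M formally into M'. *)
Definition maps_submanifold (Psi : formal_map R (p + p) (p + p))
    (E E' : formal_map R (p + p) p) : Prop :=
  forall j : 'I_p,
    pscomp (Psi (rshift p j)) (graph E) =
    pscomp (E' j)
      (glue (fun k => pscomp (Psi (lshift p k)) (graph E))
            (fun k => pscomp (psconj (Psi (lshift p k))) (conj_graph E))).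

Definition formally_equivalent (E E' : formal_map R (p + p) p) : Prop :=
  exists2 Psi, biholo Psi & maps_submanifold Psi E E'.

Definition deck (E : formal_map R (p + p) p) (F : formal_map R (p + p) (p + p)) : Prop :=
  [/\ mconvergent F, biholo F & mcomp (graph E) F = graph E].

(* The part of the quadratic part of E_j in \bar z' only, at \bar z' = v. *)
Definition pure_quadratic (E : formal_map R (p + p) p) (j : 'I_p) (v : 'I_p -> C) : C :=
  let x i := match fintype.split i with inl _ => 0 | inr k => v k end in
  \sum_(m : 'X_{1..(p + p) < 3} | mdeg m == 2)
    E j m * \prod_(i < p + p) x i ^+ (m : 'X_{1..p + p}) i.

Definition max_deck (E : formal_map R (p + p) p) : Prop :=
  (forall v : 'I_p -> C,
     (forall j, pure_quadratic E j v = 0) -> forall j, v j = 0) /\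
  ([set F | deck E F]%classic #= `I_(2 ^ p)%classic)%card.

(* F is the identity on a smooth germ of hypersurface {u = 0}: the components
   of F - I are multiples of u. *)
Definition fixes_hypersurface n (F : formal_map R n n) : Prop :=
  exists u : series R n,
    [/\ convergent u, u 0%MM = 0, exists i, u U_(i)%MM <> 0
      & forall i, exists2 v, convergent v & F i \- psX R i = psmul u v].

Definition deck_generators (E : formal_map R (p + p) p)
    (tau : 'I_p -> formal_map R (p + p) (p + p)) : Prop :=
  [/\ forall j, deck E (tau j),
      forall j, mcomp (tau j) (tau j) = mid,
      forall j, fixes_hypersurface (tau j)
    & forall F, deck E F ->
        exists s : seq 'I_p, F = foldr (fun j G => mcomp (tau j) G) mid s].

Definition sigma (tau : 'I_p -> formal_map R (p + p) (p + p)) :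
    formal_map R (p + p) (p + p) :=
  let tau1 := compose_all tau in
  let tau2 := mcomp rho0 (mcomp (mconj tau1) rho0) in
  mcomp tau1 tau2.

(* The numbers e_*, h_* and s_* of the product quadric; indices start at 0. *)
Record signature := Signature { ne : nat; nh : nat; ns : nat }.

Section Signature.
Variable sg : signature.
Let e := ne sg.
Let h := nh sg.
Let s := ns sg.

Definition is_e (j : 'I_p) := (j < e)%N.
Definition is_h (j : 'I_p) := (e <= j < e + h)%N.
Definition is_s (j : 'I_p) := (e + h <= j < e + h + s)%N.
Definition is_s' (j : 'I_p) := (e + h + s <= j)%N.

(* Exchanges s and s + s_*, and fixes the other indices. *)
Definition partner (j : 'I_p) : 'I_p :=
  if is_s j then insubd j (j + s)%N
  else if is_s' j then insubd j (j - s)%N else j.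

(* Only gam j for j not of the form s + s_* is a parameter of the quadric. *)
Definition quadric_params (gam lam : 'I_p -> C) : Prop :=
  [/\ (e + h + s.*2)%N = p,
      forall j, is_e j -> [/\ 0 < gam j < 2^-1, 1 < lam j
                            & gam j = (lam j + (lam j)^-1)^-1],
      forall j, is_h j -> [/\ 2^-1 < gam j, `|lam j| = 1,
                              0 < 'Re (lam j), 0 < 'Im (lam j)
                            & gam j = (lam j + (lam j)^*)^-1],
      forall j, is_s j -> [/\ 2^-1 < 'Re (gam j), 0 < 'Im (gam j)
                            & gam j = (1 + (lam j) ^- 2)^-1] /\
                          [/\ 1 < `|lam j|, 0 < 'Re (lam j) & 0 < 'Im (lam j)]
    & forall j, is_s j -> lam (partner j) = ((lam j)^*)^-1].

Definition quadric (gam : 'I_p -> C) (j : 'I_p) : {mpoly C[p + p]} :=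
  let g := if is_s' j then 1 - (gam (partner j))^* else gam j in
  ('X_(lshift p j) + (2 * g) *: 'X_(rshift p (partner j))) ^+ 2.

Definition quadric_perturbation (gam : 'I_p -> C) (E : formal_map R (p + p) p) : Prop :=
  mconvergent E /\
  forall j (m : 'X_{1..p + p}), (mdeg m <= 2)%N -> E j m = (quadric gam j)@_m.

Definition non_resonant (lam : 'I_p -> C) : Prop :=
  forall Q : 'I_p -> int, (exists j, Q j <> 0) ->
    \prod_(j < p) (lam j ^+ 2) ^ Q j <> 1.

(* Holomorphic part of the standard antiholomorphic involution rho. *)
Definition rho : formal_map R (p + p) (p + p) :=
  glue (fun j => if is_e j then snd_coord j else fst_coord (partner j))
       (fun j => if is_e j then fst_coord j else snd_coord (partner j)).

(* (log M)_j = log (M_j / M_j(0)), multiplied by -i for j > e_*. *)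
Definition logM (M : formal_map R p p) : formal_map R p p :=
  fun j => if is_e j then pslog (M j) else psscale (- 'i) (pslog (M j)).

Definition normalized_log (M : formal_map R p p) : Prop :=
  tangent_to_id (logM M) /\
  forall j (m : 'X_{1..p}), (0 < m j)%N -> (logM M j \- psX R j) m = 0.

End Signature.

Definition xi_eta : formal_map R (p + p) p := fun j => psmul (fst_coord j) (snd_coord j).

Definition sigma_hat (M : formal_map R p p) : formal_map R (p + p) (p + p) :=
  glue (fun j => psmul (pscomp (M j) xi_eta) (fst_coord j))
       (fun j => psmul (pscomp (psinv (M j)) xi_eta) (snd_coord j)).

Definition tau_hat (L : formal_map R p p) (j : 'I_p) : formal_map R (p + p) (p + p) :=
  glue (fun k => if k == j then psmul (pscomp (L j) xi_eta) (snd_coord j)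
                 else fst_coord k)
       (fun k => if k == j then psmul (pscomp (psinv (L j)) xi_eta) (fst_coord j)
                 else snd_coord k).

(* C^c(Z_1, .., Z_p). The exponent m has xi-part P and eta-part Q: Q is in
   2N^p when all its components are even, and is e_j + Q' with Q' in 2N^p when
   its only odd component is the j-th one. *)
Definition Cc_Z (psi : formal_map R (p + p) (p + p)) : Prop :=
  [/\ tangent_to_id psi,
      forall j (m : 'X_{1..p + p}), (1 < mdeg m)%N ->
        (forall k, ~~ odd (m (rshift p k))) -> psi (lshift p j) m = 0
    & forall j (m : 'X_{1..p + p}), (1 < mdeg m)%N ->
        (forall k, odd (m (rshift p k)) = (k == j)) -> psi (rshift p j) m = 0].

Definition straighten (L : formal_map R p p) : formal_map R (p + p) (p + p) :=
  glue (fun j => fst_coord j \+ psmul (pscomp (L j) xi_eta) (snd_coord j))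
       (fun j => snd_coord j \- psmul (pscomp (psinv (L j)) xi_eta) (fst_coord j)).

(* C^c(tau_hat_1, .., tau_hat_p). *)
Definition Cc_tau_hat (L : formal_map R p p) (Phi : formal_map R (p + p) (p + p)) : Prop :=
  exists2 psi, Cc_Z psi &
    Phi = mcomp (minv (straighten L)) (mcomp psi (straighten L)).

Definition conj_tau_hat (L : formal_map R p p) (Phi : formal_map R (p + p) (p + p))
    (j : 'I_p) : formal_map R (p + p) (p + p) :=
  mcomp Phi (mcomp (tau_hat L j) (minv Phi)).

Definition R_eps (eps : 'I_p -> C) : formal_map R (p + p) (p + p) :=
  glue (fun j => psscale (eps j) (fst_coord j))
       (fun j => psscale (eps j) (snd_coord j)).

(* A submanifold with its associated objects: parameters of its quadratic part,
   defining functions, generators tau_{1j}, and the series \hat M, \hat Lambda_1. *)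
Record submanifold := Submanifold {
  sub_sig : signature;
  sub_gam : 'I_p -> C;
  sub_lam : 'I_p -> C;
  sub_E : formal_map R (p + p) p;
  sub_tau : 'I_p -> formal_map R (p + p) (p + p);
  sub_Mhat : formal_map R p p;
  sub_Lhat : formal_map R p p }.

(* Theta conjugates rho_0 to rho and sigma to sigma_hat. *)
Definition normalizes_sigma (D : submanifold) (Theta : formal_map R (p + p) (p + p)) :
    Prop :=
  [/\ biholo Theta, conj_anti Theta rho0 (rho (sub_sig D))
    & mcomp Theta (sigma (sub_tau D)) = mcomp (sigma_hat (sub_Mhat D)) Theta].

Definition admissible (D : submanifold) : Prop :=
  [/\ quadric_params (sub_sig D) (sub_gam D) (sub_lam D),
      non_resonant (sub_lam D),
      quadric_perturbation (sub_sig D) (sub_gam D) (sub_E D),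
      max_deck (sub_E D)
    & deck_generators (sub_E D) (sub_tau D)] /\
  [/\ exists Theta, normalizes_sigma D Theta,
      normalized_log (sub_sig D) (sub_Mhat D)
    & forall j, sub_Mhat D j = psmul (sub_Lhat D j) (sub_Lhat D j) /\
                sub_Lhat D j 0%MM = sub_lam D j].

(* For j hyperbolic, Theta tau_1 Theta^-1 is xi_j' = A_j(xi eta) eta_j,
   eta_j' = A_j^-1(xi eta) xi_j with A_j(0) / lambda_j real and nonzero, of a
   sign independent of Theta. This sign is + for tau_hat_1, and it is an
   invariant: eta_j |-> - eta_j changes it but also changes the sign of the
   linear term of log \hat M_j, fixed by normalized_log. For p = 1, if
   tau_11 is xi' = - lambda exp(i xi eta / 2) eta,
   eta' = - lambda^-1 exp(- i xi eta / 2) xi, then sigma is sigma_hat with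
   log \hat M = zeta, but {tau_11, rho} is not equivalent to {tau_hat_11, rho}. *)
Definition oriented (D : submanifold) (Theta : formal_map R (p + p) (p + p)) : Prop :=
  forall j, is_h (sub_sig D) j ->
    0 < mcomp Theta (mcomp (compose_all (sub_tau D)) (minv Theta))
          (lshift p j) U_(rshift p j)%MM / sub_lam D j.

(* G brings {tau_11, .., tau_1p, rho_0} to its normal form. *)
Definition normalizes_family (D : submanifold) (Phi G : formal_map R (p + p) (p + p)) :
    Prop :=
  conj_family G (sub_tau D) rho0 (conj_tau_hat (sub_Lhat D) Phi) (rho (sub_sig D)).

Definition normal_form (D : submanifold) (Phi : formal_map R (p + p) (p + p)) : Prop :=
  [/\ Cc_tau_hat (sub_Lhat D) Phi,
      mcomp Phi (compose_all (tau_hat (sub_Lhat D))) =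
        mcomp (compose_all (tau_hat (sub_Lhat D))) Phi
    & exists G, normalizes_family D Phi G].

End Submanifolds.

(* Main.v *)
(* A formal map intertwining two maps with the same non-resonant diagonal linear part is
   graded by the torus weights: it is xi_j' = a_j(zeta) xi_j, eta_j' = b_j(zeta) eta_j with
   zeta = xi eta. Moreover the normalization of log \hat M makes \hat M rigid: M'(c zeta) =
   M(zeta) forces c = 1. So any Theta can be corrected by a torus element into a G taking
   tau_1 to \hat tau_1.

   On the side of M, averaging the coordinates over the deck group gives X with X tau_1j =
   Z_j X (up to the numbering), and pi_1 is the quotient by this group, since pi_1 = e o q o
   X where q(z, u) = (z, u^2). If F = straighten L, the map F G X^-1 conjugates the Z_j to
   the family of M read through F G; dividing it by its part of the right parity, which
   commutes with all the Z_j, leaves a unique element of C^c(Z_1, .., Z_p), hence Phi. Two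
   normalizing maps G differ by a torus element commuting with \hat tau_1, so that a^2 = 1:
   this is R_eps. If two submanifolds have the same (\hat M, Phi), then G'^-1 G takes deck
   transformations to deck transformations, and descends through pi_1.

   For the convergence, G Psi^-1 is of the form (a, b) above when Psi is a convergent
   diagonalization of sigma, up to a permutation of coordinates. With c = ab and theta
   inverse to zeta |-> c zeta, one has log \hat M = log M o theta for the convergent M given
   by Psi; as theta_j is divisible by zeta_j while (log \hat M)_j - zeta_j is free of
   zeta_j, theta solves an equation in which \hat M no longer occurs, and is dominated by a
   convergent majorant. Then \hat M, \hat Lambda_1, c, and a^2 = c (\hat Lambda_1 o (c
   zeta)) / A converge, where A is read off Psi tau_1 Psi^-1. *)

Require Import Defs.
From HB Require Import structures.
From mathcomp Require Import all_boot all_order all_fingroup all_algebra.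
From mathcomp Require Import boolp classical_sets functions cardinality reals.
From mathcomp Require Import complex.
From mathcomp Require Import mpoly.
From mathcomp Require Import ring zify.
Set Implicit Arguments.
Unset Strict Implicit.
Unset Printing Implicit Defensive.
Import Order.TTheory GRing.Theory Num.Theory.
Local Open Scope ring_scope.

(* functions.glue shadows Defs.glue. *)
Local Notation glue := Defs.glue.

(** * The ring of power series *)

(** Why a torus correction suffices: the conjugate of tau_1 by Theta is an involution that inverts
    [torus M], as [swap] does. Hence its product with [swap] is diagonal over zeta, and rigidity
    leaves [torus A * swap]. Conjugation by [torus a] replaces A by a^2 A, so a must be a square
    root of L / A that is real for rho. The reality of L / A is automatic; only hyperbolic indices
    can obstruct a real root, by the sign that [oriented] fixes.

    Dividing by the part of the right parity requires this part to be invertible, so G must match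
    the reflections to first order before the division. This is obtained without diagonalizing:
    sigma + sigma^-1 acts to first order on the plane of z'_k and its partner w'-coordinate as the
    scalar mu_k + 1 / mu_k. Non-resonance makes these scalars distinct, so the linear part of G
    respects the planes.

    In the convergence part, Psi need not respect rho, and its eigenvalues may come permuted or
    inverted. The convergence of G is therefore drawn from the relations with sigma and tau_1
    alone. *)

Section BoundedSums.
Variables (n : nat) (V : nmodType).

Lemma bsum_widen (d d' : nat) (F : 'X_{1..n} -> V) :
  (d <= d')%N -> (forall a, (d <= mdeg a)%N -> F a = 0) ->
  \sum_(a : 'X_{1..n < d'}) F a = \sum_(a : 'X_{1..n < d}) F a.
Proof.
move=> le_dd' F0; rewrite (bigID (fun a : 'X_{1..n < d'} => (mdeg a < d)%N)) /=.
rewrite [X in _ + X]big1 ?addr0; last by move=> a; rewrite -leqNgt => /F0.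
pose h (a : 'X_{1..n < d}) : 'X_{1..n < d'} :=
  BMultinom (leq_trans (bmdeg a) le_dd').
rewrite (@reindex_omap _ _ _ _ _ h (fun a => insub (a : 'X_{1..n}))) /=.
  apply: eq_bigl => a; rewrite bmdeg /=; apply/eqP.
  by rewrite insubT ?bmdeg // => H; congr Some; apply/val_inj.
move=> a lt_ad; rewrite insubT /=; congr Some; exact/val_inj.
Qed.

Lemma bsum1 (d : nat) (a : 'X_{1..n}) (F : 'X_{1..n} -> V) :
  (mdeg a < d)%N -> (forall b, b != a -> F b = 0) ->
  \sum_(b : 'X_{1..n < d}) F b = F a.
Proof.
move=> lt_ad F0; rewrite (bigD1 (BMultinom lt_ad)) //= big1 ?addr0 // => b nba.
by apply: F0; apply: contra nba => /eqP eq_ba; apply/eqP/val_inj.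
Qed.

End BoundedSums.

Section SeriesRing.
Variables (R : realType) (n : nat).
Local Notation C := R[i].
Implicit Types (f g h : series R n) (P Q : {mpoly C[n]}) (m : 'X_{1..n}).

HB.instance Definition _ := GRing.Zmodule.copy (series R n) ('X_{1..n} -> C).

(** Identities between series are imported from [{mpoly C[n]}]: by [agree_inj], two series are equal
    once, in every degree, one polynomial built from truncations represents both. *)
Definition agree (d : nat) f P := forall m, (mdeg m <= d)%N -> P@_m = f m.

Lemma truncE d f m : (mdeg m <= d)%N -> (trunc d f)@_m = f m.
Proof. by move=> lemd; rewrite mcoeff_mpoly. Qed.

Lemma agree_trunc d f : agree d f (trunc d f).
Proof. exact: truncE. Qed.

Lemma mcoeffM_agree d f g P Q m : (mdeg m <= d)%N ->
  agree d f P -> agree d g Q -> (P * Q)@_m = psmul f g m.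
Proof.
move=> lemd fP gQ; rewrite /psmul !mcoeffM; apply: eq_bigr => -[a b] /= _.
have /andP[la lb]: (mdeg a <= mdeg m)%N && (mdeg b <= mdeg m)%N.
  by have := bmdeg a; have := bmdeg b; rewrite !ltnS => -> ->.
by rewrite (truncE _ la) (truncE _ lb) (fP _ (leq_trans la lemd)) (gQ _ (leq_trans lb lemd)).
Qed.

Lemma agreeM d f g P Q : agree d f P -> agree d g Q -> agree d (psmul f g) (P * Q).
Proof. by move=> fP gQ m lemd; apply: mcoeffM_agree lemd fP gQ. Qed.

Lemma agreeD d f g P Q : agree d f P -> agree d g Q -> agree d (f + g) (P + Q).
Proof. by move=> fP gQ m lemd; rewrite mcoeffD fP ?gQ. Qed.

Lemma agree_inj f g : (forall d, exists2 P, agree d f P & agree d g P) -> f = g.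
Proof.
move=> fg; apply/funext => m; have [P fP gP] := fg (mdeg m).
by rewrite -fP // -gP.
Qed.

Definition psone : series R n := fun m => (m == 0%MM)%:R.

Lemma agree1 d : agree d psone 1.
Proof. by move=> m _; rewrite mcoeff1. Qed.

Fact psmulA : associative (@psmul R n).
Proof.
move=> f g h; apply: agree_inj => d; exists (trunc d f * trunc d g * trunc d h).
  by rewrite -mulrA; do !apply: agreeM; apply: agree_trunc.
by do !apply: agreeM; apply: agree_trunc.
Qed.

Fact psmulC : commutative (@psmul R n).
Proof.
move=> f g; apply: agree_inj => d; exists (trunc d f * trunc d g).
  by apply: agreeM; apply: agree_trunc.
by rewrite mulrC; apply: agreeM; apply: agree_trunc.
Qed.

Fact psmul1 : left_id psone (@psmul R n).
Proof.
move=> f; apply: agree_inj => d; exists (trunc d f); last exact: agree_trunc.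
by rewrite -[trunc d f]mul1r; apply: agreeM; [apply: agree1|apply: agree_trunc].
Qed.

Fact psmulDl : left_distributive (@psmul R n) +%R.
Proof.
move=> f g h; apply: agree_inj => d; exists ((trunc d f + trunc d g) * trunc d h).
  by apply: agreeM; [apply: agreeD|]; apply: agree_trunc.
by rewrite mulrDl; apply: agreeD; apply: agreeM; apply: agree_trunc.
Qed.

Fact psone_neq0 : psone != 0.
Proof.
apply/eqP => /(congr1 (fun f : series R n => f 0%MM)) /eqP.
by rewrite /psone eqxx /= oner_eq0.
Qed.

HB.instance Definition _ := GRing.Zmodule_isComNzRing.Build (series R n)
  psmulA psmulC psmul1 psmulDl psone_neq0.

Fact psscaleA (a b : C) f : psscale a (psscale b f) = psscale (a * b) f.
Proof. by apply/funext => m; rewrite /psscale mulrA. Qed.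
Fact psscale1 : left_id 1 (@psscale R n).
Proof. by move=> f; apply/funext => m; rewrite /psscale mul1r. Qed.
Fact psscaleDr : right_distributive (@psscale R n) +%R.
Proof. by move=> a f g; apply/funext => m; exact: mulrDr. Qed.
Fact psscaleDl f : {morph (@psscale R n)^~ f : a b / a + b}.
Proof. by move=> a b; apply/funext => m; exact: mulrDl. Qed.

HB.instance Definition _ := GRing.Zmodule_isLmodule.Build C (series R n)
  psscaleA psscale1 psscaleDr psscaleDl.

Fact psscaleAl (a : C) f g : a *: (f * g) = (a *: f) * g.
Proof.
apply: agree_inj => d; exists (a *: (trunc d f * trunc d g)).
  move=> m lemd; rewrite mcoeffZ.
  by rewrite (mcoeffM_agree lemd (@agree_trunc _ f) (@agree_trunc _ g)).
rewrite scalerAl; apply: agreeM; last exact: agree_trunc.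
by move=> m lemd; rewrite mcoeffZ agree_trunc.
Qed.

HB.instance Definition _ := GRing.Lmodule_isLalgebra.Build C (series R n) psscaleAl.
HB.instance Definition _ := GRing.Lalgebra_isComAlgebra.Build C (series R n).

Lemma psmulE f g : psmul f g = f * g. Proof. by []. Qed.
Lemma psaddE f g m : (f + g) m = f m + g m. Proof. by []. Qed.
Lemma psoppE f m : (- f) m = - f m. Proof. by []. Qed.
Lemma pszE (c : C) f m : (c *: f) m = c * f m. Proof. by []. Qed.
Lemma ps0E m : (0 : series R n) m = 0. Proof. by []. Qed.
Lemma ps1E m : (1 : series R n) m = (m == 0%MM)%:R. Proof. by []. Qed.

Lemma pssumE (I : Type) (r : seq I) (Pr : pred I) (F : I -> series R n) m :
  (\sum_(i <- r | Pr i) F i) m = \sum_(i <- r | Pr i) F i m.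
Proof. by elim/big_rec2: _ => // i y1 y2 _ <-. Qed.

Lemma psmul_coef f g m : (f * g) m =
  \sum_(k : 'X_{1..n < (mdeg m).+1, (mdeg m).+1} | m == (k.1 + k.2)%MM)
    f k.1 * g k.2.
Proof.
rewrite -psmulE /psmul mcoeffM; apply: eq_bigr => -[a b] /= _.
have /andP[la lb]: (mdeg a <= mdeg m)%N && (mdeg b <= mdeg m)%N.
  by have := bmdeg a; have := bmdeg b; rewrite !ltnS => -> ->.
by rewrite (truncE _ la) (truncE _ lb).
Qed.

Lemma psmul0 f g : (f * g) 0%MM = f 0%MM * g 0%MM.
Proof.
rewrite -psmulE -(mcoeffM_agree (leqnn _) (@agree_trunc _ f) (@agree_trunc _ g)).
by rewrite (rmorphM (mcoeff 0%MM)) /= !truncE ?mdeg0.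
Qed.

Lemma pspow0 f k : (f ^+ k) 0%MM = f 0%MM ^+ k.
Proof. by elim: k => [|k IH]; rewrite ?expr0 ?ps1E ?eqxx // !exprS psmul0 IH. Qed.

(** Congruence modulo the d-th power of the maximal ideal, with a strict bound: [eqd 1 f 0] means
    f(0) = 0, and [eqd 2 f 0] that the linear part vanishes too. *)
Definition eqd d f g := forall m, (mdeg m < d)%N -> f m = g m.

Lemma eqd_refl d f : eqd d f f. Proof. by []. Qed.
Lemma eqd_sym d f g : eqd d f g -> eqd d g f.
Proof. by move=> fg m /fg. Qed.
Lemma eqd_trans d f g h : eqd d f g -> eqd d g h -> eqd d f h.
Proof. by move=> fg gh m lm; rewrite fg ?gh. Qed.
Lemma eqd_le d d' f g : (d <= d')%N -> eqd d' f g -> eqd d f g.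
Proof. by move=> le fg m lm; apply: fg; apply: leq_trans le. Qed.
Lemma eqd_eq f g : (forall d, eqd d f g) -> f = g.
Proof. by move=> fg; apply/funext => m; apply: (fg (mdeg m).+1). Qed.
Lemma eqdD d f g f' g' : eqd d f f' -> eqd d g g' -> eqd d (f + g) (f' + g').
Proof. by move=> ff gg m lm; rewrite !psaddE ff ?gg. Qed.
Lemma eqdN d f f' : eqd d f f' -> eqd d (- f) (- f').
Proof. by move=> ff m lm; rewrite !psoppE ff. Qed.
Lemma eqdB d f g f' g' : eqd d f f' -> eqd d g g' -> eqd d (f - g) (f' - g').
Proof. by move=> ff gg; apply: eqdD => //; apply: eqdN. Qed.
Lemma eqdZ d c f f' : eqd d f f' -> eqd d (c *: f) (c *: f').
Proof. by move=> ff m lm; rewrite !pszE ff. Qed.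
Lemma eqd_sum d (I : Type) (r : seq I) (Pr : pred I) (F F' : I -> series R n) :
  (forall i, eqd d (F i) (F' i)) ->
  eqd d (\sum_(i <- r | Pr i) F i) (\sum_(i <- r | Pr i) F' i).
Proof. by move=> FF m lm; rewrite !pssumE; apply: eq_bigr => i _; apply: FF. Qed.

Lemma eqd_sub0 d f g : eqd d f g <-> eqd d (f - g) 0.
Proof.
split=> fg m lm; first by rewrite psaddE psoppE fg // subrr.
by apply/eqP; rewrite -subr_eq0 -[_ - _]/((f - g) m) fg.
Qed.

Lemma psmul_ext f g f' g' m :
  (forall a b, (a + b)%MM = m -> f a * g b = f' a * g' b) -> (f * g) m = (f' * g') m.
Proof.
by move=> E; rewrite !psmul_coef; apply: eq_bigr => -[a b] /= /eqP /esym /E.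
Qed.

Lemma psmul_eq0 f g m :
  (forall a b, (a + b)%MM = m -> f a * g b = 0) -> (f * g) m = 0.
Proof.
by move=> E; rewrite psmul_coef big1 // => -[a b] /= /eqP /esym /E.
Qed.

Lemma eqd0M d e f g : eqd d f 0 -> eqd e g 0 -> eqd (d + e) (f * g) 0.
Proof.
move=> f0 g0 m lm; apply: psmul_eq0 => a b E.
case: (ltnP (mdeg a) d) => [/f0 ->|da]; first by rewrite ps0E mul0r.
rewrite g0 ?ps0E ?mulr0 // -(ltn_add2l d); apply: leq_ltn_trans lm.
by rewrite -E mdegD leq_add2r.
Qed.

Lemma eqd0_any f : eqd 0 f 0. Proof. by []. Qed.

Lemma eqd_subl d f g : eqd d f g -> eqd d (f - g) 0.
Proof. by move/eqd_sub0. Qed.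
Lemma eqd_subr d f g : eqd d (f - g) 0 -> eqd d f g.
Proof. by move=> h; apply/eqd_sub0. Qed.

Lemma eqd1 f : f 0%MM = 0 <-> eqd 1 f 0.
Proof.
split=> [f0 m|f0]; last by rewrite f0 ?mdeg0.
by rewrite ltnS leqn0 mdeg_eq0 => /eqP ->.
Qed.

Lemma eqdM d f g f' g' : eqd d f f' -> eqd d g g' -> eqd d (f * g) (f' * g').
Proof.
move=> /eqd_sub0 ff /eqd_sub0 gg; apply/eqd_sub0.
have -> : f * g - f' * g' = (f - f') * g + f' * (g - g') by ring.
rewrite -[0]addr0; apply: eqdD.
  by rewrite -[d]addn0; apply: eqd0M.
by rewrite -[d]add0n; apply: eqd0M.
Qed.

Lemma eqdX d f f' k : eqd d f f' -> eqd d (f ^+ k) (f' ^+ k).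
Proof. by move=> ff; elim: k => // k IH; rewrite !exprS; apply: eqdM. Qed.

Lemma eqd_prod d (I : Type) (r : seq I) (Pr : pred I) (F F' : I -> series R n) :
  (forall i, eqd d (F i) (F' i)) ->
  eqd d (\prod_(i <- r | Pr i) F i) (\prod_(i <- r | Pr i) F' i).
Proof. by move=> FF; elim/big_rec2: _ => // i y1 y2 _ ?; apply: eqdM. Qed.

Lemma eqd0X d f k : eqd d f 0 -> eqd (k * d) (f ^+ k) 0.
Proof.
by move=> f0; elim: k => [|k IH] //; rewrite exprS mulSn; apply: eqd0M.
Qed.

Lemma eqd_bump f g d : (forall m, mdeg m = d -> f m = g m) -> eqd d f g -> eqd d.+1 f g.
Proof.
move=> e fg m; rewrite ltnS leq_eqVlt => /orP[/eqP|]; [exact: e|exact: fg].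
Qed.

(** The parts of lowest degree of f and g are polynomials whose product is the part of degree d + e
    of fg, and [{mpoly C[n]}] is a domain. Applied to (f - g)(f + g), this decides the sign of a
    square root. *)
Lemma ord_mul d e f g : eqd d f 0 -> eqd e g 0 -> eqd (d + e).+1 (f * g) 0 ->
  eqd d.+1 f 0 \/ eqd e.+1 g 0.
Proof.
move=> f0 g0 fg0; pose P := trunc d f; pose Q := trunc e g.
have PE m : P@_m = if (mdeg m == d) then f m else 0.
  case: (ltngtP (mdeg m) d) => [lt|gt|eqm]; last by rewrite truncE ?eqm.
    by rewrite truncE ?f0 // ltnW.
  rewrite raddf_sum big1 //= => a _; rewrite mcoeffZ mcoeffX.
  case: eqP => [am|]; last by rewrite mulr0.
  by have := bmdeg a; rewrite am ltnNge gt.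
have QE m : Q@_m = if (mdeg m == e) then g m else 0.
  case: (ltngtP (mdeg m) e) => [lt|gt|eqm]; last by rewrite truncE ?eqm.
    by rewrite truncE ?g0 // ltnW.
  rewrite raddf_sum big1 //= => a _; rewrite mcoeffZ mcoeffX.
  case: eqP => [am|]; last by rewrite mulr0.
  by have := bmdeg a; rewrite am ltnNge gt.
have PQ0 : P * Q = 0.
  apply/mpolyP => m; rewrite mcoeff0.
  pose p : series R n := fun k => P@_k; pose q : series R n := fun k => Q@_k.
  have -> : (P * Q)@_m = (p * q) m by rewrite psmul_coef mcoeffM.
  case: (mdeg m =P (d + e)%N) => [eqm|nem]; last first.
    apply: psmul_eq0 => a b E; rewrite /p /q PE QE.
    case: eqP => [ea|]; last by rewrite mul0r.
    case: eqP => [eb|]; last by rewrite mulr0.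
    by case: nem; rewrite -E mdegD ea eb.
  rewrite -[RHS](fg0 m) ?eqm //; apply: psmul_ext => a b E; rewrite /p /q PE QE.
  have {}E : (mdeg a + mdeg b = d + e)%N by rewrite -mdegD E.
  case: (ltngtP (mdeg a) d) => [lt|gt|ea].
  - by rewrite f0 // ps0E !mul0r.
  - rewrite [g b]g0 ?mulr0 ?ps0E ?mul0r //.
    by rewrite -(ltn_add2l (mdeg a)) E ltn_add2r.
  have -> : mdeg b = e by apply/eqP; rewrite -(eqn_add2l (mdeg a)) E ea.
  by rewrite eqxx.
move/eqP: PQ0; rewrite mulf_eq0 => /orP[]/eqP E0; [left|right];
  apply: eqd_bump => // m em.
  by have := PE m; rewrite em eqxx E0 mcoeff0.
by have := QE m; rewrite em eqxx E0 mcoeff0.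
Qed.

Lemma psX_coef (i : 'I_n) m : psX R i m = (m == U_(i)%MM)%:R. Proof. by []. Qed.
Lemma psX0 (i : 'I_n) : psX R i 0%MM = 0.
Proof.
rewrite /psX; case: eqP => // /(congr1 (@mdeg n)).
by rewrite mdeg0 mdeg1.
Qed.

End SeriesRing.

#[global] Opaque psmul trunc.

(** * Composition and inversion of formal maps *)

Section Composition.
Variable R : realType.
Local Notation C := R[i].

Definition pointed k n (G : formal_map R k n) := forall i, G i 0%MM = 0.

Definition mono k n (G : formal_map R k n) (a : 'X_{1..n}) : series R k :=
  \prod_(i < n) G i ^+ a i.

Definition eqdm d k n (F G : formal_map R k n) := forall i, eqd d (F i) (G i).

Lemma agreeX k d (f : series R k) P e : agree d f P -> agree d (f ^+ e) (P ^+ e).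
Proof.
move=> fP; elim: e => [|e IH]; first by rewrite !expr0; apply: agree1.
by rewrite !exprS; apply: agreeM.
Qed.

Lemma agree_prod k d (I : Type) (r : seq I) (F : I -> series R k) P :
  (forall i, agree d (F i) (P i)) ->
  agree d (\prod_(i <- r) F i) (\prod_(i <- r) P i).
Proof.
by move=> FP; elim/big_rec2: _ => [|i y1 y2 _ IH]; [apply: agree1|apply: agreeM].
Qed.

Section Mono.
Variables (k n : nat).
Implicit Types (G H : formal_map R k n) (a b : 'X_{1..n}).

Lemma mono0 G : mono G 0%MM = 1.
Proof. by apply: big1 => i _; rewrite mnm0E. Qed.

Lemma monoD G a b : mono G (a + b)%MM = mono G a * mono G b.
Proof. by rewrite -big_split; apply: eq_bigr => i _; rewrite mnmDE exprD. Qed.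

Lemma monoU G i : mono G U_(i)%MM = G i.
Proof.
rewrite /mono (bigD1 i) //= mnm1E eqxx expr1 big1 ?mulr1 // => j ji.
by rewrite mnm1E eq_sym (negbTE ji).
Qed.

Lemma mdeg_gt0 a : (0 < mdeg a)%N -> exists i b, a = (U_(i) + b)%MM.
Proof.
move=> a0; have [i ai] : exists i, (0 < a i)%N.
  apply: contrapT => H; move: a0; rewrite mdegE big1 // => i _.
  by apply/eqP; rewrite -leqn0 leqNgt; apply/negP => ai; apply: H; exists i.
exists i, (a - U_(i))%MM; rewrite addmC submK //.
by apply/mnm_lepP => j; rewrite mnm1E; case: eqP => // <-.
Qed.

Lemma mono_ord G a : pointed G -> eqd (mdeg a) (mono G a) 0.
Proof.
move=> G0; move: a; suff H d : forall a, mdeg a = d -> eqd d (mono G a) 0.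
  by move=> a; apply: H.
elim: d => [|d IH] a ad; first exact: eqd0_any.
have [|i [b ab]] := @mdeg_gt0 a; first by rewrite ad.
rewrite ab monoD monoU -add1n; apply: eqd0M; first exact/eqd1/G0.
by apply: IH; move: ad; rewrite ab mdegD mdeg1 add1n => -[].
Qed.

Lemma mono_eqd G H a d : eqdm d G H -> eqd d (mono G a) (mono H a).
Proof. by move=> GH; apply: eqd_prod => i; apply: eqdX. Qed.

(** Telescoping replaces one factor at a time: the changed factor contributes order d, and at least
    e other ones order 1 each. This gain makes the later fixpoint maps contracting. *)
Lemma mono_diff e G H a d : pointed G -> pointed H -> (e < mdeg a)%N ->
  eqdm d G H -> eqd (d + e) (mono G a) (mono H a).
Proof.
move=> G0 H0 ea GH; elim: e a ea => [|e IH] a ea.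
  by rewrite addn0; apply: mono_eqd.
have [|i [b ab]] := @mdeg_gt0 a; first exact: leq_ltn_trans ea.
have eb : (e < mdeg b)%N by move: ea; rewrite ab mdegD mdeg1 add1n ltnS.
rewrite ab !monoD !monoU; apply: eqd_subr.
have -> : G i * mono G b - H i * mono H b =
  (G i - H i) * mono G b + H i * (mono G b - mono H b) by ring.
rewrite -[0]addr0; apply: eqdD.
  apply: eqd0M; first exact/eqd_subl/GH.
  by apply: eqd_le eb _; apply: mono_ord.
rewrite addnS -add1n; apply: eqd0M; first exact/eqd1/H0.
by apply/eqd_subl/IH.
Qed.

Lemma mcoeff_comp_agree (f : series R n) G (P : {mpoly C[n]}) d m :
  pointed G -> (mdeg m <= d)%N -> agree d f P ->
  (P \mPo [tuple trunc d (G i) | i < n])@_m =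
  \sum_(a : 'X_{1..n < d.+1}) f a * mono G a m.
Proof.
move=> G0 md fP; set T := [tuple _ | _ < _].
(* The bound covers both the support of P and the degrees up to d; monomials of degree beyond d do
   not reach m, since G has no constant term. *)
rewrite (@comp_mpolywE _ _ _ P T (maxn (msize P) d.+1)) ?leq_maxl //.
rewrite raddf_sum /=.
have E a : (P@_a *: \prod_(i < n) tnth T i ^+ a i)@_m = P@_a * mono G a m.
  rewrite mcoeffZ; congr (_ * _); apply: (@agree_prod _ d) => // i.
  by apply: agreeX; rewrite tnth_mktuple; apply: agree_trunc.
under eq_bigr do rewrite E.
rewrite (@bsum_widen _ _ d.+1 _ (fun a => P@_a * mono G a m)) ?leq_maxr //.
  by apply: eq_bigr => a _; rewrite fP // -ltnS bmdeg.
move=> a da; rewrite [mono G a m](mono_ord G0) ?ps0E ?mulr0 //.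
by apply: leq_trans da.
Qed.

Lemma pscompE (f : series R n) G m d : pointed G -> (mdeg m < d)%N ->
  pscomp f G m = \sum_(a : 'X_{1..n < d}) f a * mono G a m.
Proof.
move=> G0 md; rewrite /pscomp.
rewrite (mcoeff_comp_agree G0 (leqnn _) (@agree_trunc _ _ _ f)).
apply/esym/(@bsum_widen _ _ _ _ (fun a => f a * mono G a m)) => // a da.
by rewrite [mono G a m](mono_ord G0) ?ps0E ?mulr0.
Qed.

Lemma mcoeff_comp (f : series R n) G (P : {mpoly C[n]}) d m :
  pointed G -> (mdeg m <= d)%N -> agree d f P ->
  (P \mPo [tuple trunc d (G i) | i < n])@_m = pscomp f G m.
Proof.
move=> G0 md fP; rewrite (mcoeff_comp_agree G0 md fP).
by rewrite -(@pscompE _ _ _ d.+1).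
Qed.

Lemma pscomp_fin (f : series R n) G d : pointed G ->
  eqd d (pscomp f G) (\sum_(a : 'X_{1..n < d}) f a *: mono G a).
Proof. by move=> G0 m md; rewrite (pscompE f G0 md) pssumE. Qed.

Lemma pscompD (f g : series R n) G : pointed G ->
  pscomp (f + g) G = pscomp f G + pscomp g G.
Proof.
move=> G0; apply/funext => m; rewrite psaddE !(pscompE _ G0 (ltnSn _)) -big_split.
by apply: eq_bigr => a _; rewrite psaddE mulrDl.
Qed.

Lemma pscompZ c (f : series R n) G : pointed G -> pscomp (c *: f) G = c *: pscomp f G.
Proof.
move=> G0; apply/funext => m; rewrite pszE !(pscompE _ G0 (ltnSn _)) mulr_sumr.
by apply: eq_bigr => a _; rewrite pszE mulrA.
Qed.

Lemma pscomp0 G : pointed G -> pscomp 0 G = 0.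
Proof. by move=> G0; rewrite -[0](scale0r 0) pscompZ // !scale0r. Qed.

Lemma pscompN (f : series R n) G : pointed G -> pscomp (- f) G = - pscomp f G.
Proof. by move=> G0; rewrite -scaleN1r pscompZ // scaleN1r. Qed.

Lemma pscompB (f g : series R n) G : pointed G ->
  pscomp (f - g) G = pscomp f G - pscomp g G.
Proof. by move=> G0; rewrite pscompD ?pscompN. Qed.

Lemma pscomp_sum (I : Type) (r : seq I) (Pr : pred I) (F : I -> series R n) G :
  pointed G -> pscomp (\sum_(i <- r | Pr i) F i) G = \sum_(i <- r | Pr i) pscomp (F i) G.
Proof.
by move=> G0; elim/big_rec2: _ => [|i y1 y2 _ <-]; rewrite ?pscomp0 ?pscompD.
Qed.

Lemma pscompM (f g : series R n) G : pointed G ->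
  pscomp (f * g) G = pscomp f G * pscomp g G.
Proof.
move=> G0; apply/funext => m; set d := mdeg m.
have fP := @agree_trunc R n d f; have gP := @agree_trunc R n d g.
rewrite -(mcoeff_comp G0 (leqnn _) (agreeM fP gP)) rmorphM /=.
by apply: (mcoeffM_agree (leqnn _)) => a ad; apply: mcoeff_comp.
Qed.

Lemma pscomp_psX i G : pointed G -> pscomp (psX R i) G = G i.
Proof.
move=> G0; apply/funext => m.
rewrite (@pscompE _ _ _ (mdeg m).+2) //.
rewrite (@bsum1 _ _ _ U_(i)%MM (fun a => psX R i a * mono G a m)) ?mdeg1 //.
  by rewrite psX_coef eqxx mul1r monoU.
by move=> b /negbTE bi; rewrite psX_coef bi mul0r.
Qed.

Lemma pscomp1 G : pointed G -> pscomp 1 G = 1.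
Proof.
move=> G0; apply/funext => m; rewrite (pscompE _ G0 (ltnSn _)).
rewrite (@bsum1 _ _ _ 0%MM (fun a => (1 : series R n) a * mono G a m)) ?mdeg0 //.
  by rewrite ps1E eqxx mul1r mono0.
by move=> b /negbTE bi; rewrite ps1E bi mul0r.
Qed.

Lemma pscompXn (f : series R n) e G : pointed G -> pscomp (f ^+ e) G = pscomp f G ^+ e.
Proof.
move=> G0; elim: e => [|e IH]; first by rewrite !expr0 pscomp1.
by rewrite !exprS pscompM ?IH.
Qed.

Lemma pscomp_prod (I : Type) (r : seq I) (Pr : pred I) (F : I -> series R n) G :
  pointed G ->
  pscomp (\prod_(i <- r | Pr i) F i) G = \prod_(i <- r | Pr i) pscomp (F i) G.
Proof.
by move=> G0; elim/big_rec2: _ => [|i y1 y2 _ <-]; rewrite ?pscomp1 ?pscompM.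
Qed.

Lemma pscomp_at0 (f : series R n) G : pointed G -> pscomp f G 0%MM = f 0%MM.
Proof.
move=> G0; rewrite (@pscompE _ _ _ 1) ?mdeg0 //.
rewrite (@bsum1 _ _ _ 0%MM (fun a => f a * mono G a 0%MM)) ?mdeg0 //.
  by rewrite mono0 ps1E eqxx mulr1.
move=> b b0; rewrite [mono G b _](mono_ord G0) ?ps0E ?mulr0 // mdeg0.
by rewrite lt0n mdeg_eq0.
Qed.

Lemma eqd_compl (f f' : series R n) G d : pointed G -> eqd d f f' ->
  eqd d (pscomp f G) (pscomp f' G).
Proof.
move=> G0 ff m md; rewrite !(pscompE _ G0 md).
by apply: eq_bigr => a _; rewrite ff ?bmdeg.
Qed.

Lemma eqd_compr (f : series R n) G H d : pointed G -> pointed H -> eqdm d G H ->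
  eqd d (pscomp f G) (pscomp f H).
Proof.
move=> G0 H0 GH m md; rewrite (pscompE _ G0 md) (pscompE _ H0 md).
by apply: eq_bigr => a _; rewrite (mono_eqd a GH).
Qed.

Lemma eqd_compr_ord e (f : series R n) G H d : pointed G -> pointed H ->
  eqd e.+1 f 0 -> eqdm d G H -> eqd (d + e) (pscomp f G) (pscomp f H).
Proof.
move=> G0 H0 f0 GH m md; rewrite (pscompE _ G0 md) (pscompE _ H0 md).
apply: eq_bigr => a _; case: (ltnP (mdeg a) e.+1) => [/f0 ->|ae].
  by rewrite ps0E !mul0r.
by rewrite (mono_diff G0 H0 ae GH).
Qed.

Lemma eqd_compr2 (f : series R n) G H d : pointed G -> pointed H -> eqd 2 f 0 ->
  eqdm d G H -> eqd d.+1 (pscomp f G) (pscomp f H).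
Proof. by move=> G0 H0 f0 GH; rewrite -addn1; apply: eqd_compr_ord f0 GH. Qed.

End Mono.

#[global] Opaque pscomp.

Lemma mono_comp j k n (G : formal_map R k n) (H : formal_map R j k) a :
  pointed H -> pscomp (mono G a) H = mono (mcomp G H) a.
Proof.
move=> H0; rewrite /mono pscomp_prod //; apply: eq_bigr => i _.
exact: pscompXn.
Qed.

Lemma pointed_comp j k n (G : formal_map R k n) (H : formal_map R j k) :
  pointed G -> pointed H -> pointed (mcomp G H).
Proof. by move=> G0 H0 i; rewrite /mcomp pscomp_at0. Qed.

(** Modulo degree d, f is a finite combination of monomials, and substitution of H is a ring
    morphism that respects the congruence. *)
Lemma pscompA j k n (f : series R n) (G : formal_map R k n) (H : formal_map R j k) :
  pointed G -> pointed H -> pscomp (pscomp f G) H = pscomp f (mcomp G H).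
Proof.
move=> G0 H0; apply: eqd_eq => d.
have E1 := eqd_compl H0 (pscomp_fin f (d := d) G0).
have E2 := pscomp_fin f (d := d) (pointed_comp G0 H0).
apply: (eqd_trans E1); apply: eqd_sym; apply: (eqd_trans E2).
rewrite pscomp_sum //; apply: eqd_sum => a.
by rewrite pscompZ // mono_comp.
Qed.

Lemma mcompA i j k n (F : formal_map R k n) (G : formal_map R j k)
    (H : formal_map R i j) : pointed G -> pointed H ->
  mcomp F (mcomp G H) = mcomp (mcomp F G) H.
Proof. by move=> G0 H0; apply/funext => l; rewrite /mcomp pscompA. Qed.

Lemma mono_mid n (a m : 'X_{1..n}) : mono (@mid R n) a m = (a == m)%:R.
Proof.
rewrite -mcoeffX mpolyXE_id; apply/esym; apply: (@agree_prod _ (mdeg m)) => // i.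
apply: agreeX => b _; rewrite mcoeffX /mid /psX eq_sym.
by [].
Qed.

Lemma pointed_mid n : pointed (@mid R n).
Proof. by move=> i; apply: psX0. Qed.

Lemma pscomp_mid n (f : series R n) : pscomp f mid = f.
Proof.
apply/funext => m; rewrite (pscompE _ (@pointed_mid _) (ltnSn _)).
rewrite (@bsum1 _ _ _ m (fun a => f a * mono mid a m)) //.
  by rewrite mono_mid eqxx mulr1.
by move=> b /negbTE bm; rewrite mono_mid bm mulr0.
Qed.

Lemma mcomp_mid k n (F : formal_map R k n) : mcomp F mid = F.
Proof. by apply/funext => i; apply: pscomp_mid. Qed.

Lemma mid_mcomp k n (F : formal_map R k n) : pointed F -> mcomp mid F = F.
Proof. by move=> F0; apply/funext => i; apply: pscomp_psX. Qed.

Definition linpart n (f : series R n) : series R n := \sum_(i < n) f U_(i)%MM *: psX R i.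

Lemma linpart_coef n (f : series R n) m :
  linpart f m = if mdeg m == 1%N then f m else 0.
Proof.
rewrite /linpart pssumE; case: (mdeg m =P 1%N) => [/eqP/mdeg1P[i /eqP ->]|m1].
  rewrite (bigD1 i) //= pszE psX_coef eqxx mulr1 big1 ?addr0 // => j ji.
  rewrite pszE psX_coef; case: eqP => [/mnmP/(_ i)|]; last by rewrite mulr0.
  by rewrite !mnm1E eqxx (negbTE ji).
apply: big1 => i _; rewrite pszE psX_coef; case: eqP => [E|]; last by rewrite mulr0.
by case: m1; rewrite E mdeg1.
Qed.

(** What remains of an equation once its affine part is solved: it has order 2, so substituting into
    it gains a degree. *)
Definition hipart n (f : series R n) : series R n :=
  f - (f 0%MM)%:A - linpart f.

Lemma hipart_ord n (f : series R n) : eqd 2 (hipart f) 0.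
Proof.
move=> m; rewrite /hipart !psaddE !psoppE pszE ps1E linpart_coef ps0E.
case: (posnP (mdeg m)) => [/eqP|m0 m2].
  by rewrite mdeg_eq0 => /eqP -> _; rewrite eqxx mdeg0 /= mulr1 subrr subr0.
have -> : mdeg m = 1%N by apply/eqP; rewrite eqn_leq m0 andbT -ltnS.
by rewrite -mdeg_eq0 -leqn0 leqNgt m0 /= mulr0 subr0 subrr.
Qed.

Lemma hipart_split n (f : series R n) : f = (f 0%MM)%:A + linpart f + hipart f.
Proof. by rewrite /hipart; ring. Qed.

Lemma pscomp_split k n (f : series R n) (G : formal_map R k n) : pointed G ->
  pscomp f G = (f 0%MM)%:A + \sum_(i < n) f U_(i)%MM *: G i + pscomp (hipart f) G.
Proof.
move=> G0; rewrite {1}[f]hipart_split !pscompD // pscompZ // pscomp1 //.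
rewrite /linpart pscomp_sum //; congr (_ + _ + _).
by apply: eq_bigr => i _; rewrite pscompZ // pscomp_psX.
Qed.

Lemma pscomp_ord2 k n (f : series R n) (G : formal_map R k n) : pointed G ->
  eqd 2 f 0 -> eqd 2 (pscomp f G) 0.
Proof. by move=> G0 f0; rewrite -(pscomp0 G0); apply: eqd_compl. Qed.

Lemma pscomp_linear_coef k n (f : series R n) (G : formal_map R k n) j : pointed G ->
  pscomp f G U_(j)%MM = \sum_(i < n) f U_(i)%MM * G i U_(j)%MM.
Proof.
move=> G0; rewrite pscomp_split // !psaddE pszE ps1E.
rewrite [pscomp _ _ _](pscomp_ord2 G0 (@hipart_ord _ f)) ?mdeg1 // ps0E addr0.
rewrite -mdeg_eq0 mdeg1 mulr0 add0r pssumE.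
by apply: eq_bigr => i _; rewrite pszE.
Qed.

Lemma jacobian0_comp n (F G : formal_map R n n) : pointed G ->
  jacobian0 (mcomp F G) = jacobian0 F *m jacobian0 G.
Proof.
move=> G0; apply/matrixP => i j; rewrite !mxE /mcomp pscomp_linear_coef //.
by apply: eq_bigr => l _; rewrite !mxE.
Qed.

Lemma jacobian0_mid n : jacobian0 (@mid R n) = 1%:M.
Proof.
apply/matrixP => i j; rewrite !mxE /mid psX_coef; congr (_%:R); congr nat_of_bool.
apply/eqP/eqP => [/mnmP/(_ j)|-> //]; rewrite !mnm1E eqxx.
by case: eqP.
Qed.

(** T is contracting for the degree filtration: the iterates from 0 stabilize degree by degree, and
    the coefficient of m is already final in the iterate of rank |m| + 1. *)
Lemma formal_fixpoint k n (T : formal_map R k n -> formal_map R k n) :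
  (forall G, pointed G -> pointed (T G)) ->
  (forall d G H, pointed G -> pointed H -> eqdm d G H -> eqdm d.+1 (T G) (T H)) ->
  exists2 G, pointed G & T G = G.
Proof.
move=> T0 TT; pose S e := iter e T (fun _ => 0).
have S0 e : pointed (S e) by elim: e => // e; apply: T0.
have Sn e e' : eqdm e (S e) (S (e + e')%N).
  by elim: e => [|e IH] // ; apply: TT.
pose G : formal_map R k n := fun i m => S (mdeg m).+1 i m.
have GS e : eqdm e G (S e) by move=> i m me; rewrite /G -(subnKC me); apply: Sn.
exists G; first by move=> i; apply: S0.
have G0 : pointed G by move=> i; apply: S0.
apply/funext => i; apply: eqd_eq => d; apply: (@eqd_le _ _ _ d.+1) => //.
apply: eqd_trans (TT d G (S d) _ _ _ i) _ => //.
exact/eqd_sym/(GS d.+1).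
Qed.

(** With J the linear part of F, the equation F G = id reads G = J^-1 (id - hipart F o G), whose
    right-hand side gains a degree. *)
Lemma formal_right_inverse n (F : formal_map R n n) : biholo F ->
  exists2 G, pointed G & mcomp F G = mid.
Proof.
move=> [F0 uF]; pose J := jacobian0 F; pose V := invmx J.
pose T (G : formal_map R n n) : formal_map R n n := fun i =>
  \sum_(j < n) V i j *: (psX R j - pscomp (hipart (F j)) G).
have [||G G0 TG] := @formal_fixpoint _ _ T.
- move=> G G0 i; rewrite /T pssumE big1 // => j _.
  rewrite pszE psaddE psoppE psX0 (pscomp_ord2 G0 (@hipart_ord _ _)) ?mdeg0 //.
  by rewrite ps0E subr0 mulr0.
- move=> d G H G0 H0 GH i; apply: eqd_sum => j; apply: eqdZ; apply: eqdB; first exact: eqd_refl.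
  by apply: eqd_compr2 G0 H0 _ GH; apply: hipart_ord.
exists G => //; apply/funext => i; rewrite /mcomp pscomp_split // F0 scale0r add0r.
have -> : \sum_(l < n) F i U_(l)%MM *: G l = \sum_(l < n) J i l *: T G l.
  by apply: eq_bigr => l _; rewrite mxE TG.
under eq_bigr => l _.
  rewrite /T scaler_sumr; under eq_bigr do rewrite scalerA.
  over.
rewrite exchange_big /=.
under eq_bigr => j _.
  rewrite -scaler_suml; have -> : \sum_(l < n) J i l * V l j = (J *m V) i j by rewrite mxE.
  rewrite mulmxV // mxE.
  over.
rewrite (bigD1 i) //= eqxx scale1r big1 ?addr0 ?subrK // => j ji.
by rewrite eq_sym (negbTE ji) scale0r.
Qed.

Lemma biholo_pointed n (F : formal_map R n n) : biholo F -> pointed F.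
Proof. by case. Qed.

(** The right inverse G has an invertible linear part, hence a right inverse H of its own, and F = F
    G H = H. *)
Lemma two_sided_inverse n (F : formal_map R n n) : biholo F ->
  exists G, mcomp F G = mid /\ mcomp G F = mid.
Proof.
move=> bF; have [G G0 FG] := formal_right_inverse bF.
have bG : biholo G.
  split=> //; have := jacobian0_comp F G0; rewrite FG jacobian0_mid => /esym E.
  by have [] := mulmx1_unit E.
have [H H0 GH] := formal_right_inverse bG; exists G; split; first exact: FG.
suff -> : F = H by [].
by rewrite -[F]mcomp_mid -GH (mcompA F G0 H0) FG (mid_mcomp H0).
Qed.

Lemma minvP n (F : formal_map R n n) : biholo F ->
  mcomp F (minv F) = mid /\ mcomp (minv F) F = mid.
Proof.
move=> bF; rewrite /minv; case: pselect => [e|[]]; last exact: two_sided_inverse.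
by case: (cid e).
Qed.

Lemma pointed_minv n (F : formal_map R n n) : biholo F -> pointed (minv F).
Proof.
move=> bF; have [G G0 FG] := formal_right_inverse bF.
have [_ IF] := minvP bF; suff -> : minv F = G by [].
by rewrite -[minv F]mcomp_mid -FG mcompA ?IF ?mid_mcomp //; apply: biholo_pointed.
Qed.

Lemma mcompKV n (F : formal_map R n n) : biholo F -> mcomp F (minv F) = mid.
Proof. by case/minvP. Qed.
Lemma mcompVK n (F : formal_map R n n) : biholo F -> mcomp (minv F) F = mid.
Proof. by case/minvP. Qed.

Lemma biholo_comp n (F G : formal_map R n n) : biholo F -> biholo G -> biholo (mcomp F G).
Proof.
move=> [F0 uF] [G0 uG]; split; first exact: pointed_comp.
by rewrite (jacobian0_comp F G0) unitmx_mul uF uG.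
Qed.

Lemma biholo_mid n : biholo (@mid R n).
Proof. by split; [apply: pointed_mid|rewrite jacobian0_mid unitmx1]. Qed.

Lemma jacobian0_minv n (F : formal_map R n n) : biholo F ->
  jacobian0 (minv F) = invmx (jacobian0 F).
Proof.
move=> bF; have := jacobian0_comp F (pointed_minv bF).
rewrite mcompKV // jacobian0_mid => /esym E; have [uF _] := mulmx1_unit E.
by rewrite -[LHS]mul1mx -(mulVmx uF) -mulmxA E mulmx1.
Qed.

Lemma biholo_minv n (F : formal_map R n n) : biholo F -> biholo (minv F).
Proof.
move=> bF; split; first exact: pointed_minv.
by rewrite jacobian0_minv // unitmx_inv; case: bF.
Qed.

Lemma mcompK n k (F : formal_map R n n) (X : formal_map R k n) :
  biholo F -> pointed X -> mcomp (minv F) (mcomp F X) = X.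
Proof.
move=> bF X0; rewrite mcompA ?mcompVK ?mid_mcomp //; exact: biholo_pointed.
Qed.

Lemma mcomp_inj n k (F : formal_map R n n) (X Y : formal_map R k n) :
  biholo F -> pointed X -> pointed Y -> mcomp F X = mcomp F Y -> X = Y.
Proof. by move=> bF X0 Y0 E; rewrite -(mcompK bF X0) E mcompK. Qed.

Lemma mcompKr n k (F : formal_map R n n) (X : formal_map R n k) :
  biholo F -> mcomp (mcomp X F) (minv F) = X.
Proof.
move=> bF; rewrite -mcompA ?mcompKV ?mcomp_mid //.
- exact: biholo_pointed.
- exact: pointed_minv.
Qed.

Lemma mcomp_injr n k (F : formal_map R n n) (X Y : formal_map R n k) :
  biholo F -> mcomp X F = mcomp Y F -> X = Y.
Proof. by move=> bF E; rewrite -(mcompKr X bF) E mcompKr. Qed.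

Lemma minv_uniq n (F G : formal_map R n n) : biholo F -> pointed G ->
  mcomp F G = mid -> minv F = G.
Proof. by move=> bF G0 E; rewrite -[minv F]mcomp_mid -E mcompK. Qed.

Lemma minvK n (F : formal_map R n n) : biholo F -> minv (minv F) = F.
Proof.
move=> bF; apply: minv_uniq; [exact: biholo_minv|exact: biholo_pointed|].
exact: mcompVK.
Qed.

Section Conjugate.
Variables (n k : nat).
Implicit Types (f g : series R n).

Lemma psconjD f g : psconj (f + g) = psconj f + psconj g.
Proof. by apply/funext => m; rewrite /psconj psaddE rmorphD. Qed.
Lemma psconjN f : psconj (- f) = - psconj f.
Proof. by apply/funext => m; rewrite /psconj psoppE rmorphN. Qed.
Lemma psconjZ c f : psconj (c *: f) = c^* *: psconj f.
Proof. by apply/funext => m; rewrite /psconj pszE rmorphM. Qed.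
Lemma psconjM f g : psconj (f * g) = psconj f * psconj g.
Proof.
apply/funext => m; rewrite /psconj !psmul_coef rmorph_sum.
by apply: eq_bigr => a _; rewrite rmorphM.
Qed.
Lemma psconj1 : psconj (1 : series R n) = 1.
Proof. by apply/funext => m; rewrite /psconj !ps1E rmorph_nat. Qed.
Lemma psconj_psX (i : 'I_n) : psconj (psX R i) = psX R i.
Proof. by apply/funext => m; rewrite /psconj !psX_coef rmorph_nat. Qed.
Lemma psconjK f : psconj (psconj f) = f.
Proof. by apply/funext => m; rewrite /psconj conjCK. Qed.
Lemma psconjX f e : psconj (f ^+ e) = psconj f ^+ e.
Proof. by elim: e => [|e IH]; rewrite ?expr0 ?psconj1 // !exprS psconjM IH. Qed.
Lemma psconj_prod (I : Type) (r : seq I) (Pr : pred I) (F : I -> series R n) :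
  psconj (\prod_(i <- r | Pr i) F i) = \prod_(i <- r | Pr i) psconj (F i).
Proof. by elim/big_rec2: _ => [|i y1 y2 _ <-]; rewrite ?psconj1 ?psconjM. Qed.
End Conjugate.

Lemma mconj_pointed n k (G : formal_map R k n) : pointed G -> pointed (mconj G).
Proof. by move=> G0 i; rewrite /mconj /psconj G0 rmorph0. Qed.

Lemma psconj_comp n k (f : series R n) (G : formal_map R k n) : pointed G ->
  psconj (pscomp f G) = pscomp (psconj f) (mconj G).
Proof.
move=> G0; apply/funext => m; rewrite {1}/psconj.
rewrite (pscompE _ G0 (ltnSn _)) (pscompE _ (mconj_pointed G0) (ltnSn _)).
rewrite rmorph_sum; apply: eq_bigr => a _; rewrite rmorphM; congr (_ * _).
rewrite -[LHS]/(psconj (mono G a) m) /mono psconj_prod.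
by congr (_ m); apply: eq_bigr => i _; rewrite psconjX.
Qed.

Lemma mconj_comp j k n (F : formal_map R k n) (G : formal_map R j k) : pointed G ->
  mconj (mcomp F G) = mcomp (mconj F) (mconj G).
Proof. by move=> G0; apply/funext => i; apply: psconj_comp. Qed.

Lemma mconjK n k (F : formal_map R k n) : mconj (mconj F) = F.
Proof. by apply/funext => i; apply: psconjK. Qed.

Lemma mconj_mid n : mconj (@mid R n) = mid.
Proof. by apply/funext => i; apply: psconj_psX. Qed.

Lemma biholo_mconj n (F : formal_map R n n) : biholo F -> biholo (mconj F).
Proof.
move=> [F0 uF]; split; first exact: mconj_pointed.
have -> : jacobian0 (mconj F) = map_mx Num.conj (jacobian0 F).
  by apply/matrixP => i j; rewrite !mxE.
by rewrite map_unitmx.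
Qed.

Lemma tangent_eqd n (F : formal_map R n n) : tangent_to_id F <-> eqdm 2 F mid.
Proof. by []. Qed.

Lemma tangent_biholo n (F : formal_map R n n) : tangent_to_id F -> biholo F.
Proof.
move=> F1; split; first by move=> i; rewrite F1 ?mdeg0 // psX0.
suff -> : jacobian0 F = 1%:M by rewrite unitmx1.
by rewrite -jacobian0_mid; apply/matrixP => i j; rewrite !mxE F1 ?mdeg1.
Qed.

Lemma tangent_jacobian n (F : formal_map R n n) :
  pointed F -> jacobian0 F = 1%:M -> tangent_to_id F.
Proof.
move=> F0 J i m; rewrite leq_eqVlt ltnS leqn0 mdeg_eq0 => /orP[/mdeg1P[j /eqP ->]|/eqP ->].
  by have := congr1 (fun M : 'M_n => M i j) J; rewrite -jacobian0_mid !mxE.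
by rewrite F0 psX0.
Qed.

Lemma mcompE j k n (F : formal_map R k n) (G : formal_map R j k) i :
  mcomp F G i = pscomp (F i) G.
Proof. by []. Qed.

Lemma mconjE k n (F : formal_map R k n) i : mconj F i = psconj (F i).
Proof. by []. Qed.

Lemma psconjE n (f : series R n) m : psconj f m = (f m)^*.
Proof. by []. Qed.

End Composition.

#[global] Opaque mcomp mconj psconj psX.

(** * Inverses, square roots, logarithms and weights *)

Section InverseSqrtLog.
Variables (R : realType) (n : nat).
Local Notation C := R[i].
Implicit Types f g u : series R n.

(** Both [psinv] and [pslog] cut their series in u at the degree of the coefficient wanted; as u^k
    has order k, a cut at any larger d gives the same coefficients. *)
Lemma eqd_geometric (c : nat -> C) f u d (P : nat -> {mpoly C[n]}) :
  u 0%MM = 0 ->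
  (forall m, f m = (\sum_(0 <= k < (mdeg m).+1) c k *: P (mdeg m) ^+ k)@_m) ->
  (forall e, agree e u (P e)) ->
  eqd d f (\sum_(0 <= k < d) c k *: u ^+ k).
Proof.
move=> u0 fE uP m md; rewrite fE raddf_sum pssumE /=.
rewrite [RHS](big_cat_nat (n := (mdeg m).+1)) //=.
rewrite [X in _ = _ + X]big_nat_cond [X in _ = _ + X]big1 ?addr0; last first.
  move=> k /andP[/andP[mk _] _]; rewrite pszE.
  have := eqd0X (k := k) ((eqd1 u).1 u0); rewrite muln1 => -> //; by rewrite ps0E mulr0.
by apply: eq_bigr => k _; rewrite mcoeffZ pszE (agreeX _ (uP _)).
Qed.

Lemma agreeB d f g P Q : agree d f P -> agree d g Q -> agree d (f - g) (P - Q).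
Proof. by move=> fP gQ m lemd; rewrite mcoeffB fP ?gQ. Qed.

Lemma agreeZ d c f P : agree d f P -> agree d (c *: f) (c *: P).
Proof. by move=> fP m lemd; rewrite mcoeffZ fP. Qed.

Lemma psinv_eqd f d : f 0%MM != 0 ->
  eqd d (psinv f) (\sum_(0 <= k < d) (f 0%MM)^-1 *: (1 - (f 0%MM)^-1 *: f) ^+ k).
Proof.
move=> f0; pose P e := 1 - (f 0%MM)^-1 *: trunc e f.
apply: (@eqd_geometric (fun=> _) _ _ _ P) => [|m|e].
- by rewrite psaddE psoppE pszE ps1E eqxx mulVf ?subrr.
- rewrite /psinv; set s := \sum_(_ <= _ < _) _.
  by rewrite -mcoeffZ scaler_sumr.
- by apply: agreeB; [apply: agree1|apply/agreeZ/agree_trunc].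
Qed.

Lemma mulVps f : f 0%MM != 0 -> psinv f * f = 1.
Proof.
move=> f0; apply: eqd_eq => d; set u := 1 - (f 0%MM)^-1 *: f.
apply: (eqd_trans (eqdM (psinv_eqd (d := d) f0) (@eqd_refl _ _ _ f))).
rewrite -/u -scaler_sumr -scalerAl scalerAr.
have -> : (f 0%MM)^-1 *: f = 1 - u by rewrite /u opprB addrC subrK.
rewrite mulrC big_mkord -opprB mulNr -subrX1 opprB.
rewrite -[X in eqd _ _ X]subr0; apply: eqdB => //.
have := eqd0X (k := d) ((eqd1 u).1 _); rewrite muln1; apply.
by rewrite /u psaddE psoppE pszE ps1E eqxx mulVf ?subrr.
Qed.

Lemma mulpsV f : f 0%MM != 0 -> f * psinv f = 1.
Proof. by move=> f0; rewrite mulrC mulVps. Qed.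

Lemma psinv_uniq f g : f 0%MM != 0 -> f * g = 1 -> psinv f = g.
Proof. by move=> f0 fg; rewrite -[psinv f]mulr1 -fg mulrA mulVps ?mul1r. Qed.

Lemma psinv0 f : f 0%MM != 0 -> psinv f 0%MM = (f 0%MM)^-1.
Proof.
move=> f0; have := congr1 (fun h : series R n => h 0%MM) (mulVps f0).
by rewrite /= psmul0 ps1E eqxx /= => /(canRL (mulfK f0)); rewrite mul1r.
Qed.

Lemma psinv0_neq0 f : f 0%MM != 0 -> psinv f 0%MM != 0.
Proof. by move=> f0; rewrite psinv0 // invr_eq0. Qed.

Lemma psinvK f : f 0%MM != 0 -> psinv (psinv f) = f.
Proof. by move=> f0; apply: psinv_uniq; [apply: psinv0_neq0|apply: mulVps]. Qed.

Lemma psmul0_neq0 f g : f 0%MM != 0 -> g 0%MM != 0 -> (f * g) 0%MM != 0.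
Proof. by move=> f0 g0; rewrite psmul0 mulf_neq0. Qed.

Lemma psinvM f g : f 0%MM != 0 -> g 0%MM != 0 -> psinv (f * g) = psinv f * psinv g.
Proof.
move=> f0 g0; apply: psinv_uniq; first exact: psmul0_neq0.
by rewrite mulrACA !mulpsV ?mulr1.
Qed.

Lemma psconj0_neq0 f : f 0%MM != 0 -> psconj f 0%MM != 0.
Proof. by move=> f0; rewrite psconjE conjC_eq0. Qed.

Lemma psinv_conj f : f 0%MM != 0 -> psconj (psinv f) = psinv (psconj f).
Proof.
move=> f0; apply/esym/psinv_uniq; first exact: psconj0_neq0.
by rewrite -psconjM mulpsV ?psconj1.
Qed.

Lemma psmul_cancel f g h : f 0%MM != 0 -> f * g = f * h -> g = h.
Proof. by move=> f0 E; rewrite -[g]mul1r -[h]mul1r -(mulVps f0) -!mulrA E. Qed.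

(** Writing f = c^2 (1 + h), the root is c (1 + G) with G = (h - G^2) / 2, a contracting equation
    because squaring gains a degree. *)
Lemma sqrt_exists f (c : C) : c != 0 -> c ^+ 2 = f 0%MM ->
  exists2 g, g * g = f & g 0%MM = c.
Proof.
move=> c0 cf; pose h : series R n := (c ^- 2) *: f - 1.
pose T (G : formal_map R n 1) : formal_map R n 1 := fun i =>
  2^-1 *: (h - G i * G i).
have h0 : h 0%MM = 0.
  by rewrite /h psaddE psoppE pszE ps1E eqxx -cf mulVf ?subrr // expf_eq0.
have [||G G0 TG] := @formal_fixpoint _ _ _ T.
- by move=> G G0 i; rewrite /T pszE psaddE psoppE psmul0 h0 G0 mul0r subr0 mulr0.
- move=> d G H G0 H0 GH i; apply: eqdZ; apply: eqdB => //; apply: eqd_subr.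
  have -> : G i * G i - H i * H i = (G i - H i) * (G i + H i) by ring.
  rewrite -addn1; apply: eqd0M; first exact/eqd_subl/GH.
  by apply/eqd1; rewrite psaddE G0 H0 addr0.
exists (c *: (1 + G ord0)); last by rewrite pszE psaddE ps1E G0 eqxx addr0 mulr1.
have E : G ord0 *+ 2 + G ord0 * G ord0 = h.
  have := congr1 (fun F : formal_map R n 1 => 2 *: F ord0) TG.
  rewrite /T scalerA mulfV ?pnatr_eq0 // scale1r => /(canRL (subrK _)) ->.
  by rewrite scaler_nat.
rewrite -scalerAl -scalerAr scalerA -expr2.
have -> : (1 + G ord0) * (1 + G ord0) = 1 + (G ord0 *+ 2 + G ord0 * G ord0) by ring.
by rewrite E addrC subrK scalerA mulfV ?scale1r // expf_eq0.
Qed.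

Lemma sqrt_uniq f g : f * f = g * g -> f 0%MM = g 0%MM -> f 0%MM != 0 -> f = g.
Proof.
move=> E e0 f0; apply/eqP; rewrite -subr_eq0; apply/eqP.
have fg0 : (f + g) 0%MM != 0.
  by rewrite psaddE -e0 -mulr2n mulrn_eq0 negb_or.
apply: (psmul_cancel fg0); rewrite mulr0.
have -> : (f + g) * (f - g) = f * f - g * g by ring.
by rewrite E subrr.
Qed.

(** The value 0 at k = 0 lets the sum start at 0, the shape required by [eqd_geometric]. *)
Definition log_coef (k : nat) : C := if k is k'.+1 then (-1) ^+ k.+1 / k%:R else 0.

Lemma pslog_eqd f d : f 0%MM != 0 ->
  eqd d (pslog f) (\sum_(0 <= k < d) log_coef k *: ((f 0%MM)^-1 *: f - 1) ^+ k).
Proof.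
move=> f0; pose P e := (f 0%MM)^-1 *: trunc e f - 1.
apply: (@eqd_geometric _ _ _ _ P) => [|m|e].
- by rewrite psaddE psoppE pszE ps1E eqxx mulVf ?subrr.
- rewrite /pslog [in RHS]big_nat_recl // scale0r add0r.
  congr (mcoeff m _); rewrite big_add1 /=.
  by apply: eq_bigr => k _.
- by apply: agreeB; [apply/agreeZ/agree_trunc|apply: agree1].
Qed.

End InverseSqrtLog.

#[global] Opaque psinv pslog.

Section CompInverseLog.
Variables (R : realType) (k n : nat).
Implicit Types (f : series R n) (G : formal_map R k n).

Lemma psinv_comp f G : pointed G -> f 0%MM != 0 ->
  pscomp (psinv f) G = psinv (pscomp f G).
Proof.
move=> G0 f0; apply/esym/psinv_uniq; first by rewrite pscomp_at0.
by rewrite -pscompM // mulpsV ?pscomp1.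
Qed.

Lemma pslog_comp f G : pointed G -> f 0%MM != 0 ->
  pscomp (pslog f) G = pslog (pscomp f G).
Proof.
move=> G0 f0; apply: eqd_eq => d.
apply: (eqd_trans (eqd_compl G0 (pslog_eqd (d := d) f0))).
have g0 : pscomp f G 0%MM != 0 by rewrite pscomp_at0.
apply: eqd_sym; apply: (eqd_trans (pslog_eqd (d := d) g0)).
rewrite pscomp_sum // pscomp_at0 //; apply: eqd_sum => e.
by rewrite (pscompZ _ _ G0) (pscompXn _ _ G0) (pscompB _ _ G0) (pscompZ _ _ G0) (pscomp1 G0).
Qed.

End CompInverseLog.

(** * Coordinate substitutions and diagonal maps *)

Section LinearMaps.
Variable R : realType.
Local Notation C := R[i].

Definition pmap k n (s : 'I_n -> 'I_k) : formal_map R k n := fun i => psX R (s i).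
Definition dmap n (d : 'I_n -> C) : formal_map R n n := fun i => d i *: psX R i.

Lemma pointed_pmap k n (s : 'I_n -> 'I_k) : pointed (pmap s).
Proof. by move=> i; apply: psX0. Qed.
Lemma pointed_dmap n (d : 'I_n -> C) : pointed (dmap d).
Proof. by move=> i; rewrite /dmap pszE psX0 mulr0. Qed.

Lemma pmap_comp j k n (s : 'I_n -> 'I_k) (G : formal_map R j k) : pointed G ->
  mcomp (pmap s) G = fun i => G (s i).
Proof. by move=> G0; apply/funext => i; apply: pscomp_psX. Qed.

Lemma dmap_comp k n (d : 'I_n -> C) (G : formal_map R k n) : pointed G ->
  mcomp (dmap d) G = fun i => d i *: G i.
Proof. by move=> G0; apply/funext => i; rewrite !mcompE pscompZ // pscomp_psX. Qed.

Lemma dmap_dmap n (d e : 'I_n -> C) : mcomp (dmap d) (dmap e) = dmap (fun i => d i * e i).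
Proof.
rewrite dmap_comp; last exact: pointed_dmap.
by apply/funext => i; rewrite /dmap scalerA.
Qed.

Lemma dmap1 n : dmap (fun=> 1) = @mid R n.
Proof. by apply/funext => i; rewrite /dmap scale1r. Qed.

Lemma pmap_pmap j k n (s : 'I_n -> 'I_k) (t : 'I_k -> 'I_j) :
  mcomp (pmap s) (pmap t) = pmap (t \o s).
Proof. by rewrite pmap_comp //; apply: pointed_pmap. Qed.

Lemma mconj_pmap k n (s : 'I_n -> 'I_k) : mconj (pmap s) = pmap s.
Proof. by apply/funext => i; apply: psconj_psX. Qed.

Lemma jacobian0_dmap n (d : 'I_n -> C) : jacobian0 (dmap d) = diag_mx (\row_i d i).
Proof.
have J := @jacobian0_mid R n; apply/matrixP => i j.
have := congr1 (fun M : 'M_n => M i j) J; rewrite !mxE /mid => E.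
by rewrite /dmap pszE E; case: eqP; rewrite ?mulr1n ?mulr0n ?mulr1 ?mulr0.
Qed.

Lemma biholo_dmap n (d : 'I_n -> C) : (forall i, d i != 0) -> biholo (dmap d).
Proof.
move=> d0; split; first exact: pointed_dmap.
rewrite jacobian0_dmap unitmxE det_diag unitfE; apply/prodf_neq0 => i _.
by rewrite mxE.
Qed.

Lemma mono_dmap n (d : 'I_n -> C) a :
  mono (dmap d) a = (\prod_i d i ^+ a i) *: mono mid a.
Proof.
rewrite /mono /dmap /mid -scaler_prod; apply: eq_bigr => i _.
exact: exprZn.
Qed.

Lemma mnmU_eq n (i j : 'I_n) : (U_(i)%MM == U_(j)%MM :> 'X_{1..n}) = (i == j).
Proof.
apply/eqP/eqP => [/mnmP/(_ j)|-> //]; rewrite !mnm1E eqxx.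
by case: eqP.
Qed.

Lemma eqd_dmap_coef n (d : 'I_n -> C) (G : formal_map R n n) i j :
  eqdm 2 G (dmap d) -> G i U_(j)%MM = d i * (j == i)%:R.
Proof.
move=> Gd; have m1 : (mdeg U_(j)%MM < 2)%N by rewrite mdeg1.
by rewrite (Gd i _ m1) /dmap pszE psX_coef mnmU_eq.
Qed.

Lemma pscomp_dmap n (d : 'I_n -> C) (f : series R n) m :
  pscomp f (dmap d) m = f m * \prod_i d i ^+ m i.
Proof.
rewrite (pscompE _ (@pointed_dmap _ d) (ltnSn _)).
rewrite (@bsum1 _ _ _ m (fun a => f a * mono (dmap d) a m)) //.
  by rewrite mono_dmap pszE mono_mid eqxx mulr1.
by move=> b /negbTE bm; rewrite mono_dmap pszE mono_mid bm !mulr0.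
Qed.

Lemma involution_biholo n (F : formal_map R n n) : pointed F -> mcomp F F = mid ->
  biholo F.
Proof.
move=> F0 FF; split=> //; have := jacobian0_comp F F0.
by rewrite FF jacobian0_mid => /esym /mulmx1_unit [].
Qed.

End LinearMaps.

(** * Gradings by weights *)

Section Weights.
Variables (R : realType) (W : zmodType).
Local Notation C := R[i].

(** The group W is abstract because two gradings are used: the Z^p-grading of the torus, and the
    grading by eta-exponents modulo 2. *)
Definition wt n (w : 'I_n -> W) (m : 'X_{1..n}) : W := \sum_(i < n) w i *+ m i.
Definition weighted n (w : 'I_n -> W) (c : W) (f : series R n) :=
  forall m, f m != 0 -> wt w m = c.
Definition weightedm k n (v : 'I_k -> W) (w : 'I_n -> W) (G : formal_map R k n) :=
  forall i, weighted v (w i) (G i).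
Definition wproj n (w : 'I_n -> W) (c : W) (f : series R n) : series R n :=
  fun m => if wt w m == c then f m else 0.

Lemma wt0 n (w : 'I_n -> W) : wt w 0%MM = 0.
Proof. by apply: big1 => i _; rewrite mnm0E mulr0n. Qed.
Lemma wtD n (w : 'I_n -> W) a b : wt w (a + b)%MM = wt w a + wt w b.
Proof. by rewrite -big_split; apply: eq_bigr => i _; rewrite mnmDE mulrnDr. Qed.
Lemma wtU n (w : 'I_n -> W) i : wt w U_(i)%MM = w i.
Proof.
rewrite /wt (bigD1 i) //= mnm1E eqxx mulr1n big1 ?addr0 // => j ji.
by rewrite mnm1E eq_sym (negbTE ji) mulr0n.
Qed.

Section OneDomain.
Variables (n : nat) (w : 'I_n -> W).
Implicit Types f g u : series R n.

Lemma weighted1 : weighted w 0 (1 : series R n).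
Proof. by move=> m; rewrite ps1E; case: (m =P _) => [->|]; rewrite ?wt0 ?eqxx. Qed.
Lemma weighted_psX i : weighted w (w i) (psX R i).
Proof. by move=> m; rewrite psX_coef; case: (m =P _) => [->|]; rewrite ?wtU ?eqxx. Qed.
Lemma weightedM a b f g : weighted w a f -> weighted w b g -> weighted w (a + b) (f * g).
Proof.
move=> fa gb m; apply: contra_neqP => ab; apply: psmul_eq0 => x y xy.
case: (eqVneq (f x) 0) => [->|/fa fx]; first by rewrite mul0r.
case: (eqVneq (g y) 0) => [->|/gb gy]; first by rewrite mulr0.
by case: ab; rewrite -xy wtD fx gy.
Qed.
Lemma weightedXn a f e : weighted w a f -> weighted w (a *+ e) (f ^+ e).
Proof.
move=> fa; elim: e => [|e IH]; first by rewrite expr0 mulr0n; apply: weighted1.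
by rewrite exprS mulrS; apply: weightedM.
Qed.

Lemma wproj_weighted c f : weighted w c (wproj w c f).
Proof. by move=> m; rewrite /wproj; case: (_ =P c); rewrite ?eqxx. Qed.
Lemma wproj_id c f : weighted w c f -> wproj w c f = f.
Proof.
move=> fc; apply/funext => m; rewrite /wproj; case: eqP => // wm.
by apply/eqP; rewrite eq_sym; apply: contra_notT wm => /fc.
Qed.
End OneDomain.

Lemma weighted_mono k n (v : 'I_k -> W) (w : 'I_n -> W) (G : formal_map R k n) a :
  weightedm v w G -> weighted v (wt w a) (mono G a).
Proof.
move=> Gw; rewrite /mono /wt; elim/big_rec2: _ => [|i y1 y2 _ IH].
  exact: weighted1.
by apply: weightedM => //; apply: weightedXn.
Qed.

(** Substituting a homogeneous G sends each monomial of weight c to a series of weight c, so nothing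
    passes from one weight to another. *)
Lemma wproj_comp k n (v : 'I_k -> W) (w : 'I_n -> W) (G : formal_map R k n) c f :
  weightedm v w G -> pointed G -> pscomp (wproj w c f) G = wproj v c (pscomp f G).
Proof.
move=> Gw G0; apply/funext => m; rewrite {2}/wproj.
rewrite !(pscompE _ G0 (ltnSn _)); case: eqP => wm.
  apply: eq_bigr => a _; rewrite /wproj; case: eqP => // wa.
  case: (eqVneq (mono G a m) 0) => [->|]; first by rewrite !mulr0.
  by move/(weighted_mono Gw); rewrite wm => /esym.
apply: big1 => a _; rewrite /wproj; case: eqP => [wa|]; last by rewrite mul0r.
case: (eqVneq (mono G a m) 0) => [->|]; first by rewrite !mulr0.
by move/(weighted_mono Gw); rewrite wa.
Qed.

Lemma weighted_comp k n (v : 'I_k -> W) (w : 'I_n -> W) (G : formal_map R k n) c f :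
  weighted w c f -> weightedm v w G -> pointed G -> weighted v c (pscomp f G).
Proof.
move=> fc Gw G0; rewrite -(wproj_id fc) (wproj_comp _ _ Gw G0).
exact: wproj_weighted.
Qed.

Lemma mono_lin k n (G H : formal_map R k n) a : pointed G -> pointed H ->
  eqdm 2 G H -> eqd (mdeg a).+1 (mono G a) (mono H a).
Proof.
move=> G0 H0 GH; move: a; suff P d : forall a, mdeg a = d ->
    eqd d.+1 (mono G a) (mono H a) by move=> a; apply: P.
elim: d => [|d IH] a ad.
  by move/eqP: ad; rewrite mdeg_eq0 => /eqP ->; rewrite !mono0.
have [|i [b ab]] := @mdeg_gt0 n a; first by rewrite ad.
have bd : mdeg b = d by move: ad; rewrite ab mdegD mdeg1 add1n => -[].
rewrite ab !monoD !monoU; apply: eqd_subr.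
have -> : G i * mono G b - H i * mono H b =
  (G i - H i) * mono G b + H i * (mono G b - mono H b) by ring.
rewrite -[0]addr0; apply: eqdD.
  rewrite -addn2 addnC; apply: eqd0M; first exact/eqd_subl/GH.
  by rewrite -bd; apply: mono_ord.
rewrite -add1n; apply: eqd0M; first exact/eqd1/H0.
by apply/eqd_subl/IH.
Qed.

(** In degree d, a series of order d only sees the linear part of what is substituted. *)
Lemma eqd_comp_lin k n (f : series R n) (G H : formal_map R k n) d :
  pointed G -> pointed H -> eqdm 2 G H -> eqd d f 0 ->
  eqd d.+1 (pscomp f G) (pscomp f H).
Proof.
move=> G0 H0 GH f0 m md; rewrite (pscompE _ G0 md) (pscompE _ H0 md).
apply: eq_bigr => a _; case: (ltnP (mdeg a) d) => [/f0 ->|da].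
  by rewrite ps0E !mul0r.
rewrite (mono_lin G0 H0 GH (m := m)) //.
by apply: leq_trans md _; rewrite ltnS.
Qed.

(* The components of X of the wrong weight would have a lowest order term,
   which the equation X S = S' X multiplies by d^m - d_i. *)
Lemma weighted_of_conjugation n (w : 'I_n -> W) (d : 'I_n -> C)
    (S S' X : formal_map R n n) :
  pointed S -> pointed X -> weightedm w w S -> weightedm w w S' ->
  eqdm 2 S (dmap d) -> eqdm 2 S' (dmap d) ->
  (forall i (m : 'X_{1..n}), (0 < mdeg m)%N -> \prod_j d j ^+ m j = d i -> wt w m = w i) ->
  mcomp X S = mcomp S' X -> weightedm w w X.
Proof.
move=> S0 X0 wS wS' Sd S'd nres XS.
pose P : formal_map R n n := fun i => wproj w (w i) (X i).
pose Y : formal_map R n n := fun i => X i - P i.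
have P0 : pointed P by move=> i; rewrite /P /wproj X0; case: ifP.
have Pw : weightedm w w P by move=> i; apply: wproj_weighted.
have XE i : X i = P i + Y i by rewrite /Y [RHS]addrC subrK.
have S'0 : pointed S' by move=> i; rewrite (S'd i 0%MM) ?mdeg0 ?pointed_dmap.
have Yw i m : wt w m = w i -> Y i m = 0.
  by move=> wm; rewrite /Y psaddE psoppE /P /wproj wm eqxx subrr.
suff Y0 d' : eqdm d' Y 0.
  move=> i; have Yi : Y i = 0 by apply: eqd_eq => e; apply: Y0.
  have -> : X i = P i by rewrite XE Yi addr0.
  exact: Pw.
elim: d' => [|e IH] i; first exact: eqd0_any.
apply: eqd_bump; last exact: IH.
move=> m me; rewrite [RHS]ps0E.
case: (eqVneq (wt w m) (w i)) => [/Yw //|wm].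
case: (posnP (mdeg m)) => [/eqP|m0].
  by rewrite mdeg_eq0 => /eqP ->; rewrite /Y psaddE psoppE X0 P0 subrr.
have md : (mdeg m < e.+1)%N by rewrite me.
have z f : weighted w (w i) f -> f m = 0.
  by move=> fw; apply/eqP; apply: contraNT wm => /fw ->.
have := congr1 (fun F : formal_map R n n => F i m) XS; rewrite !mcompE {1}XE.
rewrite (pscompD _ _ S0) psaddE (z (pscomp (P i) S)); last exact: weighted_comp (Pw i) wS S0.
rewrite add0r (eqd_comp_lin S0 (@pointed_dmap _ _ d) Sd (IH i) md) pscomp_dmap.
rewrite (pscomp_split _ X0) S'0 scale0r add0r psaddE pssumE.
(* In degree e the nonlinear part of S' only sees P, whose contribution has weight w i and so no
   coefficient at m. *)
have hS' : weighted w (w i) (pscomp (hipart (S' i)) P).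
  apply: (weighted_comp _ Pw P0) => m'; rewrite /hipart !psaddE !psoppE pszE ps1E S'0 mul0r subr0.
  rewrite linpart_coef; case: (mdeg _ =P _) => _; first by rewrite subrr eqxx.
  by rewrite subr0; apply: wS'.
have XP : eqdm e X P.
  by move=> l; rewrite XE -[X in eqd _ _ X]addr0; apply: eqdD => //; apply: IH.
rewrite (eqd_compr2 X0 P0 (@hipart_ord _ _ _) XP md) (z _ hS') addr0.
have -> : \sum_(l < n) (S' i U_(l)%MM *: X l) m = d i * X i m.
  rewrite (bigD1 i isT) /= big1 ?addr0; last first.
    move=> l li; rewrite pszE (eqd_dmap_coef _ _ S'd) (negbTE li).
    by rewrite mulr0n mulr0 mul0r.
  by rewrite pszE (eqd_dmap_coef _ _ S'd) eqxx mulr1n mulr1.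
rewrite XE psaddE.
rewrite (z _ (Pw i)) add0r mulrC => /eqP; rewrite -subr_eq0 -mulrBl mulf_eq0 => /orP[|/eqP //].
rewrite subr_eq0 => /eqP /(nres _ _ m0) wmi; by rewrite wmi eqxx in wm.
Qed.

End Weights.

(** * Maps with torus symmetry *)

Section Glue.
Variables (R : realType) (p : nat).
Local Notation C := R[i].

Lemma split_l (j : 'I_p) : fintype.split (lshift p j) = inl j.
Proof. exact: (unsplitK (inl j)). Qed.
Lemma split_r (j : 'I_p) : fintype.split (rshift p j) = inr j.
Proof. exact: (unsplitK (inr j)). Qed.

Lemma glueL k (A B : formal_map R k p) j : glue A B (lshift p j) = A j.
Proof. by rewrite /glue split_l. Qed.
Lemma glueR k (A B : formal_map R k p) j : glue A B (rshift p j) = B j.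
Proof. by rewrite /glue split_r. Qed.

Lemma ord_lr (P : 'I_(p + p) -> Prop) :
  (forall j, P (lshift p j)) -> (forall j, P (rshift p j)) -> forall i, P i.
Proof. by move=> Pl Pr i; case: (split_ordP i) => j ->. Qed.

Lemma map_lr k (F G : formal_map R k (p + p)) :
  (forall j, F (lshift p j) = G (lshift p j)) ->
  (forall j, F (rshift p j) = G (rshift p j)) -> F = G.
Proof. by move=> Fl Fr; apply/funext; apply: ord_lr. Qed.

Definition lrfun (T : Type) (a b : 'I_p -> T) (i : 'I_(p + p)) : T :=
  match fintype.split i with inl j => a j | inr j => b j end.

Lemma lrfunL T (a b : 'I_p -> T) j : lrfun a b (lshift p j) = a j.
Proof. by rewrite /lrfun split_l. Qed.
Lemma lrfunR T (a b : 'I_p -> T) j : lrfun a b (rshift p j) = b j.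
Proof. by rewrite /lrfun split_r. Qed.

Lemma lr_sum (V : nmodType) (F : 'I_(p + p) -> V) :
  \sum_i F i = \sum_j (F (lshift p j) + F (rshift p j)).
Proof. by rewrite big_split_ord /= -big_split. Qed.
Lemma lr_prod (F : 'I_(p + p) -> C) :
  \prod_i F i = \prod_j (F (lshift p j) * F (rshift p j)).
Proof. by rewrite big_split_ord /= -big_split. Qed.

Lemma lrE : (forall j k : 'I_p, (lshift p j == lshift p k) = (j == k)) /\
  (forall j k : 'I_p, (rshift p j == rshift p k) = (j == k)) /\
  (forall j k : 'I_p, (lshift p j == rshift p k) = false) /\
  (forall j k : 'I_p, (rshift p j == lshift p k) = false).
Proof.
split; first exact: eq_lshift.
split; first exact: eq_rshift.
by split=> j k; rewrite ?eq_lrshift ?eq_rlshift.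
Qed.

Definition sw : 'I_(p + p) -> 'I_(p + p) := lrfun (@rshift p p) (@lshift p p).
Lemma swL j : sw (lshift p j) = rshift p j. Proof. exact: lrfunL. Qed.
Lemma swR j : sw (rshift p j) = lshift p j. Proof. exact: lrfunR. Qed.
Lemma swK : involutive sw.
Proof. by apply: ord_lr => j; rewrite !(swL, swR). Qed.

Lemma rho0E : @rho0 R p = pmap R sw.
Proof. by apply: map_lr => j; rewrite /rho0 /pmap ?(glueL, glueR) ?(swL, swR). Qed.

End Glue.

Section Torus.
Variables (R : realType) (p : nat).
Local Notation C := R[i].
Implicit Types (a b : 'I_p -> series R p) (f g : series R p).

Lemma xi_etaE (j : 'I_p) : xi_eta R j = psX R (lshift p j) * psX R (rshift p j).
Proof. by []. Qed.

Lemma pointed_xi_eta : pointed (@xi_eta R p).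
Proof. by move=> j; rewrite xi_etaE psmul0 psX0 mul0r. Qed.

Definition zcomp f : series R (p + p) := pscomp f (@xi_eta R p).

(** Exponent of zeta^b = xi^b eta^b in the 2p coordinates. *)
Definition dbl (b : 'X_{1..p}) : 'X_{1..p + p} := [multinom lrfun b b i | i < p + p].

Lemma dblL (b : 'X_{1..p}) j : dbl b (lshift p j) = b j. Proof. by rewrite mnmE lrfunL. Qed.
Lemma dblR (b : 'X_{1..p}) j : dbl b (rshift p j) = b j. Proof. by rewrite mnmE lrfunR. Qed.

Lemma mdeg_dbl (b : 'X_{1..p}) : mdeg (dbl b) = (mdeg b).*2.
Proof.
rewrite !mdegE lr_sum -addnn -big_split /=.
by apply: eq_bigr => j _; rewrite dblL dblR.
Qed.

Lemma mono_xi_eta (b : 'X_{1..p}) m : mono (@xi_eta R p) b m = (dbl b == m)%:R.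
Proof.
rewrite -mono_mid; congr (_ m); rewrite /mono big_split_ord /= -big_split /=.
by apply: eq_bigr => j _; rewrite dblL dblR xi_etaE exprMn.
Qed.

Lemma dbl_inj : injective dbl.
Proof. by move=> b c /mnmP E; apply/mnmP => j; rewrite -!dblL E. Qed.

Lemma zcomp_dbl f (b : 'X_{1..p}) : zcomp f (dbl b) = f b.
Proof.
rewrite /zcomp (pscompE _ pointed_xi_eta (ltnSn _)).
rewrite (@bsum1 _ _ _ b (fun c => f c * mono (@xi_eta R p) c (dbl b))).
- by rewrite mono_xi_eta eqxx mulr1.
- by rewrite mdeg_dbl ltnS -addnn leq_addr.
- move=> c cb; rewrite mono_xi_eta (_ : (_ == _) = false) ?mulr0 //.
  by apply: contraNF cb => /eqP /dbl_inj ->.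
Qed.

Lemma psmulX_coef n (h : series R n) i m : (h * psX R i) (m + U_(i))%MM = h m.
Proof.
set d := mdeg (m + U_(i))%MM.
have X : agree d (psX R i) 'X_i.
  by move=> k _; rewrite mcoeffX psX_coef eq_sym.
have dm : (mdeg m <= d)%N by rewrite /d mdegD leq_addr.
rewrite -psmulE -(mcoeffM_agree (leqnn _) (@agree_trunc _ _ _ h) X) addmC mcoeffMX.
by apply: truncE; rewrite mdegD leq_addl.
Qed.

Lemma psmulX_coef0 n (h : series R n) (i : 'I_n) (m : 'X_{1..n}) :
  m i = 0%N -> (h * psX R i) m = 0.
Proof.
move=> mi; apply: psmul_eq0 => x y xy; rewrite psX_coef.
case: eqP => [bi|]; last by rewrite mulr0.
by move: mi; rewrite -xy mnmDE bi mnm1E eqxx addnC.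
Qed.

Lemma mnm_subU n (m : 'X_{1..n}) i : (0 < m i)%N -> exists m', m = (m' + U_(i))%MM.
Proof.
move=> mi; exists (m - U_(i))%MM; rewrite submK //.
by apply/mnm_lepP => j; rewrite mnm1E; case: eqP => // <-.
Qed.

(** Weights of the torus action xi_j -> t_j xi_j, eta_j -> t_j^-1 eta_j; its invariant monomials are
    those in zeta. *)
Definition tw : 'I_(p + p) -> 'rV[int]_p :=
  lrfun (fun j => delta_mx 0 j) (fun j => - delta_mx 0 j).

Lemma wt_twE (m : 'X_{1..p + p}) j :
  wt tw m 0 j = (m (lshift p j))%:Z - (m (rshift p j))%:Z.
Proof.
rewrite /wt lr_sum summxE (bigD1 j) //= big1 ?addr0 => [|k kj].
  rewrite /tw lrfunL lrfunR !mxE mulNrn !mxE !mulmxnE !mxE !eqxx /=.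
  by rewrite !natz.
rewrite /tw lrfunL lrfunR !mxE mulNrn !mxE !mulmxnE !mxE eq_sym (negbTE kj) andbF.
by rewrite !mul0rn subrr.
Qed.

Lemma wt0_dbl m : wt tw m = 0 -> exists b : 'X_{1..p}, m = dbl b.
Proof.
move=> w0; exists [multinom m (lshift p j) | j < p].
apply/mnmP; apply: ord_lr => j; rewrite ?dblL ?dblR mnmE //.
have := wt_twE m j; rewrite w0 mxE => /esym/eqP; rewrite subr_eq0 => /eqP [->].
by [].
Qed.

Lemma zcomp_weighted f : weighted tw 0 (zcomp f).
Proof.
apply: (@weighted_comp _ _ _ _ tw (fun=> 0) _ _ _ _ _ pointed_xi_eta).
  by move=> m _; apply: big1 => j _; rewrite mul0rn.
move=> j; rewrite xi_etaE -(addrN (delta_mx 0 j)).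
have E1 : tw (lshift p j) = delta_mx 0 j by apply: lrfunL.
have E2 : tw (rshift p j) = - delta_mx 0 j by apply: lrfunR.
by apply: weightedM; [rewrite -E1|rewrite -E2]; apply: weighted_psX.
Qed.

(** For h = f(zeta) x_i, with x_i the i-th of the 2p coordinates, this recovers f. *)
Definition zext (i : 'I_(p + p)) (h : series R (p + p)) : series R p :=
  fun x => h (dbl x + U_(i))%MM.

Lemma zext_mul i f : zext i (zcomp f * psX R i) = f.
Proof. by apply/funext => b; rewrite /zext psmulX_coef zcomp_dbl. Qed.

Lemma zcomp_mulX_inj i f g : zcomp f * psX R i = zcomp g * psX R i -> f = g.
Proof. by move=> E; rewrite -(zext_mul i f) E zext_mul. Qed.

Lemma tw_pos i (m : 'X_{1..p + p}) : wt tw m = tw i -> (0 < m i)%N.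
Proof.
move=> wm; case: (split_ordP i) wm => j -> wm; have := wt_twE m j; rewrite wm.
  by rewrite /tw lrfunL mxE !eqxx /=; lia.
by rewrite /tw lrfunR !mxE !eqxx /=; lia.
Qed.

(** A monomial with the weight of x_i is divisible by x_i, and the quotient has weight 0, so it is a
    monomial in zeta. *)
Lemma zextK i h : weighted tw (tw i) h -> h = zcomp (zext i h) * psX R i.
Proof.
move=> hw; apply/funext => m; case: (posnP (m i)) => [mi|mi].
  rewrite psmulX_coef0 //; apply/eqP; apply: contraT => /hw /tw_pos.
  by rewrite mi.
have [m' ->] := mnm_subU mi; rewrite psmulX_coef.
case: (eqVneq (wt tw m') 0) => [/wt0_dbl [b ->]|wm'].
  by rewrite zcomp_dbl.
have -> : zcomp (zext i h) m' = 0.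
  by apply/eqP; apply: contraNT wm' => /zcomp_weighted ->.
apply/eqP; apply: contraNT wm' => /hw; rewrite wtD wtU => /(canRL (addrK _)).
by rewrite subrr => ->.
Qed.

Lemma zcomp1 : zcomp 1 = 1. Proof. exact: pscomp1 pointed_xi_eta. Qed.
Lemma zcompM f g : zcomp (f * g) = zcomp f * zcomp g.
Proof. exact: pscompM pointed_xi_eta. Qed.
Lemma zcomp_psX j : zcomp (psX R j) = xi_eta R j.
Proof. exact: pscomp_psX pointed_xi_eta. Qed.
Lemma zcomp_at0 f : zcomp f 0%MM = f 0%MM.
Proof. exact: pscomp_at0 pointed_xi_eta. Qed.

Definition emap a b : formal_map R (p + p) (p + p) :=
  glue (fun j => zcomp (a j) * fst_coord R j) (fun j => zcomp (b j) * snd_coord R j).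

Lemma emapL a b j : emap a b (lshift p j) = zcomp (a j) * psX R (lshift p j).
Proof. exact: glueL. Qed.
Lemma emapR a b j : emap a b (rshift p j) = zcomp (b j) * psX R (rshift p j).
Proof. exact: glueR. Qed.

Lemma pointed_emap a b : pointed (emap a b).
Proof.
by apply: ord_lr => j; rewrite ?emapL ?emapR psmul0 psX0 mulr0.
Qed.

Lemma emap_inj a b a' b' : emap a b = emap a' b' -> a = a' /\ b = b'.
Proof.
move=> E; split; apply/funext => j.
  have := congr1 (fun F : formal_map R _ _ => F (lshift p j)) E.
  by rewrite /= !emapL; apply: zcomp_mulX_inj.
have := congr1 (fun F : formal_map R _ _ => F (rshift p j)) E.
by rewrite /= !emapR; apply: zcomp_mulX_inj.
Qed.

Lemma emap_of_weighted F : weightedm tw tw F ->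
  F = emap (fun j => zext (lshift p j) (F (lshift p j)))
           (fun j => zext (rshift p j) (F (rshift p j))).
Proof. by move=> Fw; apply: map_lr => j; rewrite ?emapL ?emapR; apply: zextK. Qed.

Lemma emap_weighted a b : weightedm tw tw (emap a b).
Proof.
by apply: ord_lr => j; rewrite ?emapL ?emapR -[tw _]add0r; apply: weightedM;
  [apply: zcomp_weighted|apply: weighted_psX|apply: zcomp_weighted|apply: weighted_psX].
Qed.

(** The map induced on zeta by [emap a b] is [act] of the product ab. *)
Definition act a : formal_map R p p := fun j => a j * psX R j.

Lemma pointed_act a : pointed (act a).
Proof. by move=> j; rewrite /act psmul0 psX0 mulr0. Qed.

Lemma xi_eta_emap a b : mcomp (@xi_eta R p) (emap a b) =
  mcomp (act (fun j => a j * b j)) (@xi_eta R p).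
Proof.
apply/funext => j; rewrite !mcompE xi_etaE (pscompM _ _ (@pointed_emap a b)).
rewrite !(pscomp_psX _ (@pointed_emap a b)) emapL emapR.
by rewrite /act -[RHS]/(zcomp _) !zcompM zcomp_psX xi_etaE mulrACA.
Qed.

Lemma zcomp_emap f a b : pscomp (zcomp f) (emap a b) =
  zcomp (pscomp f (act (fun j => a j * b j))).
Proof.
rewrite /zcomp (pscompA _ pointed_xi_eta (@pointed_emap a b)) xi_eta_emap.
by rewrite (pscompA _ (@pointed_act _) pointed_xi_eta).
Qed.

Lemma emap_comp a' b' a b : mcomp (emap a' b') (emap a b) =
  emap (fun j => pscomp (a' j) (act (fun j => a j * b j)) * a j)
       (fun j => pscomp (b' j) (act (fun j => a j * b j)) * b j).
Proof.
have P := @pointed_emap a b.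
apply: map_lr => j; rewrite !mcompE ?emapL ?emapR (pscompM _ _ P) zcomp_emap.
  by rewrite (pscomp_psX _ P) emapL zcompM mulrA.
by rewrite (pscomp_psX _ P) emapR zcompM mulrA.
Qed.

Lemma act1 a b : (forall j, a j * b j = 1) -> act (fun j => a j * b j) = mid.
Proof. by move=> ab; apply/funext => j; rewrite /act ab mul1r. Qed.

Lemma emap_comp1 a' b' a b : (forall j, a j * b j = 1) ->
  mcomp (emap a' b') (emap a b) = emap (fun j => a' j * a j) (fun j => b' j * b j).
Proof.
move=> ab; rewrite emap_comp (act1 ab).
by apply: (f_equal2 emap); apply/funext => j; rewrite pscomp_mid.
Qed.

Lemma emap1 : emap (fun=> 1) (fun=> 1) = mid.
Proof. by apply: map_lr => j; rewrite ?emapL ?emapR zcomp1 mul1r. Qed.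

Lemma pointed_sw : pointed (pmap R (@sw p)). Proof. exact: pointed_pmap. Qed.

Lemma xi_eta_sw : mcomp (@xi_eta R p) (pmap R (@sw p)) = @xi_eta R p.
Proof.
apply/funext => j; rewrite !mcompE xi_etaE (pscompM _ _ pointed_sw).
by rewrite !(pscomp_psX _ pointed_sw) /pmap swL swR mulrC.
Qed.

Lemma emap_sw a b : mcomp (pmap R (@sw p)) (emap a b) = mcomp (emap b a) (pmap R (@sw p)).
Proof.
rewrite (pmap_comp _ (@pointed_emap _ _)).
apply: map_lr => j; rewrite ?swL ?swR !mcompE ?emapL ?emapR (pscompM _ _ pointed_sw);
  by rewrite /zcomp (pscompA _ pointed_xi_eta pointed_sw) xi_eta_sw
       (pscomp_psX _ pointed_sw) /pmap ?swL ?swR.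
Qed.

Lemma emap_lin a b :
  eqdm 2 (emap a b) (dmap (lrfun (fun j => a j 0%MM) (fun j => b j 0%MM))).
Proof.
have H f i : eqd 2 (zcomp f * psX R i) (f 0%MM *: psX R i).
  apply: eqd_subr; have -> : zcomp f * psX R i - f 0%MM *: psX R i =
      (zcomp f - (f 0%MM)%:A) * psX R i by rewrite mulrBl -scalerAl mul1r.
  apply: (@eqd0M _ _ 1 1); apply/eqd1; last exact: psX0.
  by rewrite psaddE psoppE pszE ps1E eqxx mulr1 zcomp_at0 subrr.
by apply: ord_lr => j; rewrite /dmap ?lrfunL ?lrfunR ?emapL ?emapR; apply: H.
Qed.

Lemma biholo_emap a b : (forall j, a j 0%MM != 0) -> (forall j, b j 0%MM != 0) ->
  biholo (emap a b).
Proof.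
move=> a0 b0; split; first exact: pointed_emap.
suff -> : jacobian0 (emap a b) =
    jacobian0 (dmap (lrfun (fun j => a j 0%MM) (fun j => b j 0%MM))).
  by apply: (proj2 (biholo_dmap _)); apply: ord_lr => j; rewrite ?lrfunL ?lrfunR.
by apply/matrixP => i j; rewrite !mxE (emap_lin a b) ?mdeg1.
Qed.

Definition torus_eigen (mu : 'I_p -> C) : 'I_(p + p) -> C := lrfun mu (fun j => (mu j)^-1).

Definition independent (mu : 'I_p -> C) :=
  (forall j, mu j != 0) /\
  forall Q : 'I_p -> int, \prod_j mu j ^ Q j = 1 -> forall j, Q j = 0.

(** At the eigenvalues, the monomial of exponent m takes the value mu^(wt m); independence of mu
    makes equal values come from equal weights. *)
Lemma torus_nonresonance mu : independent mu ->
  forall i (m : 'X_{1..p + p}),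
  \prod_j torus_eigen mu j ^+ m j = torus_eigen mu i -> wt tw m = tw i.
Proof.
move=> [mu0 ind] i m E.
have P (m' : 'X_{1..p + p}) :
    \prod_j torus_eigen mu j ^+ m' j = \prod_j mu j ^ (wt tw m' 0 j).
  rewrite lr_prod; apply: eq_bigr => j _; rewrite /torus_eigen lrfunL lrfunR wt_twE.
  by rewrite expfzDr ?mu0 // exprVn -exprnN -exprnP.
have Ei : torus_eigen mu i = \prod_j mu j ^ (wt tw U_(i)%MM 0 j).
  rewrite -P (bigD1 i isT) /= mnm1E eqxx expr1 big1 ?mulr1 // => j ji.
  by rewrite mnm1E eq_sym (negbTE ji) expr0.
apply/rowP => j; apply/eqP; rewrite -subr_eq0; apply/eqP; move: j.
apply: (ind (fun j => wt tw m 0 j - tw i 0 j)).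
under eq_bigr => j _ do rewrite expfzDr ?mu0 //.
rewrite big_split /= -P E Ei -big_split /=; apply: big1 => j _.
by rewrite wtU -expfzDr ?mu0 // subrr expr0z.
Qed.

Lemma emap_of_conjugation mu a b a' b' X : independent mu ->
  (forall j, a j 0%MM = mu j) -> (forall j, b j 0%MM = (mu j)^-1) ->
  (forall j, a' j 0%MM = mu j) -> (forall j, b' j 0%MM = (mu j)^-1) ->
  pointed X -> mcomp X (emap a b) = mcomp (emap a' b') X ->
  exists c, exists d, X = emap c d.
Proof.
move=> ind a0 b0 a0' b0' X0 E.
have L c d : (forall j, c j 0%MM = mu j) -> (forall j, d j 0%MM = (mu j)^-1) ->
    eqdm 2 (emap c d) (dmap (torus_eigen mu)).
  move=> c0 d0; have <- : lrfun (fun j => c j 0%MM) (fun j => d j 0%MM) = torus_eigen mu.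
    by apply/funext; apply: ord_lr => j; rewrite /torus_eigen ?lrfunL ?lrfunR.
  exact: emap_lin.
have Xw := weighted_of_conjugation (@pointed_emap a b) X0 (@emap_weighted a b)
  (@emap_weighted a' b') (L _ _ a0 b0) (L _ _ a0' b0')
  (fun i m _ => @torus_nonresonance mu ind i m) E.
by eexists; eexists; apply: emap_of_weighted.
Qed.

End Torus.

(** * Rigidity of the normalized logarithm *)

Section NormalizedLog.
Variables (R : realType) (p : nat) (sg : signature).
Local Notation C := R[i].
Implicit Types M : formal_map R p p.

Definition log_factor (j : 'I_p) : C := if is_e sg j then 1 else - 'i.

Lemma logME M j : logM sg M j = log_factor j *: pslog (M j).
Proof. by rewrite /logM /log_factor; case: ifP; rewrite ?scale1r. Qed.

Lemma logM_comp k M (G : formal_map R k p) j : pointed G -> M j 0%MM != 0 ->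
  pscomp (logM sg M j) G = log_factor j *: pslog (pscomp (M j) G).
Proof. by move=> G0 M0; rewrite logME (pscompZ _ _ G0) pslog_comp. Qed.

(* Since log M_j - zeta_j does not contain zeta_j while the j-th component of act c
   is divisible by it, the lowest order terms of act c - mid vanish. *)
Lemma normalized_rigid M M' (c : 'I_p -> series R p) :
  normalized_log sg M -> normalized_log sg M' -> (forall j, M' j 0%MM != 0) ->
  (forall j, pscomp (M' j) (act c) = M j) -> act c = mid.
Proof.
move=> [tM nM] [tM' nM'] M0' E; have ac0 := @pointed_act R p c.
pose f j := logM sg M j - psX R j; pose f' j := logM sg M' j - psX R j.
have ordf (N : formal_map R p p) j : tangent_to_id (logM sg N) ->
    eqd 2 (logM sg N j - psX R j) 0.
  by move=> tN; apply: eqd_subl => m m2; apply: tN.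
have EE j : act c j + pscomp (f' j) (act c) = psX R j + f j.
  rewrite /f /f' (pscompB _ _ ac0) (pscomp_psX _ ac0) !(addrC _ (_ - _)) !subrK.
  by rewrite logM_comp // E logME.
suff P d : eqdm d (act c) mid by apply/funext => j; apply: eqd_eq => d; apply: P.
elim: d => [|d IH] j; first by move=> m; rewrite ltn0.
apply: eqd_bump; last exact: IH.
move=> m md; have := congr1 (fun h : series R p => h m) (EE j).
(* Since [f'] has order 2, knowing [act c] below degree d gives the composite in degree d as
   well. *)
have e2 : eqd d.+1 (pscomp (f' j) (act c)) (f' j).
  rewrite -[X in eqd _ _ X]pscomp_mid; apply: (eqd_compr2 ac0 (@pointed_mid _ _) _ IH).
  exact: ordf.
rewrite !psaddE e2 ?md //; case: (posnP (m j)) => [mj _|mj].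
  rewrite /act psmulX_coef0 // /mid psX_coef; case: eqP => // mU.
  by move: mj; rewrite mU mnm1E eqxx.
have -> : f' j m = 0 by have := nM' j m mj.
by have -> : f j m = 0; [have := nM j m mj|rewrite !addr0].
Qed.

End NormalizedLog.

(** * The group of formal biholomorphisms *)

Section GermGroup.
Variables (R : realType) (n : nat).
Local Notation C := R[i].

(** Bundling invertibility turns these maps into a group, where generic group lemmas apply without
    conditions on constant terms or Jacobians. *)
Record germ := Germ { gmap :> formal_map R n n; germP : biholo gmap }.

Lemma germ_inj (x y : germ) : gmap x = gmap y -> x = y.
Proof.
case: x => F bF; case: y => G bG /= E; subst G.
by congr Germ; apply: Prop_irrelevance.
Qed.

Lemma germ0 (x : germ) : pointed x. Proof. exact: biholo_pointed (germP x). Qed.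

(* The operations are sealed: conversion would unfold compositions of power series. *)
Fact gmul_spec : {f : germ -> germ -> germ | forall x y, gmap (f x y) = mcomp x y}.
Proof. by exists (fun x y => Germ (biholo_comp (germP x) (germP y))). Qed.
Fact ginv_spec : {f : germ -> germ | forall x, gmap (f x) = minv x}.
Proof. by exists (fun x => Germ (biholo_minv (germP x))). Qed.
Fact gone_spec : {x : germ | gmap x = mid}.
Proof. by exists (Germ (@biholo_mid R n)). Qed.
Fact gconj_spec : {f : germ -> germ | forall x, gmap (f x) = mconj x}.
Proof. by exists (fun x => Germ (biholo_mconj (germP x))). Qed.

HB.instance Definition _ := gen_eqMixin germ.
HB.instance Definition _ := gen_choiceMixin germ.

Fact gmulA : associative (sval gmul_spec).
Proof.
move=> x y z; apply: germ_inj; rewrite !(svalP gmul_spec).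
exact: mcompA (germ0 _) (germ0 _).
Qed.
Fact gmul1 : left_id (sval gone_spec) (sval gmul_spec).
Proof.
move=> x; apply: germ_inj; rewrite (svalP gmul_spec) (svalP gone_spec).
exact: mid_mcomp (germ0 x).
Qed.
Fact gmulV : left_inverse (sval gone_spec) (sval ginv_spec) (sval gmul_spec).
Proof.
move=> x; apply: germ_inj; rewrite (svalP gmul_spec) (svalP ginv_spec) (svalP gone_spec).
exact: mcompVK (germP x).
Qed.
Fact gmul1r : right_id (sval gone_spec) (sval gmul_spec).
Proof.
move=> x; apply: germ_inj; rewrite (svalP gmul_spec) (svalP gone_spec).
exact: mcomp_mid.
Qed.
Fact gmulVr : right_inverse (sval gone_spec) (sval ginv_spec) (sval gmul_spec).
Proof.
move=> x; apply: germ_inj; rewrite (svalP gmul_spec) (svalP ginv_spec) (svalP gone_spec).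
exact: mcompKV (germP x).
Qed.

HB.instance Definition _ := isGroup.Build germ gmulA gmul1 gmul1r gmulV gmulVr.

Lemma gmM (x y : germ) : gmap (x * y)%g = mcomp x y.
Proof. exact: (svalP gmul_spec). Qed.
Lemma gmV (x : germ) : gmap (x^-1)%g = minv x.
Proof. exact: (svalP ginv_spec). Qed.
Lemma gm1 : gmap (1%g : germ) = mid.
Proof. exact: (svalP gone_spec). Qed.

Definition gconj : germ -> germ := sval gconj_spec.
Lemma gmconj (x : germ) : gmap (gconj x) = mconj x.
Proof. exact: (svalP gconj_spec). Qed.
Lemma gconjM x y : gconj (x * y)%g = (gconj x * gconj y)%g.
Proof.
by apply: germ_inj; rewrite gmconj !gmM !gmconj; apply: mconj_comp (germ0 y).
Qed.
Lemma gconjK : involutive gconj.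
Proof. by move=> x; apply: germ_inj; rewrite !gmconj mconjK. Qed.
Lemma gconj1 : gconj 1%g = 1%g.
Proof. by apply: germ_inj; rewrite gmconj gm1 mconj_mid. Qed.

Section Pmap.
Variable s : 'I_n -> 'I_n.
Hypothesis sK : involutive s.
Lemma pmap_invol : mcomp (pmap R s) (pmap R s) = mid.
Proof. by rewrite pmap_pmap; apply/funext => i; rewrite /pmap /= sK. Qed.
Lemma biholo_pmap : biholo (pmap R s).
Proof. exact: involution_biholo (@pointed_pmap R n n s) pmap_invol. Qed.
Fact gpmap_spec : {x : germ | gmap x = pmap R s}.
Proof. by exists (Germ biholo_pmap). Qed.
Definition gpmap : germ := sval gpmap_spec.
Lemma gmpmap : gmap gpmap = pmap R s. Proof. exact: (svalP gpmap_spec). Qed.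
Lemma gpmapK : (gpmap * gpmap)%g = 1%g.
Proof. by apply: germ_inj; rewrite gmM gm1 gmpmap pmap_invol. Qed.
Lemma gconj_pmap : gconj gpmap = gpmap.
Proof. by apply: germ_inj; rewrite gmconj gmpmap mconj_pmap. Qed.

(** This is F -> a F a for the antiholomorphic involution a with holomorphic part [pmap R s]; for
    rho_0 it gives tau_2 from tau_1. *)
Definition anticonj (x : germ) : germ := (gpmap * (gconj x * gpmap))%g.
Lemma anticonjM x y : anticonj (x * y)%g = (anticonj x * anticonj y)%g.
Proof. by rewrite /anticonj gconjM !mulgA -(mulgA _ gpmap gpmap) gpmapK mulg1. Qed.
Lemma anticonj1 : anticonj 1%g = 1%g.
Proof. by rewrite /anticonj gconj1 mul1g gpmapK. Qed.
Lemma anticonjK : involutive anticonj.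
Proof.
move=> x; rewrite /anticonj !gconjM gconjK gconj_pmap !mulgA gpmapK mul1g.
by rewrite -mulgA gpmapK mulg1.
Qed.
Lemma anticonj_coef x i : gmap (anticonj x) i = pscomp (psconj (gmap x (s i))) (pmap R s).
Proof.
rewrite /anticonj gmM gmM gmconj gmpmap mcompE /pmap.
rewrite (pscomp_psX _ (pointed_comp (mconj_pointed (germ0 x)) (@pointed_pmap _ _ _ s))).
by rewrite mcompE mconjE.
Qed.
End Pmap.

(* conj_anti G a a' says that G intertwines F |-> a F a and F |-> a' F a'. *)
Lemma conj_anti_germ s s' (sK : involutive s) (s'K : involutive s') (g : germ) :
  conj_anti g (pmap R s) (pmap R s') <-> (g * gpmap sK = gpmap s'K * gconj g)%g.
Proof.
split=> E; first by apply: germ_inj; rewrite !gmM gmconj !gmpmap.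
by have := congr1 gmap E; rewrite !gmM gmconj !gmpmap.
Qed.

Lemma conj_antiE s (sK : involutive s) (g : germ) :
  conj_anti g (pmap R s) (pmap R s) <-> anticonj sK g = g.
Proof.
rewrite (conj_anti_germ sK sK); split=> E.
  by rewrite /anticonj mulgA -E -mulgA gpmapK mulg1.
by rewrite -{1}E /anticonj -!mulgA gpmapK mulg1.
Qed.

Lemma anticonj_transport s s' (sK : involutive s) (s'K : involutive s') (g f f' : germ) :
  conj_anti g (pmap R s) (pmap R s') -> (g * f = f' * g)%g ->
  (g * anticonj sK f = anticonj s'K f' * g)%g.
Proof.
move=> /(conj_anti_germ sK s'K) E E'.
have E1 : (gconj g * gpmap sK = gpmap s'K * g)%g.
  by have := congr1 gconj E; rewrite !gconjM !gconj_pmap gconjK.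
have E2 : (gconj g * gconj f = gconj f' * gconj g)%g by rewrite -!gconjM E'.
rewrite /anticonj mulgA E -!mulgA (mulgA (gconj g)) E2 -mulgA E1.
by [].
Qed.

End GermGroup.

(** * The standard antiholomorphic involution rho *)

Section Rho.
Variables (R : realType) (p : nat) (sg : signature).
Local Notation C := R[i].
Hypothesis sgp : (ne sg + nh sg + (ns sg).*2)%N = p.
Local Notation is_e := (@is_e p sg).
Local Notation is_h := (@is_h p sg).
Local Notation is_s := (@is_s p sg).
Local Notation is_s' := (@is_s' p sg).
Local Notation partner := (@partner p sg).

Lemma partner_val (j : 'I_p) : (partner j : nat) =
  if is_s j then (j + ns sg)%N else if is_s' j then (j - ns sg)%N else j.
Proof.
have jp := ltn_ord j; rewrite /Defs.partner /Defs.is_s /Defs.is_s'.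
case: ifP => [/andP[h1 h2]|h].
  by rewrite val_insubd; case: ifP => // /negbT; lia.
by case: ifP => // h'; rewrite val_insubd; case: ifP => // /negbT; lia.
Qed.

Lemma kindP (j : 'I_p) : [\/ is_e j, is_h j, is_s j | is_s' j].
Proof.
rewrite /Defs.is_e /Defs.is_h /Defs.is_s /Defs.is_s'; have := ltn_ord j.
case: (ltnP j (ne sg)) => [?|le1]; first by constructor 1.
case: (ltnP j (ne sg + nh sg)) => [?|le2]; first by constructor 2.
case: (ltnP j (ne sg + nh sg + ns sg)) => [?|le3]; first by constructor 3.
by constructor 4.
Qed.

Lemma partnerK : involutive partner.
Proof.
move=> j; apply/val_inj; rewrite /= !partner_val /Defs.is_s /Defs.is_s' !partner_val.
rewrite /Defs.is_s /Defs.is_s'; have := ltn_ord j.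
by repeat case: ifP; lia.
Qed.

Lemma is_e_partner j : is_e (partner j) = is_e j.
Proof.
rewrite /Defs.is_e partner_val /Defs.is_s /Defs.is_s'; have := ltn_ord j.
by case: ifP => h; [|case: ifP => h']; lia.
Qed.

Lemma is_s_partner j : is_s (partner j) = is_s' j.
Proof.
rewrite {1}/Defs.is_s partner_val /Defs.is_s /Defs.is_s'; have := ltn_ord j.
by case: ifP => h; [|case: ifP => h']; lia.
Qed.

Lemma is_s'_partner j : is_s' (partner j) = is_s j.
Proof. by rewrite -is_s_partner partnerK. Qed.

Lemma partner_eq j : (partner j == j) = is_e j || is_h j.
Proof.
rewrite -val_eqE /= partner_val /Defs.is_e /Defs.is_h /Defs.is_s /Defs.is_s'.
have := ltn_ord j; by case: ifP => h; [|case: ifP => h']; lia.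
Qed.

Lemma partner_e j : is_e j -> partner j = j.
Proof. by move=> e; apply/eqP; rewrite partner_eq e. Qed.
Lemma partner_h j : is_h j -> partner j = j.
Proof. by move=> e; apply/eqP; rewrite partner_eq e orbT. Qed.

Lemma is_h_notP j : is_h j -> (is_e j = false) * (is_s j = false) * (is_s' j = false).
Proof. by rewrite /Defs.is_e /Defs.is_h /Defs.is_s /Defs.is_s' => h; do !split; apply/negbTE; move: h; lia. Qed.
Lemma is_s_notP j : is_s j -> (is_e j = false) * (is_h j = false) * (is_s' j = false).
Proof. by rewrite /Defs.is_e /Defs.is_h /Defs.is_s /Defs.is_s' => h; do !split; apply/negbTE; move: h; lia. Qed.
Lemma is_s'_notP j : is_s' j -> (is_e j = false) * (is_h j = false) * (is_s j = false).
Proof. by rewrite /Defs.is_e /Defs.is_h /Defs.is_s /Defs.is_s' => h; do !split; apply/negbTE; move: h; lia. Qed.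
Lemma is_e_notP j : is_e j -> (is_h j = false) * (is_s j = false) * (is_s' j = false).
Proof. by rewrite /Defs.is_e /Defs.is_h /Defs.is_s /Defs.is_s' => h; do !split; apply/negbTE; move: h; lia. Qed.

Definition rh : 'I_(p + p) -> 'I_(p + p) :=
  lrfun (fun j => if is_e j then rshift p j else lshift p (partner j))
        (fun j => if is_e j then lshift p j else rshift p (partner j)).

Lemma rhL j : rh (lshift p j) = if is_e j then rshift p j else lshift p (partner j).
Proof. exact: lrfunL. Qed.
Lemma rhR j : rh (rshift p j) = if is_e j then lshift p j else rshift p (partner j).
Proof. exact: lrfunR. Qed.

Lemma rhoE : @rho R p sg = pmap R rh.
Proof.
by apply: map_lr => j; rewrite /rho /pmap ?(glueL, glueR) ?rhL ?rhR; case: ifP.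
Qed.

Lemma rhK : involutive rh.
Proof.
by apply: ord_lr => j; rewrite ?rhL ?rhR; case: ifP => e;
  rewrite ?rhL ?rhR ?is_e_partner e ?partnerK.
Qed.

Lemma rh_sw i : rh (sw i) = sw (rh i).
Proof.
move: i; apply: ord_lr => j; rewrite ?swL ?swR ?rhL ?rhR; case: ifP => e;
  by rewrite ?swL ?swR.
Qed.

Let Prt : pointed (pmap R partner) := @pointed_pmap R p p partner.
Let Prh : pointed (pmap R rh) := @pointed_pmap R _ _ rh.

Implicit Types f g : series R p.

(** Action of rho on series in zeta: zeta_j goes to the conjugate of the zeta of its partner; for
    elliptic j the exchange of xi_j and eta_j leaves their product in place. *)
Definition rc (f : series R p) : series R p := pscomp (psconj f) (pmap R partner).

Lemma rcM f g : rc (f * g) = rc f * rc g.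
Proof. by rewrite /rc psconjM (pscompM _ _ Prt). Qed.
Lemma rcK f : rc (rc f) = f.
Proof.
rewrite /rc (psconj_comp _ Prt) psconjK mconj_pmap (pscompA _ Prt Prt).
by rewrite (pmap_invol _ partnerK) pscomp_mid.
Qed.
Lemma rc_at0 f : rc f 0%MM = (f 0%MM)^*.
Proof. by rewrite /rc (pscomp_at0 _ Prt). Qed.
Lemma rc_neq0 f : f 0%MM != 0 -> rc f 0%MM != 0.
Proof. by rewrite rc_at0 conjC_eq0. Qed.
Lemma rc_inv f : f 0%MM != 0 -> rc (psinv f) = psinv (rc f).
Proof. by move=> f0; rewrite /rc (psinv_conj f0) (psinv_comp Prt (psconj0_neq0 f0)). Qed.

Lemma xi_eta_rh : mcomp (@xi_eta R p) (pmap R rh) = mcomp (pmap R partner) (@xi_eta R p).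
Proof.
rewrite (pmap_comp _ (@pointed_xi_eta R p)); apply/funext => j.
rewrite !mcompE xi_etaE (pscompM _ _ Prh) !(pscomp_psX _ Prh) /pmap rhL rhR xi_etaE.
case: ifP => e; last by [].
by rewrite (partner_e e) mulrC.
Qed.

Lemma zcomp_rc f : pscomp (psconj (zcomp f)) (pmap R rh) = zcomp (rc f).
Proof.
have Px := @pointed_xi_eta R p; rewrite /zcomp (psconj_comp _ Px).
have -> : mconj (@xi_eta R p) = @xi_eta R p.
  by apply/funext => j; rewrite mconjE xi_etaE psconjM !psconj_psX.
by rewrite (pscompA _ Px Prh) xi_eta_rh /rc (pscompA _ Prt Px).
Qed.

End Rho.

(** * Normalization of tau_1 *)

Section TorusGroup.
Variables (R : realType) (p : nat).
Local Notation C := R[i].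
Implicit Types a b : 'I_p -> series R p.

Definition nz a := forall j, a j 0%MM != 0.
Definition vmul a b : 'I_p -> series R p := fun j => a j * b j.
Definition vinv a : 'I_p -> series R p := fun j => psinv (a j).

Lemma nz_vmul a b : nz a -> nz b -> nz (vmul a b).
Proof. by move=> a0 b0 j; apply: psmul0_neq0. Qed.
Lemma nz_vinv a : nz a -> nz (vinv a).
Proof. by move=> a0 j; apply: psinv0_neq0. Qed.
Lemma vmulV a : nz a -> forall j, a j * vinv a j = 1.
Proof. by move=> a0 j; apply: mulpsV. Qed.
Lemma vmulVl a : nz a -> forall j, vinv a j * a j = 1.
Proof. by move=> a0 j; apply: mulVps. Qed.
Lemma vmulVf a : nz a -> vmul (vinv a) a = fun=> 1.
Proof. by move=> a0; apply/funext; apply: vmulVl. Qed.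
Lemma vinvK a : nz a -> vinv (vinv a) = a.
Proof. by move=> a0; apply/funext => j; apply: psinvK. Qed.
Lemma vinvM a b : nz a -> nz b -> vinv (vmul a b) = vmul (vinv a) (vinv b).
Proof. by move=> a0 b0; apply/funext => j; apply: psinvM. Qed.
Lemma vmulC a b : vmul a b = vmul b a.
Proof. by apply/funext => j; apply: mulrC. Qed.
Lemma vmulA a b c : vmul a (vmul b c) = vmul (vmul a b) c.
Proof. by apply/funext => j; apply: mulrA. Qed.
Lemma vmulKl a b : nz a -> vmul a (vmul (vinv a) b) = b.
Proof. by move=> a0; apply/funext => j; rewrite /vmul mulrA (vmulV a0) mul1r. Qed.
Lemma vmul_cancel a b c : nz a -> vmul a b = vmul a c -> b = c.
Proof.
move=> a0 E; apply/funext => j; apply: (psmul_cancel (a0 j)).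
exact: (congr1 (fun F : 'I_p -> series R p => F j) E).
Qed.

(** The default value 1 makes [gemap] total; the invertibility of a and b is only required when its
    value is unfolded. *)
Fact gemap_spec a b : {x : germ R (p + p) | nz a -> nz b -> gmap x = emap a b}.
Proof.
case: (pselect (nz a /\ nz b)) => [[a0 b0]|H].
  by exists (Germ (biholo_emap a0 b0)).
by exists 1%g => a0 b0; case: H.
Qed.
Definition gemap a b : germ R (p + p) := sval (gemap_spec a b).
Lemma gmemap a b : nz a -> nz b -> gmap (gemap a b) = emap a b.
Proof. exact: (svalP (gemap_spec a b)). Qed.

(** These maps fix zeta, so they multiply componentwise and commute; sigma_hat is one of them. *)
Definition torus a := gemap a (vinv a).
Lemma gmtorus a : nz a -> gmap (torus a) = emap a (vinv a).
Proof. by move=> a0; rewrite gmemap //; apply: nz_vinv. Qed.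

Lemma gemap_torus a b : nz a -> nz b -> (forall j, a j * b j = 1) -> gemap a b = torus a.
Proof.
move=> a0 b0 ab; rewrite /torus; congr gemap; apply/funext => j.
by rewrite /vinv (psinv_uniq (a0 j) (ab j)).
Qed.

Lemma torus_inj a b : nz a -> nz b -> torus a = torus b -> a = b.
Proof.
move=> a0 b0 /(congr1 (@gmap _ _)); rewrite (gmtorus a0) (gmtorus b0).
by move/emap_inj => [].
Qed.

Lemma nz1 : nz (fun=> 1). Proof. by move=> j; rewrite ps1E eqxx oner_neq0. Qed.

Lemma torus1 : torus (fun=> 1) = 1%g.
Proof.
apply: germ_inj; rewrite (gmtorus nz1) gm1 -(@emap1 R p); congr emap.
by apply/funext => j; apply: (psinv_uniq (nz1 j)); rewrite mulr1.
Qed.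

Lemma gemap_torusM a b c : nz a -> nz b -> nz c ->
  (gemap a b * torus c)%g = gemap (vmul a c) (vmul b (vinv c)).
Proof.
move=> a0 b0 c0; apply: germ_inj; have c0' := nz_vinv c0.
rewrite gmM (gmemap a0 b0) (gmtorus c0) (gmemap (nz_vmul a0 c0) (nz_vmul b0 c0')).
exact: emap_comp1 _ _ (vmulV c0).
Qed.

Lemma torusM a b : nz a -> nz b -> (torus a * torus b)%g = torus (vmul a b).
Proof.
move=> a0 b0; rewrite {1}/torus gemap_torusM //; last exact: nz_vinv.
by rewrite /torus vinvM.
Qed.

Lemma torusV a : nz a -> ((torus a)^-1)%g = torus (vinv a).
Proof.
move=> a0; apply/eqP; rewrite eq_sym -mulg_eq1 torusM //; last exact: nz_vinv.
by rewrite vmulVf // torus1.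
Qed.

Lemma torus_comm a b : nz a -> nz b -> (torus a * torus b)%g = (torus b * torus a)%g.
Proof. by move=> a0 b0; rewrite (torusM a0 b0) (torusM b0 a0) vmulC. Qed.

Lemma biholo_emap_nz a b : biholo (emap a b) -> nz a /\ nz b.
Proof.
case=> _; have -> : jacobian0 (emap a b) =
    jacobian0 (dmap (lrfun (fun j => a j 0%MM) (fun j => b j 0%MM))).
  by apply/matrixP => i j; rewrite !mxE (emap_lin a b) ?mdeg1.
rewrite jacobian0_dmap unitmxE det_diag unitfE => /prodf_neq0 H.
split=> j; [have := H (lshift p j) isT|have := H (rshift p j) isT].
  by rewrite mxE lrfunL.
by rewrite mxE lrfunR.
Qed.

Definition swap : germ R (p + p) := gpmap R (@swK p).
Lemma gmswap : gmap swap = pmap R (@sw p). Proof. exact: gmpmap. Qed.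
Lemma swapK : (swap * swap)%g = 1%g. Proof. exact: gpmapK. Qed.
Lemma swapKl x : (swap * (swap * x))%g = x. Proof. by rewrite mulgA swapK mul1g. Qed.

Lemma swap_gemap a b : nz a -> nz b -> (swap * gemap a b)%g = (gemap b a * swap)%g.
Proof.
by move=> a0 b0; apply: germ_inj; rewrite !gmM (gmemap a0 b0) (gmemap b0 a0) gmswap emap_sw.
Qed.

Lemma swap_torus a : nz a -> (swap * torus a)%g = (torus (vinv a) * swap)%g.
Proof.
by move=> a0; have a0' := nz_vinv a0; rewrite /torus (swap_gemap a0 a0') vinvK.
Qed.

Lemma gemap_of_commutation (mu : 'I_p -> C) a b (x : germ R (p + p)) :
  independent mu -> nz a -> nz b ->
  (forall j, a j 0%MM = mu j) -> (forall j, b j 0%MM = mu j) ->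
  (x * torus a)%g = (torus b * x)%g ->
  exists c, exists d, [/\ nz c, nz d & x = gemap c d].
Proof.
move=> ind a0 b0 amu bmu /(congr1 (@gmap _ _)); rewrite !gmM (gmtorus a0) (gmtorus b0) => E.
have ainv (f : 'I_p -> series R p) : nz f -> (forall j, f j 0%MM = mu j) ->
    forall j, vinv f j 0%MM = (mu j)^-1.
  by move=> f0 fmu j; rewrite /vinv (psinv0 (f0 j)) fmu.
have [c [d xE]] := emap_of_conjugation ind amu (ainv _ a0 amu) bmu (ainv _ b0 bmu) (germ0 x) E.
have := germP x; rewrite xE => /biholo_emap_nz[c0 d0].
exists c, d; split; [exact: c0|exact: d0|].
by apply: germ_inj; rewrite (gmemap c0 d0).
Qed.

Lemma gemap_inj a b a' b' : nz a -> nz b -> nz a' -> nz b' ->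
  gemap a b = gemap a' b' -> a = a' /\ b = b'.
Proof.
move=> a0 b0 a0' b0' /(congr1 (@gmap _ _)); rewrite (gmemap a0 b0) (gmemap a0' b0').
exact: emap_inj.
Qed.

Definition vact a (c : 'I_p -> series R p) : 'I_p -> series R p :=
  fun j => pscomp (a j) (act c).

Lemma nz_vact a c : nz a -> nz (vact a c).
Proof. by move=> a0 j; rewrite /vact (pscomp_at0 _ (@pointed_act _ _ c)). Qed.

Lemma gemap_mul a' b' a b : nz a' -> nz b' -> nz a -> nz b ->
  (gemap a' b' * gemap a b)%g =
  gemap (vmul (vact a' (vmul a b)) a) (vmul (vact b' (vmul a b)) b).
Proof.
move=> a0' b0' a0 b0; apply: germ_inj; have c0 := nz_vmul a0 b0.
rewrite gmM (gmemap a0' b0') (gmemap a0 b0).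
rewrite (gmemap (nz_vmul (nz_vact _ a0') a0) (nz_vmul (nz_vact _ b0') b0)).
exact: emap_comp.
Qed.

(** Compare the xi-components: [torus M] fixes zeta, while [gemap a b] moves it by [act] of ab; the
    factor a_j cancels. *)
Lemma gemap_conj_torus a b M M' : nz a -> nz b -> nz M -> nz M' ->
  (gemap a b * torus M)%g = (torus M' * gemap a b)%g ->
  forall j, pscomp (M' j) (act (fun j => a j * b j)) = M j.
Proof.
move=> a0 b0 M0 M0'; have M0i := nz_vinv M0; have M0i' := nz_vinv M0'.
rewrite (gemap_torusM a0 b0 M0) {1}/torus (gemap_mul M0' M0i' a0 b0).
move/(gemap_inj (nz_vmul a0 M0) (nz_vmul b0 M0i)
  (nz_vmul (nz_vact _ M0') a0) (nz_vmul (nz_vact _ M0i') b0)) => [E _] j.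
apply: (psmul_cancel (a0 j)).
have := congr1 (fun F : 'I_p -> series R p => F j) E; rewrite /vmul => ->.
exact: mulrC.
Qed.

Lemma act_mid1 (c : 'I_p -> series R p) : act c = mid -> forall j, c j = 1.
Proof.
move=> E j; apply/funext => m.
have := congr1 (fun F : formal_map R p p => F j (m + U_(j))%MM) E.
rewrite /act psmulX_coef => ->; rewrite /mid -[psX R j]mul1r psmulX_coef.
by [].
Qed.

End TorusGroup.

Section TorusRho.
Variables (R : realType) (p : nat) (sg : signature).
Local Notation C := R[i].
Hypothesis sgp : (ne sg + nh sg + (ns sg).*2)%N = p.
Local Notation is_e := (@is_e p sg).
Local Notation is_h := (@is_h p sg).
Local Notation is_s := (@is_s p sg).
Local Notation is_s' := (@is_s' p sg).
Local Notation partner := (@partner p sg).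
Local Notation rc := (@rc R p sg).
Local Notation rh := (@rh p sg).
Local Notation rhK := (rhK sgp).
Local Notation alpha := (@anticonj R (p + p) rh rhK).

Lemma alpha_swap : alpha (@swap R p) = @swap R p.
Proof.
apply: germ_inj; apply/funext => i; rewrite anticonj_coef gmswap /pmap psconj_psX.
by rewrite (pscomp_psX _ (@pointed_pmap _ _ _ _)) /pmap -rh_sw // rhK.
Qed.

(** Conjugation by rho sends [torus a] to [torus (vrho a)]; for elliptic j it exchanges xi_j and
    eta_j, hence the inverse. *)
Definition vrho (a : 'I_p -> series R p) : 'I_p -> series R p :=
  fun j => if is_e j then rc (psinv (a j)) else rc (a (partner j)).

Lemma nz_vrho a : nz a -> nz (vrho a).
Proof.
move=> a0 j; rewrite /vrho; case: (is_e j); apply: rc_neq0; last exact: a0.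
exact: psinv0_neq0.
Qed.

Lemma vrhoM a b : nz a -> nz b -> vrho (vmul a b) = vmul (vrho a) (vrho b).
Proof.
move=> a0 b0; apply/funext => j; rewrite /vrho /vmul; case: (is_e j).
  by rewrite (psinvM (a0 j) (b0 j)) rcM.
exact: rcM.
Qed.

Lemma vrho_inv a : nz a -> vrho (vinv a) = vinv (vrho a).
Proof.
move=> a0; apply/funext => j; rewrite /vrho /vinv; case: (is_e j).
  by rewrite (rc_inv _ (psinv0_neq0 (a0 j))).
by rewrite (rc_inv _ (a0 _)).
Qed.

Lemma alpha_torus a : nz a -> alpha (torus a) = torus (vrho a).
Proof.
move=> a0; apply: germ_inj; rewrite (gmtorus (nz_vrho a0)).
have E f i j : rh i = j ->
    pscomp (psconj (zcomp f * psX R i)) (pmap R rh) = zcomp (rc f) * psX R j.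
  have P := @pointed_pmap R _ _ rh.
  move=> <-; rewrite psconjM psconj_psX (pscompM _ _ P) (pscomp_psX _ P).
  by rewrite zcomp_rc.
apply: map_lr => j; rewrite anticonj_coef (gmtorus a0) ?rhL ?rhR /vrho /vinv.
  rewrite emapL; case e: (is_e j); rewrite ?emapL ?emapR; apply: E.
    by rewrite rhR e.
  by rewrite rhL is_e_partner // e partnerK.
rewrite emapR; case e: (is_e j); rewrite ?emapL ?emapR.
  rewrite (E _ _ (rshift p j)); last by rewrite rhL e.
  by rewrite (rc_inv _ (a0 j)) (psinvK (rc_neq0 _ (a0 j))).
rewrite (E _ _ (rshift p j)); last by rewrite rhR is_e_partner // e partnerK.
by rewrite (rc_inv _ (a0 _)).
Qed.

Section Normalization.
Variables (lam : 'I_p -> C) (M L : formal_map R p p).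
Hypothesis lam0 : forall j, lam j != 0.
Hypothesis lam_e : forall j, is_e j -> 0 < lam j.
Hypothesis lam_h : forall j, is_h j -> (lam j)^* = (lam j)^-1.
Hypothesis lam_s : forall j, is_s j -> lam (partner j) = ((lam j)^*)^-1.
Hypothesis M_sq : forall j, M j = L j * L j.
Hypothesis L0 : forall j, L j 0%MM = lam j.
Hypothesis ind : independent (fun j => lam j ^+ 2).
Hypothesis nM : normalized_log sg M.

Lemma nzL : nz L. Proof. by move=> j; rewrite L0. Qed.
Lemma M0E j : M j 0%MM = lam j ^+ 2. Proof. by rewrite M_sq psmul0 L0 expr2. Qed.
Lemma nzM : nz M. Proof. by move=> j; rewrite M0E expf_neq0. Qed.

Lemma lam_partner j : is_e j = false -> ((lam (partner j))^*)^-1 = lam j.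
Proof.
case: (kindP sg j) => [->//|h _|h _|h _].
- by rewrite (partner_h sgp h) lam_h // invrK.
- by rewrite (lam_s h) -fmorphV invrK; apply: conjCK.
by rewrite -lam_s ?is_s_partner // partnerK.
Qed.

Section Involution.
Variable t1 : germ R (p + p).
Hypothesis t1K : (t1 * t1)%g = 1%g.
Hypothesis t1_sigma : torus M = (t1 * alpha t1)%g.

Lemma alpha_t1K : (alpha t1 * alpha t1)%g = 1%g.
Proof. by rewrite -anticonjM t1K anticonj1. Qed.

(** As t1 and [alpha t1] are involutions with product [torus M], t1 conjugates [torus M] to its
    inverse, and so does [swap]. Thus [swap * t1] commutes with [torus M] and is diagonal over zeta;
    rigidity forces AB = 1. *)
Lemma reversor_form : exists2 A, nz A & t1 = (torus A * @swap R p)%g.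
Proof.
have nM' := nz_vinv nzM.
have E1 : (t1 * torus M)%g = alpha t1 by rewrite t1_sigma mulgA t1K mul1g.
have E2 : (torus (vinv M) * t1)%g = alpha t1.
  rewrite -(torusV nzM) t1_sigma invMg -mulgA mulVg mulg1.
  by apply: (mulgI (alpha t1)); rewrite mulgV alpha_t1K.
have E : ((@swap R p * t1) * torus M = torus M * (@swap R p * t1))%g.
  by rewrite -mulgA E1 -E2 !mulgA (swap_torus nM') vinvK //; apply: nzM.
have [B [A [B0 A0 BA]]] := gemap_of_commutation ind nzM nzM M0E M0E E.
have t1E : t1 = (gemap A B * @swap R p)%g by rewrite -swap_gemap // -BA swapKl.
have E3 : (gemap A B * torus M = torus M * gemap A B)%g.
  suff /commuteV : commute (gemap A B) ((torus M)^-1)%g by rewrite invgK.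
  apply: (mulIg (@swap R p)); rewrite (torusV nzM) -!mulgA -(swap_torus nzM) -t1E E2.
  by rewrite mulgA -t1E E1.
have AB1 : act (fun j => A j * B j) = mid.
  exact: (normalized_rigid nM nM nzM (gemap_conj_torus A0 B0 nzM nzM E3)).
exists A => //; rewrite t1E; congr (_ * _)%g; apply: gemap_torus => //.
exact: act_mid1 AB1.
Qed.

(** [alpha] exchanges the two factors of [torus M = t1 * alpha t1], which are involutions, and so
    inverts the product. *)
Lemma M_conj : vrho M = vinv M.
Proof.
apply: torus_inj; [exact: nz_vrho nzM|exact: nz_vinv nzM|].
rewrite -(alpha_torus nzM) -(torusV nzM) t1_sigma anticonjM anticonjK invMg.
congr (_ * _)%g; apply/eqP; rewrite -mulg_eq1; apply/eqP.
  exact: alpha_t1K.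
exact: t1K.
Qed.

(** Both sides have the same square by [M_conj]; a root is fixed by its constant term, and the
    conditions on lambda make the constant terms agree. *)
Lemma L_conj : vrho L = vinv L.
Proof.
apply/funext => j; have := congr1 (fun F : 'I_p -> series R p => F j) M_conj.
rewrite /vrho /vinv !M_sq (psinvM (nzL j) (nzL j)).
case e: (is_e j); rewrite ?rcM => /sqrt_uniq; apply.
- rewrite rc_at0 (psinv0 (nzL j)) L0 fmorphV; apply: (congr1 GRing.inv).
  by apply: CrealP; apply: gtr0_real; apply: lam_e.
- by apply: rc_neq0; apply: psinv0_neq0; apply: nzL.
- by rewrite rc_at0 (psinv0 (nzL j)) !L0 -(lam_partner e) invrK.
- by apply: rc_neq0; apply: nzL.
Qed.

Definition tau1_hat : germ R (p + p) := locked (torus L * @swap R p)%g.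

Lemma tau1_hat_sigma : torus M = (tau1_hat * alpha tau1_hat)%g.
Proof.
rewrite /tau1_hat -!lock anticonjM alpha_swap (alpha_torus nzL) L_conj.
rewrite -mulgA (mulgA (@swap R p)) (swap_torus (nz_vinv nzL)) (vinvK nzL).
rewrite -mulgA swapK mulg1 (torusM nzL nzL); congr torus.
by apply/funext => j; rewrite M_sq.
Qed.

Section Orientation.
Hypothesis t1_or : forall j, is_h j -> 0 < gmap t1 (lshift p j) U_(rshift p j)%MM / lam j.

(** Conjugation by [torus a] multiplies A by a^2. What is needed is a root a of r = L / A with
    [vrho a = a], so that [torus a] commutes with rho. *)
Lemma normalize_tau1 : exists2 K, alpha K = K & (K * t1 = tau1_hat * K)%g.
Proof.
have [A A0 t1E] := reversor_form; have A0' := nz_vinv A0.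
have Ah j : gmap t1 (lshift p j) U_(rshift p j)%MM = A j 0%MM.
  have Psw := @pointed_sw R p.
  rewrite t1E gmM (gmtorus A0) gmswap mcompE emapL (pscompM _ _ Psw).
  rewrite (pscomp_psX _ Psw) /pmap swL.
  by rewrite -[U_(_)%MM]add0m psmulX_coef (pscomp_at0 _ Psw) zcomp_at0.
(* Inserting [t1 = torus A * swap] into [torus M = t1 * alpha t1] gives M = A / vrho A; with
   [L_conj], this makes r real for rho. *)
have MA : vmul M (vrho A) = A.
  apply: (torus_inj (nz_vmul nzM (nz_vrho A0)) A0).
  rewrite -(torusM nzM (nz_vrho A0)) -(alpha_torus A0) t1_sigma t1E.
  rewrite anticonjM alpha_swap (alpha_torus A0) -!mulgA; have rA0 := nz_vrho A0.
  rewrite (mulgA (@swap R p)) {1}(swap_torus rA0) -mulgA swapKl.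
  by rewrite (torusM (nz_vinv rA0) rA0) (vmulVf rA0) torus1 mulg1.
pose r := vmul L (vinv A).
have r0 : nz r by exact: nz_vmul nzL A0'.
have rr : vrho r = r.
  have LL : vmul L L = M by apply/funext => j; rewrite M_sq.
  have E : vinv (vrho A) = vmul M (vinv A).
    rewrite -{2}MA (vinvM nzM (nz_vrho A0)) vmulKl //; exact: nzM.
  rewrite /r (vrhoM nzL A0') L_conj (vrho_inv A0) E -LL -!vmulA vmulC.
  by rewrite -!vmulA (vmulC _ (vinv L)) (vmulKl _ nzL) vmulC.
pose c j := sqrtC (r j 0%MM).
have c0 j : c j != 0 by rewrite sqrtC_eq0.
have H j : exists g, g * g = r j /\ g 0%MM = c j.
  by have [g gE gc] := sqrt_exists (c0 j) (sqrtCK (r j 0%MM)); exists g.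
have [g gP] := boolp.choice H.
(* For a pair of complex indices the root is chosen at one index and transported by rho to the
   other, so that reality holds by construction. *)
pose a j := if is_s' j then rc (g (partner j)) else g j.
have rp j : is_e j = false -> rc (r (partner j)) = r j.
  move=> e; have := congr1 (fun F : 'I_p -> series R p => F j) rr.
  by rewrite /vrho e.
have re j : is_e j -> rc (psinv (r j)) = r j.
  move=> e; have := congr1 (fun F : 'I_p -> series R p => F j) rr.
  by rewrite /vrho e.
have aa j : a j * a j = r j.
  rewrite /a; case s': (is_s' j); last by case: (gP j).
  by rewrite -rcM (proj1 (gP _)) rp ?(is_s'_notP sgp s').
have a0 : nz a.
  move=> j; apply/eqP => Z; have := r0 j.
  by rewrite -aa psmul0 Z mulr0 eqxx.
have ra : vrho a = a.
  apply/funext => j; rewrite /vrho; case: (kindP sg j) => [h|h|h|h].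
  - rewrite h; have s0 : (psinv (a j)) 0%MM != 0 by apply: psinv0_neq0.
    apply: sqrt_uniq; [|rewrite rc_at0 (psinv0 (a0 j))|exact: rc_neq0].
      by rewrite -rcM -(psinvM (a0 j) (a0 j)) aa (re _ h).
    (* Elliptic j: the reality of r gives |r(0)| = 1, so |a(0)|^4 = 1 and |a(0)| = 1, whichever root
       was chosen. *)
    have : (a j 0%MM * (a j 0%MM)^* ) ^+ 2 = 1.
      have r0j : r j 0%MM = a j 0%MM * a j 0%MM by rewrite -psmul0 aa.
      have := congr1 (fun f : series R p => f 0%MM) (re j h).
      rewrite /= rc_at0 (psinv0 (r0 j)) r0j => E.
      rewrite expr2 mulrACA -{1}E -rmorphM -rmorphM mulVf ?rmorph1 //.
      by rewrite mulf_neq0.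
    move/eqP; rewrite sqrp_eq1 ?mul_conjC_ge0 // => /eqP E.
    by rewrite fmorphV -[LHS]mul1r -E -mulrA mulfV ?mulr1 // conjC_eq0.
  - rewrite (is_h_notP sgp h) (partner_h sgp h).
    have aE : a j = g j by rewrite /a (is_h_notP sgp h).
    apply: sqrt_uniq; [|rewrite rc_at0|exact: rc_neq0].
      by rewrite -rcM aa -{1}(partner_h sgp h) rp ?(is_h_notP sgp h).
    (* Hyperbolic j: a root of r(0) is real only if r(0) is not negative, and the orientation gives
       A(0) / lambda_j > 0. *)
    rewrite aE (proj2 (gP j)); apply: CrealP; apply: ger0_real.
    rewrite sqrtC_ge0 /r /vmul psmul0 L0 /vinv (psinv0 (A0 j)) -invr_ge0 invfM invrK mulrC.
    by rewrite -(Ah j); apply/ltW/t1_or.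
  - rewrite (is_s_notP sgp h) /a is_s'_partner // h partnerK // rcK //.
    by rewrite (is_s_notP sgp h).
  - by rewrite (is_s'_notP sgp h) /a is_s'_partner // h (is_s'_notP sgp h).
exists (torus a); first by rewrite (alpha_torus a0) ra.
have aA0 := nz_vmul a0 A0.
rewrite t1E mulgA (torusM a0 A0) /tau1_hat -lock -mulgA (swap_torus a0) mulgA.
rewrite (torusM nzL (nz_vinv a0)).
suff -> : vmul a A = vmul L (vinv a) by [].
apply: (vmul_cancel a0); rewrite vmulA.
have -> : vmul a a = r by apply/funext => j; apply: aa.
rewrite /r -vmulA (vmulVf A0) (vmulC L (vinv a)) (vmulKl _ a0).
by apply/funext => j; rewrite /vmul mulr1.
Qed.

End Orientation.
End Involution.
End Normalization.
End TorusRho.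

(** * Deck transformations of product quadrics *)

Section Deck.
Variables (R : realType) (p : nat).
Local Notation C := R[i].
Variables (g : 'I_p -> C) (pt : 'I_p -> 'I_p) (E : formal_map R (p + p) p).
Hypothesis ptK : involutive pt.
Hypothesis g0 : forall k, g k != 0.

(** A linear form whose square is the quadratic part of E_k; to first order, a deck transformation
    can only change its sign. *)
Definition uform k : series R (p + p) :=
  psX R (lshift p k) + (2 * g k) *: psX R (rshift p (pt k)).

Hypothesis E_quad : forall k, eqd 3 (E k) (uform k ^+ 2).

Definition formal_deck (F : formal_map R (p + p) (p + p)) :=
  biholo F /\ mcomp (graph E) F = graph E.

Let two_neq0 : (2 : C) != 0. Proof. by rewrite pnatr_eq0. Qed.
Let g20 k : 2 * g k != 0. Proof. by rewrite mulf_neq0. Qed.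

Lemma uform0 k : uform k 0%MM = 0.
Proof. by rewrite /uform psaddE pszE !psX0 mulr0 addr0. Qed.

Lemma uform_coefL k l : uform k U_(lshift p l)%MM = (l == k)%:R.
Proof.
have [e1 [_ [e3 e4]]] := @lrE p.
by rewrite /uform psaddE pszE !psX_coef !mnmU_eq e1 e3 mulr0 addr0.
Qed.

Lemma E0 k : E k 0%MM = 0.
Proof. by rewrite E_quad ?mdeg0 // pspow0 uform0 expr0n. Qed.

Lemma graphL k : graph E (lshift p k) = psX R (lshift p k).
Proof. exact: glueL. Qed.
Lemma graphR k : graph E (rshift p k) = E k.
Proof. exact: glueR. Qed.

Section OneDeck.
Variable F : formal_map R (p + p) (p + p).
Hypothesis dF : formal_deck F.

Lemma deck_pointed : pointed F. Proof. exact: biholo_pointed dF.1. Qed.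

Lemma deck_fst k : F (lshift p k) = psX R (lshift p k).
Proof.
have := congr1 (fun G : formal_map R _ _ => G (lshift p k)) dF.2.
by rewrite mcompE graphL (pscomp_psX _ deck_pointed).
Qed.

Lemma deck_E k : pscomp (E k) F = E k.
Proof.
have := congr1 (fun G : formal_map R _ _ => G (rshift p k)) dF.2.
by rewrite mcompE graphR.
Qed.

Lemma deck_uform k : pscomp (uform k) F =
  psX R (lshift p k) + (2 * g k) *: F (rshift p (pt k)).
Proof.
have F0 := deck_pointed.
by rewrite /uform (pscompD _ _ F0) (pscompZ _ _ F0) !(pscomp_psX _ F0) deck_fst.
Qed.

Lemma deck_uform0 k : pscomp (uform k) F 0%MM = 0.
Proof. by rewrite (pscomp_at0 _ deck_pointed) uform0. Qed.

(** F preserves E_k, so (u_k o F)^2 and u_k^2 agree up to degree 2; factor their difference. *)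
Lemma deck_sign k : exists b : bool, eqd 2 (pscomp (uform k) F) ((-1) ^+ b *: uform k).
Proof.
have F0 := deck_pointed.
have H : eqd 3 (pscomp (uform k) F ^+ 2) (uform k ^+ 2).
  have := eqd_compl F0 (eqd_sym (E_quad k)); rewrite deck_E (pscompXn _ _ F0) => H.
  exact: eqd_trans H (E_quad k).
have H1 := (eqd1 _).1 (deck_uform0 k); have H2 := (eqd1 _).1 (uform0 k).
have [|||D|S] := @ord_mul _ _ 1 1 (pscomp (uform k) F - uform k)
    (pscomp (uform k) F + uform k).
- by rewrite -[0]subr0; apply: eqdB.
- by rewrite -[0]addr0; apply: eqdD.
- have -> : (pscomp (uform k) F - uform k) * (pscomp (uform k) F + uform k) =
    pscomp (uform k) F ^+ 2 - uform k ^+ 2 by ring.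
  exact: eqd_subl H.
- by exists false; rewrite expr0 scale1r; apply: eqd_subr.
exists true; rewrite expr1 scaleN1r; apply: eqd_subr; rewrite opprK.
exact: S.
Qed.

Lemma deck_snd k : F (rshift p k) =
  (2 * g (pt k))^-1 *: (pscomp (uform (pt k)) F - psX R (lshift p (pt k))).
Proof. by rewrite deck_uform addrC addKr scalerA mulVf // scale1r ptK. Qed.

End OneDeck.

Lemma sign_neq0 (b : bool) k : ~ eqd 2 ((-1) ^+ b *: uform k) 0.
Proof.
move=> H; have := H U_(lshift p k)%MM; rewrite mdeg1 => /(_ isT)/eqP.
by rewrite pszE uform_coefL eqxx mulr1 ps0E signr_eq0.
Qed.

(** Write E_k = u_k^2 + h with h of order 3. If the two composites with u_k agree to order d + 2,
    the difference of their squares has order d + 4. Their sum is twice u_k up to sign in degree 1,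
    so it has order exactly 1, and their difference has order d + 3. *)
Lemma deck_uniq F F' : formal_deck F -> formal_deck F' ->
  (forall k, eqd 2 (pscomp (uform k) F) (pscomp (uform k) F')) -> F = F'.
Proof.
move=> dF dF' H; have F0 := deck_pointed dF; have F0' := deck_pointed dF'.
have P d : forall k, eqd d.+2 (pscomp (uform k) F) (pscomp (uform k) F').
  elim: d => [|d IH] k; first exact: H.
  have FF : eqdm d.+2 F F'.
    apply: ord_lr => j; first by rewrite (deck_fst dF) (deck_fst dF'); apply: eqd_refl.
    rewrite (deck_snd dF) (deck_snd dF'); apply: eqdZ; apply: eqdB; first exact: IH.
    exact: eqd_refl.
  pose h := E k - uform k ^+ 2.
  have h0 : eqd 3 h 0 by apply: eqd_subl; apply: E_quad.
  have Eh : E k = uform k ^+ 2 + h by rewrite /h addrC subrK.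
  have : pscomp (E k) F = pscomp (E k) F' by rewrite (deck_E dF) (deck_E dF').
  rewrite Eh.
  rewrite (pscompD _ _ F0) (pscompD _ _ F0') (pscompXn _ _ F0) (pscompXn _ _ F0') => EE.
  have hd : eqd (d.+2 + 2) (pscomp h F') (pscomp h F).
    by apply: eqd_compr_ord F0' F0 h0 _ => i; apply/eqd_sym/FF.
  have [|||D|S] := @ord_mul _ _ d.+2 1 (pscomp (uform k) F - pscomp (uform k) F')
      (pscomp (uform k) F + pscomp (uform k) F').
  - exact/eqd_subl/IH.
  - rewrite -[0]addr0; apply: eqdD; apply/eqd1; first exact: deck_uform0 dF k.
    exact: deck_uform0 dF' k.
  - have -> : (pscomp (uform k) F - pscomp (uform k) F') *
        (pscomp (uform k) F + pscomp (uform k) F') = pscomp h F' - pscomp h F.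
      move: EE; move: (pscomp _ F) (pscomp _ F') (pscomp h F) (pscomp h F') => x y a b EE.
      by rewrite -[b](addKr (y ^+ 2)) -EE; ring.
    by rewrite addn1 -addn2; apply: eqd_subl.
  - by apply: eqd_subr.
  have [b Sb] := deck_sign dF k; exfalso; apply: (@sign_neq0 b k).
  have S2 : eqd 2 (2 *: pscomp (uform k) F) 0.
    rewrite scaler_nat mulr2n; apply: (eqd_trans _ S); apply: eqdD; first exact: eqd_refl.
    exact: H.
  apply: (eqd_trans (eqd_sym Sb)) => m m2; have := S2 m m2; rewrite pszE ps0E => /eqP.
  by rewrite mulf_eq0 (negbTE two_neq0) => /eqP.
apply: map_lr => j; first by rewrite (deck_fst dF) (deck_fst dF').
have Pj k : pscomp (uform k) F = pscomp (uform k) F'.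
  by apply: eqd_eq => d; apply: eqd_le (P d k); rewrite -addn2 leq_addr.
by rewrite (deck_snd dF) (deck_snd dF') Pj.
Qed.

Definition has_signs (F : formal_map R (p + p) (p + p)) (b : 'I_p -> bool) :=
  forall k, eqd 2 (pscomp (uform k) F) ((-1) ^+ b k *: uform k).

Lemma deck_signs F : formal_deck F -> exists b : {ffun 'I_p -> bool}, has_signs F b.
Proof.
move=> dF; have [b bP] := boolp.choice (deck_sign dF).
by exists [ffun k => b k] => k; rewrite ffunE.
Qed.

Lemma deck_comp F F' : formal_deck F -> formal_deck F' -> formal_deck (mcomp F F').
Proof.
move=> dF dF'; have F0 := deck_pointed dF; have F0' := deck_pointed dF'.
split; first exact: biholo_comp dF.1 dF'.1.
by rewrite (mcompA _ F0 F0') dF.2 dF'.2.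
Qed.

Lemma has_signs_comp F F' b b' : pointed F -> pointed F' ->
  has_signs F b -> has_signs F' b' ->
  has_signs (mcomp F F') (fun k => b k (+) b' k).
Proof.
move=> F0 F0' Fb Fb' k; rewrite -(pscompA _ F0 F0').
apply: (eqd_trans (eqd_compl F0' (Fb k))).
rewrite (pscompZ _ _ F0') signr_addb -scalerA; apply: eqdZ.
exact: Fb'.
Qed.

Section FullDeck.
Hypothesis full : forall b : {ffun 'I_p -> bool}, exists2 F, formal_deck F & has_signs F b.

Definition Zmap (k : 'I_p) : formal_map R (p + p) (p + p) :=
  dmap (lrfun (fun=> 1) (fun l => (-1) ^+ (l == k))).

Lemma sum_bool_neq0 : (2 ^+ p : C) != 0. Proof. by rewrite expf_neq0. Qed.

(* X averages the functions u_k over the deck group, with the signs by which the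
   linear parts of the deck transformations act on them. *)
Lemma linearization : exists X : formal_map R (p + p) (p + p),
  [/\ biholo X, forall k, X (lshift p k) = psX R (lshift p k),
      forall k, eqd 2 (X (rshift p k)) (uform k)
    & forall T k0, formal_deck T -> has_signs T (fun k => k == k0) ->
        mcomp X T = mcomp (Zmap k0) X].
Proof.
have H (b : {ffun 'I_p -> bool}) : exists F, formal_deck F /\ has_signs F b.
  by have [F] := full b; exists F.
have [F FP] := boolp.choice H.
pose A k : series R (p + p) :=
  (2 ^- p) *: \sum_(b : {ffun 'I_p -> bool}) (-1) ^+ b k *: pscomp (uform k) (F b).
have Alin k : eqd 2 (A k) (uform k).
  have <- : (2 ^- p) *: \sum_(b : {ffun 'I_p -> bool}) uform k = uform k.
    rewrite sumr_const card_ffun card_bool card_ord -[uform k *+ _]scaler_nat scalerA natrX.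
    by rewrite mulVf ?scale1r // sum_bool_neq0.
  apply: eqdZ; apply: eqd_sum => b; have [_ Fb] := FP b.
  have -> : uform k = (-1) ^+ b k *: ((-1) ^+ b k *: uform k).
    by rewrite scalerA -signr_addb addbb expr0 scale1r.
  by apply: eqdZ; have := Fb k; rewrite scalerA -signr_addb addbb expr0 scale1r.
pose X : formal_map R (p + p) (p + p) := glue (fun k => psX R (lshift p k)) A.
have X0 : pointed X.
  apply: ord_lr => k; rewrite /X ?glueL ?glueR ?psX0 //.
  by rewrite Alin ?mdeg0 // uform0.
exists X; split.
- split=> //.
  (* [X1] has the linear part of X; its inverse [Y] solves u_k for the variable of index [pt k]. *)
  pose X1 : formal_map R (p + p) (p + p) := glue (fun k => psX R (lshift p k)) uform.
  pose Y : formal_map R (p + p) (p + p) := glue (fun k => psX R (lshift p k))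
    (fun l => (2 * g (pt l))^-1 *: (psX R (rshift p (pt l)) - psX R (lshift p (pt l)))).
  have Y0 : pointed Y.
    apply: ord_lr => k; rewrite /Y ?glueL ?glueR ?psX0 // pszE psaddE psoppE !psX0.
    by rewrite subr0 mulr0.
  have XY : mcomp X1 Y = mid.
    apply: map_lr => k; rewrite mcompE /X1 ?glueL ?glueR /uform.
      by rewrite (pscomp_psX _ Y0) /Y glueL.
    rewrite (pscompD _ _ Y0) (pscompZ _ _ Y0) !(pscomp_psX _ Y0) /Y glueL glueR.
    by rewrite ptK scalerA mulfV // scale1r addrC subrK.
  have := jacobian0_comp X1 Y0; rewrite XY jacobian0_mid => /esym /mulmx1_unit [uX1 _].
  suff -> : jacobian0 X = jacobian0 X1 by [].
  apply/matrixP => i j; rewrite !mxE; move: i; apply: ord_lr => k.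
    by rewrite /X /X1 !glueL.
  by rewrite /X /X1 !glueR Alin ?mdeg1.
- by move=> k; rewrite /X glueL.
- by move=> k; rewrite /X glueR.
move=> T k0 dT Tb; have T0 := deck_pointed dT.
rewrite (dmap_comp _ X0); apply: map_lr => k; rewrite mcompE.
  by rewrite /X !glueL lrfunL scale1r (pscomp_psX _ T0) (deck_fst dT).
rewrite /X !glueR lrfunR /A (pscompZ _ _ T0) scalerA mulrC -scalerA; apply: (congr1 (GRing.scale _)).
rewrite (pscomp_sum _ _ _ T0) scaler_sumr.
(* By [deck_uniq], F_b followed after T is the deck transformation with signs [tr b]; reindexing the
   average by [tr] produces the sign of Z_k0. *)
pose tr (b : {ffun 'I_p -> bool}) : {ffun 'I_p -> bool} := [ffun l => b l (+) (l == k0)].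
have trK : involutive tr by move=> b; apply/ffunP => l; rewrite !ffunE -addbA addbb addbF.
rewrite [RHS](reindex_inj (inv_inj trK)); apply: eq_bigr => b _.
have [dF Fb] := FP b; have [dF' Fb'] := FP (tr b); have F0 := deck_pointed dF.
rewrite (pscompZ _ _ T0) (pscompA _ F0 T0) scalerA -signr_addb ffunE addbCA addbb addbF.
suff -> : mcomp (F b) T = F (tr b) by [].
apply: deck_uniq; [exact: deck_comp|exact: dF'|] => l.
apply: (eqd_trans (has_signs_comp F0 T0 Fb Tb l)); apply: eqd_sym.
by apply: (eqd_trans (Fb' l)); rewrite ffunE; apply: eqd_refl.
Qed.

End FullDeck.

End Deck.

(** * Parity weights and the class C^c *)

Section ParityWeights.
Variables (R : realType) (p : nat).
Local Notation C := R[i].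

(** Grading by the parities of the eta-exponents, which are what the sign changes Z_k detect. *)
Definition zw : 'I_(p + p) -> 'rV['F_2]_p := lrfun (fun=> 0) (fun j => delta_mx 0 j).

Lemma F2_nat (n : nat) : (n%:R : 'F_2) = (odd n)%:R.
Proof. by apply/val_inj; rewrite /= !val_Fp_nat // !modn2; case: (odd n). Qed.

Lemma wt_zwE (m : 'X_{1..p + p}) j : wt zw m 0 j = (odd (m (rshift p j)))%:R.
Proof.
rewrite /wt lr_sum summxE (bigD1 j isT) /= big1 ?addr0 => [|k kj].
  rewrite /zw lrfunL lrfunR mul0rn add0r mulmxnE mxE !eqxx /=.
  exact: F2_nat.
by rewrite /zw lrfunL lrfunR mul0rn add0r mulmxnE mxE eq_sym (negbTE kj) mul0rn.
Qed.

Lemma F2_bool_inj (b c : bool) : (b%:R : 'F_2) = c%:R -> b = c.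
Proof. by move=> /(congr1 val); case: b; case: c. Qed.

Lemma wt_zw0P (m : 'X_{1..p + p}) :
  (wt zw m == 0) = [forall k, ~~ odd (m (rshift p k))].
Proof.
apply/eqP/forallP => [w0 k|H].
  by have := wt_zwE m k; rewrite w0 mxE => /esym /(F2_bool_inj (c := false)) ->.
by apply/rowP => k; rewrite wt_zwE mxE (negbTE (H k)).
Qed.

Lemma wt_zwP (m : 'X_{1..p + p}) j :
  (wt zw m == delta_mx 0 j) = [forall k, odd (m (rshift p k)) == (k == j)].
Proof.
apply/eqP/forallP => [w0 k|H].
  by have := wt_zwE m k; rewrite w0 mxE eqxx /= => /esym /F2_bool_inj ->.
by apply/rowP => k; rewrite wt_zwE mxE eqxx (eqP (H k)).
Qed.

(** The part of psi that commutes with all the Z_k. *)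
Definition zproj (psi : formal_map R (p + p) (p + p)) : formal_map R (p + p) (p + p) :=
  fun i => wproj zw (zw i) (psi i).

Lemma zprojP psi i m : zproj psi i m = if wt zw m == zw i then psi i m else 0.
Proof. by []. Qed.

Lemma mid_weighted : weightedm zw zw (@mid R (p + p)).
Proof. by move=> i; apply: weighted_psX. Qed.

(** The monomials forbidden in C^c are those of degree above 1 whose parity is that of the
    component. Given tangency to the identity, their absence says that the part commuting with the
    Z_k is the identity. *)
Lemma Cc_ZP psi : Cc_Z psi <-> tangent_to_id psi /\ zproj psi = mid.
Proof.
have midE i (m : 'X_{1..p + p}) : (1 < mdeg m)%N -> (@mid R (p + p)) i m = 0.
  move=> m1; rewrite /mid psX_coef; case: eqP => // mU.
  by move: m1; rewrite mU mdeg1.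
split=> [[tpsi Hl Hr]|[tpsi zpsi]].
  split=> //; apply/funext => i; apply/funext => m; rewrite zprojP.
  case: (leqP (mdeg m) 1) => [m1|m1].
    rewrite tpsi // -/(@mid R (p + p) i m); case: eqP => // wm.
    apply/esym/eqP; apply: contra_notT wm => /mid_weighted.
    by [].
  rewrite midE //; move: i; apply: ord_lr => j; rewrite /zw ?lrfunL ?lrfunR.
    rewrite wt_zw0P; case: forallP => // H; exact: Hl.
  rewrite wt_zwP; case: forallP => // H; apply: Hr => // k; exact/eqP.
split=> // j m m1 H.
  have := congr1 (fun F : formal_map R _ _ => F (lshift p j) m) zpsi.
  by rewrite zprojP midE // /zw lrfunL wt_zw0P; case: forallP.
have := congr1 (fun F : formal_map R _ _ => F (rshift p j) m) zpsi.
rewrite zprojP midE // /zw lrfunR wt_zwP; case: forallP => // -[] k.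
by apply/eqP; exact: H.
Qed.

Lemma zproj_weighted psi : weightedm zw zw (zproj psi).
Proof. by move=> i; apply: wproj_weighted. Qed.

(** This is why psi0 kappa^-1, with kappa = [zproj psi0], has the identity as its part of the right
    parity. *)
Lemma zproj_comp psi kappa : weightedm zw zw kappa -> pointed kappa ->
  zproj (mcomp psi kappa) = mcomp (zproj psi) kappa.
Proof.
move=> kw k0; apply/funext => i; rewrite mcompE /zproj mcompE.
by rewrite (wproj_comp _ _ kw k0).
Qed.

Definition zsgn (k : 'I_p) : 'I_(p + p) -> C := lrfun (fun=> 1) (fun l => (-1) ^+ (l == k)).

Lemma ZmapE k : Zmap R k = dmap (zsgn k). Proof. by []. Qed.

Lemma zsgn_prod k (m : 'X_{1..p + p}) :
  \prod_i zsgn k i ^+ m i = (-1) ^+ odd (m (rshift p k)).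
Proof.
rewrite lr_prod (bigD1 k isT) /= big1 => [|l lk].
  by rewrite /zsgn lrfunL lrfunR eqxx expr1n mul1r mulr1 expr1 signr_odd.
by rewrite /zsgn lrfunL lrfunR (negbTE lk) !expr1n mulr1.
Qed.

Lemma zw_of_signs_wt i (m : 'X_{1..p + p}) :
  (forall k, \prod_l zsgn k l ^+ m l = zsgn k i) -> wt zw m = zw i.
Proof.
move=> H; apply/rowP => k; have := H k; rewrite zsgn_prod wt_zwE; move: {H} i.
have sg_inj (b b' : bool) : (-1) ^+ b = (-1) ^+ b' :> C -> b = b'.
  have N : (1 : C) <> -1.
    by move=> /eqP; rewrite -subr_eq0 opprK -mulr2n pnatr_eq0.
  by case: b; case: b' => //; rewrite expr0 expr1 => E; case: N; first [exact: E|exact: esym E].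
apply: ord_lr => j; rewrite /zsgn /zw ?lrfunL ?lrfunR mxE.
  by rewrite -[1]/((-1) ^+ false) => /sg_inj ->.
by move/sg_inj ->; rewrite eqxx /= eq_sym.
Qed.

Lemma zsgn_wt k i (m : 'X_{1..p + p}) : wt zw m = zw i ->
  \prod_l zsgn k l ^+ m l = zsgn k i.
Proof.
rewrite zsgn_prod => wm; have := wt_zwE m k; rewrite wm; move: i {wm}.
apply: ord_lr => j; rewrite /zw /zsgn ?lrfunL ?lrfunR mxE.
  by move=> /(F2_bool_inj (b := false)) <-.
by rewrite eqxx /= eq_sym => /F2_bool_inj <-.
Qed.

Lemma weighted_comm_Z psi k : weightedm zw zw psi -> pointed psi ->
  mcomp psi (Zmap R k) = mcomp (Zmap R k) psi.
Proof.
move=> pw p0; rewrite (dmap_comp _ p0); apply/funext => i; apply/funext => m.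
rewrite mcompE pscomp_dmap pszE; case: (eqVneq (psi i m) 0) => [->|/pw wm].
  by rewrite mul0r mulr0.
by rewrite mulrC (zsgn_wt k wm).
Qed.

Lemma comm_Z_weighted psi : pointed psi ->
  (forall k, mcomp psi (Zmap R k) = mcomp (Zmap R k) psi) -> weightedm zw zw psi.
Proof.
move=> p0 H i m pm; apply: zw_of_signs_wt => k; apply: (mulIf pm).
have := congr1 (fun F : formal_map R _ _ => F i m) (H k).
by rewrite (dmap_comp _ p0) mcompE pscomp_dmap pszE mulrC.
Qed.

Lemma zproj_lin psi : pointed psi ->
  (forall k, eqdm 2 (mcomp psi (Zmap R k)) (mcomp (Zmap R k) psi)) ->
  eqdm 2 (zproj psi) psi.
Proof.
move=> p0 H i m m2; rewrite zprojP; case: eqP => // wm.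
apply/esym/eqP; apply: contra_notT wm => pm; apply: zw_of_signs_wt => k; apply: (mulIf pm).
by have := H k i m m2; rewrite (dmap_comp _ p0) mcompE pscomp_dmap pszE mulrC.
Qed.

End ParityWeights.

Section ProductGerms.
Variables (R : realType) (p : nat).
Local Notation C := R[i].

Lemma compose_all_germ n q (x : 'I_q -> germ R n) :
  compose_all (fun j => gmap (x j)) = gmap (\prod_(j < q) x j)%g.
Proof.
rewrite /compose_all; elim/big_rec2: _ => [|j y F _ ->]; first by rewrite gm1.
by rewrite gmM.
Qed.

Lemma zsgn_neq0 (k : 'I_p) i : zsgn R k i != 0.
Proof.
by move: i; apply: (@ord_lr p) => j; rewrite /zsgn ?lrfunL ?lrfunR ?oner_neq0 ?signr_eq0.
Qed.

Fact gdmap_spec n (d : 'I_n -> C) :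
  {x : germ R n | (forall i, d i != 0) -> gmap x = dmap d}.
Proof.
case: (pselect (forall i, d i != 0)) => [d0|H]; last by exists 1%g.
by exists (Germ (biholo_dmap d0)).
Qed.
Definition gdmap n (d : 'I_n -> C) : germ R n := sval (gdmap_spec d).
Lemma gmdmap n (d : 'I_n -> C) : (forall i, d i != 0) -> gmap (gdmap d) = dmap d.
Proof. exact: (svalP (gdmap_spec d)). Qed.

Definition gZ (k : 'I_p) : germ R (p + p) := gdmap (zsgn R k).
Lemma gmZ k : gmap (gZ k) = Zmap R k.
Proof. by rewrite ZmapE -gmdmap //; apply: zsgn_neq0. Qed.

Definition Zall : germ R (p + p) := gdmap (lrfun (fun=> 1) (fun=> -1)).

(** Stated for any injective numbering, as the generators tau_j come in an order unrelated to that
    of the coordinates. *)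
Lemma prod_gZ (pi : 'I_p -> 'I_p) : injective pi -> (\prod_(j < p) gZ (pi j))%g = Zall.
Proof.
move=> pi_inj.
have H (r : seq 'I_p) : gmap (\prod_(j <- r) gZ (pi j))%g =
    dmap (fun i => \prod_(j <- r) zsgn R (pi j) i).
  elim: r => [|j r IH].
    rewrite big_nil gm1 -dmap1; congr dmap; apply/funext => i.
    by rewrite big_nil.
  rewrite big_cons gmM IH gmZ ZmapE dmap_dmap; congr dmap; apply/funext => i.
  by rewrite big_cons.
apply: germ_inj; rewrite H gmdmap; last first.
  by apply: ord_lr => j; rewrite ?lrfunL ?lrfunR ?oppr_eq0 oner_neq0.
congr dmap; apply/funext => i.
have -> : \prod_(j < p) zsgn R (pi j) i = \prod_k zsgn R k i.
  by rewrite [RHS](reindex_inj pi_inj).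
move: i; apply: ord_lr => j; rewrite ?lrfunL ?lrfunR.
  by apply: big1 => k _; rewrite /zsgn lrfunL.
rewrite (bigD1 j isT) /= big1 => [|k kj]; first by rewrite /zsgn lrfunR eqxx mulr1 expr1.
by rewrite /zsgn lrfunR eq_sym (negbTE kj) expr0.
Qed.

Lemma gZ_inj : injective gZ.
Proof.
move=> k l /(congr1 (fun x => gmap x (rshift p k) U_(rshift p k)%MM)).
rewrite !gmZ !ZmapE /dmap !pszE !psX_coef !eqxx !mulr1 /zsgn !lrfunR eqxx expr1.
case: eqP => // _ /eqP.
by rewrite expr0 eq_sym -subr_eq0 opprK -mulr2n pnatr_eq0.
Qed.

End ProductGerms.

(** * Straightening of the standard reflections *)

Section Straighten.
Variables (R : realType) (p : nat) (L : formal_map R p p).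
Local Notation C := R[i].
Hypothesis L0 : nz L.

Let LV := vmulV L0.
Let VL := vmulVl L0.

Lemma straightenL j : straighten L (lshift p j) =
  psX R (lshift p j) + zcomp (L j) * psX R (rshift p j).
Proof. exact: glueL. Qed.
Lemma straightenR j : straighten L (rshift p j) =
  psX R (rshift p j) - zcomp (psinv (L j)) * psX R (lshift p j).
Proof. exact: glueR. Qed.

Lemma pointed_straighten : pointed (straighten L).
Proof.
apply: ord_lr => j; rewrite ?straightenL ?straightenR !psaddE ?psoppE psmul0 !psX0 mulr0.
  by rewrite addr0.
by rewrite subr0.
Qed.

(** Product of the standard reflections over the indices selected by b: one index gives a single
    reflection, all of them give [tau1_hat]. *)
Definition flip (b : 'I_p -> bool) : formal_map R (p + p) (p + p) :=
  lrfun (fun j => if b j then zcomp (L j) * psX R (rshift p j) else psX R (lshift p j))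
    (fun j => if b j then zcomp (psinv (L j)) * psX R (lshift p j) else psX R (rshift p j)).

Lemma flipL b j : flip b (lshift p j) =
  if b j then zcomp (L j) * psX R (rshift p j) else psX R (lshift p j).
Proof. exact: lrfunL. Qed.
Lemma flipR b j : flip b (rshift p j) =
  if b j then zcomp (psinv (L j)) * psX R (lshift p j) else psX R (rshift p j).
Proof. exact: lrfunR. Qed.

Lemma tau_hat_flip k : tau_hat L k = flip (fun j => j == k).
Proof.
apply: map_lr => j; rewrite /tau_hat ?glueL ?glueR ?flipL ?flipR;
  by case: (j =P k) => [->|_].
Qed.

Lemma pointed_flip b : pointed (flip b).
Proof.
apply: ord_lr => j; rewrite ?flipL ?flipR; case: (b j); rewrite ?psX0 //;
  by rewrite psmul0 psX0 mulr0.
Qed.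

Lemma zcompLV j : zcomp (L j) * zcomp (psinv (L j)) = 1.
Proof. by rewrite -zcompM LV zcomp1. Qed.

Lemma zcompVL j : zcomp (psinv (L j)) * zcomp (L j) = 1.
Proof. by rewrite mulrC zcompLV. Qed.

Lemma zcomp_flip f b : pscomp (zcomp f) (flip b) = zcomp f.
Proof.
have T0 := pointed_flip b; rewrite /zcomp (pscompA _ (@pointed_xi_eta R p) T0).
suff -> : mcomp (@xi_eta R p) (flip b) = @xi_eta R p by [].
apply/funext => j; rewrite mcompE xi_etaE (pscompM _ _ T0) !(pscomp_psX _ T0).
rewrite flipL flipR; case: (b j); last by [].
by rewrite mulrACA zcompLV mul1r mulrC.
Qed.

(** A flip preserves zeta, hence L(zeta); at a selected index it fixes xi_j + L_j eta_j and negates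
    eta_j - L_j^-1 xi_j. *)
Lemma straighten_flip b : mcomp (straighten L) (flip b) =
  mcomp (dmap (lrfun (fun=> 1) (fun j => (-1) ^+ b j))) (straighten L).
Proof.
have T0 := pointed_flip b; rewrite (dmap_comp _ pointed_straighten).
apply: map_lr => j; rewrite mcompE ?straightenL ?straightenR ?lrfunL ?lrfunR.
  rewrite scale1r (pscompD _ _ T0) (pscompM _ _ T0) !(pscomp_psX _ T0) zcomp_flip.
  rewrite flipL flipR; case: (b j); last by [].
  by rewrite mulrA zcompLV mul1r addrC.
rewrite (pscompB _ _ T0) (pscompM _ _ T0) !(pscomp_psX _ T0) zcomp_flip.
rewrite flipL flipR; case: (b j); last by rewrite expr0 scale1r.
by rewrite mulrA zcompVL mul1r expr1 scaleN1r opprB.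
Qed.

(** The linear part splits into the blocks xi + l eta, eta - l^-1 xi of determinant 2; [Y1] is its
    inverse. *)
Lemma biholo_straighten : biholo (straighten L).
Proof.
have lin f i : eqd 2 (zcomp f * psX R i) (f 0%MM *: psX R i).
  have -> : f 0%MM *: psX R i = (f 0%MM)%:A * psX R i by rewrite -scalerAl mul1r.
  apply: eqd_subr; rewrite -mulrBl.
  apply: (@eqd0M _ _ 1 1); apply/eqd1; last exact: psX0.
  by rewrite psaddE psoppE pszE ps1E eqxx mulr1 zcomp_at0 subrr.
pose l j := L j 0%MM.
pose S1 : formal_map R (p + p) (p + p) :=
  glue (fun j => psX R (lshift p j) + l j *: psX R (rshift p j))
       (fun j => psX R (rshift p j) - (l j)^-1 *: psX R (lshift p j)).
pose Y1 : formal_map R (p + p) (p + p) :=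
  glue (fun j => 2^-1 *: (psX R (lshift p j) - l j *: psX R (rshift p j)))
       (fun j => 2^-1 *: (psX R (rshift p j) + (l j)^-1 *: psX R (lshift p j))).
have S1E : eqdm 2 (straighten L) S1.
  apply: ord_lr => j; rewrite ?straightenL ?straightenR /S1 ?glueL ?glueR.
    by apply: eqdD; [apply: eqd_refl|apply: lin].
  rewrite /l -(psinv0 (L0 j)); apply: eqdB; [exact: eqd_refl|exact: lin].
have Y10 : pointed Y1.
  by apply: ord_lr => j; rewrite /Y1 ?glueL ?glueR pszE psaddE ?psoppE pszE !psX0
    mulr0 ?oppr0 addr0 mulr0.
have SY : mcomp S1 Y1 = mid.
  have h (v : series R (p + p)) : 2^-1 *: v + 2^-1 *: v = v.
    rewrite -scalerDl -mulr2n -[2^-1 *+ 2]mulr_natr mulVf ?scale1r //.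
    by rewrite pnatr_eq0.
  apply: map_lr => j; rewrite mcompE /S1 ?glueL ?glueR.
    rewrite (pscompD _ _ Y10) (pscompZ _ _ Y10) !(pscomp_psX _ Y10) /Y1 glueL glueR.
    rewrite scalerA mulrC -scalerA -scalerDr [l j *: (_ + _)]scalerDr (scalerA (l j)) mulfV ?scale1r; last exact: L0.
    rewrite addrA subrK scalerDr; exact: h.
  rewrite (pscompB _ _ Y10) (pscompZ _ _ Y10) !(pscomp_psX _ Y10) /Y1 glueL glueR.
  rewrite scalerA mulrC -scalerA -scalerBr [(l j)^-1 *: (_ - _)]scalerBr (scalerA _ (l j)) mulVf ?scale1r; last exact: L0.
  rewrite opprB addrCA addrK scalerDr; exact: h.
split; first exact: pointed_straighten.
have := jacobian0_comp S1 Y10; rewrite SY jacobian0_mid => /esym /mulmx1_unit [u _].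
suff -> : jacobian0 (straighten L) = jacobian0 S1 by [].
by apply/matrixP => i j; rewrite !mxE (S1E i) ?mdeg1.
Qed.

End Straighten.

(** * Parameters of product quadrics *)

Section QuadricParameters.
Variables (R : realType) (p : nat) (sg : signature) (gam lam : 'I_p -> R[i]).
Local Notation C := R[i].
Hypothesis hq : quadric_params sg gam lam.
Hypothesis hnr : non_resonant lam.
Local Notation is_e := (@is_e p sg).
Local Notation is_h := (@is_h p sg).
Local Notation is_s := (@is_s p sg).
Local Notation is_s' := (@is_s' p sg).
Local Notation partner := (@partner p sg).

Lemma params_sum : (ne sg + nh sg + (ns sg).*2)%N = p. Proof. by case: hq. Qed.

Lemma params_e j : is_e j -> [/\ 0 < gam j < 2^-1, 1 < lam j
  & gam j = (lam j + (lam j)^-1)^-1].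
Proof. by case: hq => _ H _ _ _; apply: H. Qed.
Lemma params_h j : is_h j -> [/\ 2^-1 < gam j, `|lam j| = 1,
  0 < 'Re (lam j), 0 < 'Im (lam j) & gam j = (lam j + (lam j)^*)^-1].
Proof. by case: hq => _ _ H _ _; apply: H. Qed.
Lemma params_s j : is_s j -> [/\ 2^-1 < 'Re (gam j), 0 < 'Im (gam j)
    & gam j = (1 + (lam j) ^- 2)^-1] /\
  [/\ 1 < `|lam j|, 0 < 'Re (lam j) & 0 < 'Im (lam j)].
Proof. by case: hq => _ _ _ H _; apply: H. Qed.
Lemma lam_s j : is_s j -> lam (partner j) = ((lam j)^*)^-1.
Proof. by case: hq => _ _ _ _; apply. Qed.

Lemma lam_e j : is_e j -> 0 < lam j.
Proof. by move=> /params_e[_ l1 _]; apply: lt_trans l1; apply: ltr01. Qed.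

Lemma lam_h j : is_h j -> (lam j)^* = (lam j)^-1.
Proof. by move=> /params_h[_ l1 _ _ _]; rewrite invC_norm l1 expr1n invr1 mul1r. Qed.

Lemma lam_neq0 j : lam j != 0.
Proof.
case: (kindP sg j) => h.
- by rewrite gt_eqF // lam_e.
- by have [_ l1 _ _ _] := params_h h; rewrite -normr_eq0 l1 oner_neq0.
- by have [_ [l1 _ _]] := params_s h; rewrite -normr_eq0 gt_eqF // (lt_trans _ l1) ?ltr01.
have hs : is_s (partner j) by rewrite is_s_partner // params_sum.
rewrite -(partnerK params_sum j) (lam_s hs) invr_eq0 conjC_eq0.
by have [_ [l1 _ _]] := params_s hs; rewrite -normr_eq0 gt_eqF // (lt_trans _ l1) ?ltr01.
Qed.

Lemma lam_independent : independent (fun j => lam j ^+ 2).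
Proof.
split=> [j|Q E j]; first by rewrite expf_neq0 // lam_neq0.
by apply: contrapT => Qj; apply: (hnr (ex_intro _ j Qj)).
Qed.

Definition coeff_g j : C := if is_s' j then 1 - (gam (partner j))^* else gam j.

Lemma coeff_g_s' j : is_s' j -> coeff_g j = 1 - (gam (partner j))^*.
Proof. by rewrite /coeff_g => ->. Qed.
Lemma coeff_g_N j : is_s' j = false -> coeff_g j = gam j.
Proof. by rewrite /coeff_g => ->. Qed.

Lemma gam_s_neq0 j : is_s j -> gam j != 0.
Proof.
move=> /params_s[[g1 _ _] _]; apply/eqP => G; move: g1; rewrite G.
have /Creal_ReP -> : (0 : C) \is Num.real by apply: rpred0.
by move/(lt_trans (_ : 0 < 2^-1)); rewrite ltxx invr_gt0 ltr0n => /(_ isT).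
Qed.

Lemma gam_s_neq1 j : is_s j -> 1 - gam j != 0.
Proof.
move=> /params_s[[_ g1 _] _]; apply/eqP => /eqP; rewrite subr_eq0 => /eqP G.
move: g1; rewrite -G.
have /Creal_ImP -> : (1 : C) \is Num.real by apply: rpred1.
by rewrite ltxx.
Qed.

Lemma coeff_g_neq0 j : coeff_g j != 0.
Proof.
have sgp := params_sum; case: (kindP sg j) => h.
- rewrite coeff_g_N ?(is_e_notP sgp h) //; have [/andP[g1 _] _ _] := params_e h.
  by rewrite gt_eqF.
- rewrite coeff_g_N ?(is_h_notP sgp h) //; have [g1 _ _ _ _] := params_h h.
  by rewrite gt_eqF // (lt_trans _ g1) // invr_gt0 ltr0n.
- by rewrite coeff_g_N ?(is_s_notP sgp h) //; apply: gam_s_neq0.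
rewrite coeff_g_s' // -(rmorph1 Num.conj) -rmorphB conjC_eq0.
by apply: gam_s_neq1; rewrite is_s_partner.
Qed.

Lemma trace_s j : is_s j -> (gam j * (1 - gam j))^-1 - 2 = lam j ^+ 2 + lam j ^- 2.
Proof.
move=> h; have [[_ _ gE] _] := params_s h; have g0 := gam_s_neq0 h.
have l0 := lam_neq0 j; have d0 : 1 + lam j ^- 2 != 0.
  by move: g0; rewrite gE invr_eq0.
have d1 : lam j ^+ 2 + 1 != 0.
  apply: contra d0 => /eqP E; have -> : 1 + lam j ^- 2 = (lam j ^+ 2 + 1) / lam j ^+ 2.
    by field.
  by rewrite E mul0r.
rewrite gE; field; rewrite l0 d1 [X in X - _]addrC addrK; exact: oner_neq0.
Qed.

(** The left-hand side is the scalar by which sigma + sigma^-1 acts to first order on the plane of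
    index j, the right-hand side the sum of its two eigenvalues there; the parametrization of gamma
    by lambda is made for this. *)
Lemma trace_eq j : (coeff_g j * (coeff_g (partner j))^*)^-1 - 2 =
  lam j ^+ 2 + lam j ^- 2.
Proof.
have sgp := params_sum; have l0 := lam_neq0 j; case: (kindP sg j) => h.
- have [/andP[g1 _] l1 gE] := params_e h; rewrite (partner_e sgp h).
  rewrite coeff_g_N ?(is_e_notP sgp h) // (CrealP _) ?gtr0_real // gE.
  rewrite invfM !invrK; field; exact: l0.
- have [g1 l1 _ _ gE] := params_h h; rewrite (partner_h sgp h).
  rewrite coeff_g_N ?(is_h_notP sgp h) // (CrealP _).
    by rewrite gE (lam_h h) invfM !invrK; field; apply: l0.
  by rewrite gtr0_real // (lt_trans _ g1) // invr_gt0 ltr0n.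
- rewrite coeff_g_N ?(is_s_notP sgp h) // coeff_g_s' ?is_s'_partner // partnerK //.
  by rewrite rmorphB rmorph1 /= conjCK (trace_s h).
have hs : is_s (partner j) by rewrite is_s_partner.
rewrite coeff_g_s' // coeff_g_N ?(is_s_notP sgp hs) //.
have -> : lam j = ((lam (partner j))^*)^-1 by rewrite -(lam_s hs) partnerK.
have conjE (z : C) : ((1 - z^*) * z^*)^-1 - 2 = ((z * (1 - z))^-1 - 2)^*.
  by rewrite !(rmorphB, fmorphV, rmorphM, rmorph1, rmorph_nat) mulrC.
rewrite conjE (trace_s hs) !(rmorphD, fmorphV, rmorphXn) /=.
by rewrite exprVn invrK addrC.
Qed.

Lemma quadric_uform (E : formal_map R (p + p) p) : quadric_perturbation sg gam E ->
  forall k, eqd 3 (E k) (uform coeff_g partner k ^+ 2).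
Proof.
move=> [_ H] k m m3; rewrite H; last by rewrite -ltnS.
apply: (@agreeX _ _ 2); last by rewrite -ltnS.
move=> a _; rewrite mcoeffD mcoeffZ !mcoeffX /uform psaddE pszE !psX_coef.
by rewrite -/(coeff_g k) !(eq_sym a).
Qed.

End QuadricParameters.

(** * The deck group and its sign vectors *)

Section AdmissibleDeck.
Variables (R : realType) (p : nat).
Local Notation C := R[i].
Variables (g : 'I_p -> C) (pt : 'I_p -> 'I_p) (E : formal_map R (p + p) p).
Hypothesis ptK : involutive pt.
Hypothesis g0 : forall k, g k != 0.
Hypothesis E_quad : forall k, eqd 3 (E k) (uform g pt k ^+ 2).
Local Notation u := (uform g pt).

Lemma deck_formal F : deck E F -> formal_deck E F.
Proof. by case=> _ bF EF; split. Qed.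

(** By [deck_uniq] the sign vector determines the deck transformation; 2^p deck transformations thus
    inject into the 2^p sign vectors and exhaust them. *)
Lemma all_signs : max_deck E -> forall b : {ffun 'I_p -> bool},
  exists F, [/\ deck E F, formal_deck E F & has_signs g pt F b].
Proof.
move=> [_ /card_set_bijP[f [_ _ fsurj]]].
have H1 (i : 'I_(2 ^ p)) : exists Fb : formal_map R (p + p) (p + p) * {ffun 'I_p -> bool},
    [/\ deck E Fb.1, f Fb.1 = i & has_signs g pt Fb.1 Fb.2].
  have [F dF fF] := fsurj i (ltn_ord i).
  have [b Fb] := deck_signs E_quad (deck_formal dF).
  by exists (F, b).
have [h hP] := boolp.choice H1.
have h_inj : injective (fun i => (h i).2).
  move=> i j /= E2; have [di fi bi] := hP i; have [dj fj bj] := hP j.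
  apply/val_inj; rewrite /= -fi -fj; congr f.
  apply: (deck_uniq ptK g0 E_quad (deck_formal di) (deck_formal dj)) => k.
  by apply: (eqd_trans (bi k)); rewrite E2; apply/eqd_sym/bj.
move=> b; have /codomP[i ->] : b \in codom (fun i => (h i).2).
  apply: inj_card_onto h_inj _ b; rewrite card_ffun card_bool !card_ord.
  exact: leqnn.
by have [di _ bi] := hP i; exists (h i).1; split=> //; apply: deck_formal.
Qed.

Lemma full_deck : max_deck E -> forall b : {ffun 'I_p -> bool},
  exists2 F, formal_deck E F & has_signs g pt F b.
Proof. by move=> H b; have [F [_ dF Fb]] := all_signs H b; exists F. Qed.

Lemma psmul_coefU n (f h : series R n) i :
  (f * h) U_(i)%MM = f U_(i)%MM * h 0%MM + f 0%MM * h U_(i)%MM.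
Proof.
have fE : f * h = (f - (f 0%MM)%:A) * (h - (h 0%MM)%:A) +
    ((h 0%MM)%:A * f + (f 0%MM)%:A * h - (f 0%MM)%:A * (h 0%MM)%:A) by ring.
have scE c (k : series R n) : c%:A * k = c *: k by rewrite -scalerAl mul1r.
have o1 (k : series R n) : eqd 1 (k - (k 0%MM)%:A) 0.
  by apply/eqd1; rewrite psaddE psoppE pszE ps1E eqxx mulr1 subrr.
rewrite fE psaddE (eqd0M (o1 f) (o1 h)) ?mdeg1 // ps0E add0r !scE !psaddE psoppE !pszE ps1E.
by rewrite -mdeg_eq0 mdeg1 !mulr0 subr0 mulrC.
Qed.

(** If F negates u_k to first order, the linear part of F - I in the coordinate of index [pt k] is a
    nonzero multiple of u_k. It is also a multiple of the linear part of the equation v of the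
    hypersurface. Distinct u_k, u_l are independent already in their z'-coefficients. *)
Lemma hypersurface_sign F b k l : fixes_hypersurface F ->
  has_signs g pt F b -> formal_deck E F -> b k -> b l -> k = l.
Proof.
move=> [v [_ v0 _ vP]] Fb dF bk bl.
have H k' : b k' -> exists c, forall l',
    - (2 * u k' U_(lshift p l')%MM) = c * v U_(lshift p l')%MM.
  move=> bk'; have [w _ wE] := vP (rshift p (pt k')).
  exists (2 * g k' * w 0%MM) => l'.
  have := Fb k' U_(lshift p l')%MM; rewrite mdeg1 => /(_ isT).
  rewrite (deck_uform _ _ dF) bk' expr1 scaleN1r psaddE psoppE pszE => EF.
  have := congr1 (fun f : series R (p + p) => f U_(lshift p l')%MM) wE.
  rewrite psmulE psmul_coefU v0 mul0r addr0.
  have uE : u k' U_(lshift p l')%MM = psX R (lshift p k') U_(lshift p l')%MM +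
      2 * g k' * psX R (rshift p (pt k')) U_(lshift p l')%MM by [].
  rewrite -[LHS]/(F (rshift p (pt k')) U_(lshift p l')%MM -
    psX R (rshift p (pt k')) U_(lshift p l')%MM) => EW.
  rewrite -mulrA (mulrC (w _)) -EW mulrBr.
  have -> : 2 * g k' * F (rshift p (pt k')) U_(lshift p l')%MM =
      - u k' U_(lshift p l')%MM - psX R (lshift p k') U_(lshift p l')%MM.
    by rewrite -EF addrC addKr.
  rewrite -addrA -opprD -uE; move: (u _ _) => z; by ring.
have [c cP] := H k bk; have [d dP] := H l bl.
apply/eqP; apply: contraT => kl; have /esym/eqP := cP l.
rewrite uform_coefL (eq_sym l k) (negbTE kl) mulr0 oppr0 mulf_eq0 => /orP[]/eqP Z.
  have /eqP := cP k; rewrite Z mul0r uform_coefL eqxx mulr1 oppr_eq0.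
  by rewrite pnatr_eq0.
have /eqP := dP l; rewrite Z mulr0 uform_coefL eqxx mulr1 oppr_eq0.
by rewrite pnatr_eq0.
Qed.

(* The tau_j generate a group whose sign vectors exhaust {+-1}^p, so each reflection
   u_k |-> - u_k is the linear part of some tau_j. *)
Lemma generator_signs tau : max_deck E -> deck_generators E tau ->
  exists2 pi : 'I_p -> 'I_p, injective pi &
    forall j, formal_deck E (tau j) /\ has_signs g pt (tau j) (fun k => k == pi j).
Proof.
move=> mE [dtau _ htau gen].
have fd j := deck_formal (dtau j).
have [b bP] := boolp.choice (fun j => deck_signs E_quad (fd j)).
have u1 j k l := @hypersurface_sign (tau j) (b j) k l (htau j) (bP j) (fd j).
have ex k : exists j, b j k.
  (* If no generator changed the sign of u_k, no word in them would; but the deck transformation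
     with all signs -1 is such a word. *)
  apply: contrapT => nb; have [F [dF fF Fb]] := all_signs mE [ffun=> true].
  have [s sF] := gen F dF.
  suff H : eqd 2 (pscomp (u k) F) (u k) /\ pointed F.
    have := eqd_trans (eqd_sym H.1) (Fb k); rewrite ffunE expr1 scaleN1r.
    move/(_ U_(lshift p k)%MM); rewrite mdeg1 psoppE uform_coefL eqxx => /(_ isT)/eqP.
    by rewrite -subr_eq0 opprK -mulr2n pnatr_eq0.
  rewrite sF; elim: s {sF} => [|j s [IH I0]] /=.
    by split; [rewrite pscomp_mid|apply: pointed_mid].
  have t0 := deck_pointed (fd j); split; last exact: pointed_comp.
  rewrite -(pscompA _ t0 I0); apply: eqd_trans IH; apply: (eqd_compl I0).
  have := bP j k; case bjk: (b j k); first by case: nb; exists j.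
  by rewrite expr0 scale1r.
have [q qP] := boolp.choice ex.
have q_inj : injective q.
  by move=> k l E1; apply: (u1 (q k)); rewrite ?qP // E1 qP.
exists (invF q_inj); first exact: (can_inj (f_invF q_inj)).
move=> j; split; first exact: fd.
move=> k; have -> : (k == invF q_inj j) = b j k; last exact: bP.
apply/eqP/idP => [->|bjk]; first by rewrite -{1}(f_invF q_inj j) qP.
by apply: (u1 j) => //; rewrite -{1}(f_invF q_inj j) qP.
Qed.

End AdmissibleDeck.

(** * Linear parts of the reflections *)

Section LinearPart.
Variables (R : realType) (p : nat).
Local Notation C := R[i].
Variables (g : 'I_p -> C) (pt : 'I_p -> 'I_p).
Hypothesis ptK : involutive pt.
Hypothesis g0 : forall k, g k != 0.
Variable X : germ R (p + p).
Hypothesis XL : forall k, gmap X (lshift p k) = psX R (lshift p k).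
Hypothesis XR : forall k, eqd 2 (gmap X (rshift p k)) (uform g pt k).
Local Notation x k := (psX R (lshift p k)).
Local Notation y k := (psX R (rshift p (pt k))).
Local Notation u := (uform g pt).

Let g20 k : 2 * g k != 0. Proof. by rewrite mulf_neq0 ?g0 ?pnatr_eq0. Qed.

Lemma yE k : y k = (2 * g k)^-1 *: (u k - x k).
Proof. by rewrite /uform addrC addKr scalerA mulVf ?scale1r. Qed.

Section OneMap.
Variables (T : germ R (p + p)) (s : 'I_p -> C).
Hypothesis s0 : forall k, s k != 0.
Hypothesis XT : (X * T)%g = (gdmap (lrfun (fun=> 1%R) s) * X)%g.

Let T0 : pointed T := germ0 T.

Lemma XT_coef i : pscomp (gmap X i) T = lrfun (fun=> 1) s i *: gmap X i.
Proof.
have := congr1 (fun z => gmap z i) XT; rewrite !gmM mcompE gmdmap.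
  by rewrite (dmap_comp _ (germ0 X)).
by apply: ord_lr => j; rewrite ?lrfunL ?lrfunR ?oner_neq0.
Qed.

Lemma T_x k : gmap T (lshift p k) = x k.
Proof. by have := XT_coef (lshift p k); rewrite XL lrfunL scale1r (pscomp_psX _ T0). Qed.

Lemma T_u k : eqd 2 (pscomp (u k) T) (s k *: u k).
Proof.
apply: (eqd_trans (eqd_compl T0 (eqd_sym (XR k)))).
by rewrite XT_coef lrfunR; apply: eqdZ; apply: XR.
Qed.

Lemma T_y k : eqd 2 (gmap T (rshift p (pt k))) ((2 * g k)^-1 *: (s k *: u k - x k)).
Proof.
rewrite -(pscomp_psX _ T0) yE (pscompZ _ _ T0) (pscompB _ _ T0) (pscomp_psX _ T0) T_x.
by apply: eqdZ; apply: eqdB; [apply: T_u|apply: eqd_refl].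
Qed.

Lemma T_y_id k : s k = 1 -> eqd 2 (gmap T (rshift p (pt k))) (y k).
Proof. by move=> s1; rewrite yE; have := T_y k; rewrite s1 scale1r. Qed.

Lemma T_y_neg k : s k = -1 ->
  eqd 2 (gmap T (rshift p (pt k))) (- y k - (g k)^-1 *: x k).
Proof.
move=> s1; have := T_y k; rewrite s1 scaleN1r.
suff -> : (2 * g k)^-1 *: (- u k - x k) = - y k - (g k)^-1 *: x k by [].
have -> : - u k - x k = - ((2 * g k) *: y k) - (2 : C) *: x k.
  rewrite /uform scaler_nat; move: (_ *: _) (x k) => a b; by ring.
rewrite scalerBr scalerN !scalerA mulVf ?g20 // scale1r.
have -> // : (2 * g k)^-1 * 2 = (g k)^-1.
by rewrite invfM mulrAC mulVf ?mul1r // pnatr_eq0.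
Qed.

End OneMap.

Variable t1 : germ R (p + p).
Hypothesis Xt1 : (X * t1)%g = (@Zall R p * X)%g.

Let m1 : forall k : 'I_p, (-1 : C) != 0. Proof. by move=> _; rewrite oppr_eq0 oner_neq0. Qed.
Let t1_x := T_x m1 Xt1.
Let t1_y k : eqd 2 (gmap t1 (rshift p (pt k))) (- y k - (g k)^-1 *: x k).
Proof. exact: (T_y_neg m1 Xt1 (k := k) erefl). Qed.

Variable t2 : germ R (p + p).
Hypothesis t2E : t2 = anticonj (@swK p) t1.

Let Psw := @pointed_sw R p.

Lemma t2_y k : gmap t2 (rshift p (pt k)) = y k.
Proof.
by rewrite t2E anticonj_coef swR t1_x psconj_psX (pscomp_psX _ Psw) /pmap swL.
Qed.

Definition g' k := (g (pt k))^*.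

Lemma psconj_eqd n d (f h : series R n) : eqd d f h -> eqd d (psconj f) (psconj h).
Proof. by move=> fh m md; rewrite !psconjE fh. Qed.

Lemma t2_x k : eqd 2 (gmap t2 (lshift p k)) (- x k - (g' k)^-1 *: y k).
Proof.
rewrite t2E anticonj_coef swL; have := t1_y (pt k); rewrite ptK => H.
apply: (eqd_trans (eqd_compl Psw (psconj_eqd H))).
rewrite psconjD !psconjN psconjZ !psconj_psX fmorphV.
rewrite (pscompB _ _ Psw) (pscompN _ Psw) (pscompZ _ _ Psw) !(pscomp_psX _ Psw).
by rewrite /pmap swL swR; apply: eqd_refl.
Qed.

(** To first order t1 and t2 preserve the plane of x_k and y_k: t1 fixes x and sends y to -y - x/g,
    t2 fixes y and sends x to -x - y/g'. There t1 t2 + t2 t1 is this scalar. *)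
Definition block_trace k := (g k * g' k)^-1 - 2.

Let t10 := germ0 t1.
Let t20 := germ0 t2.

Let g'0 k : g' k != 0. Proof. by rewrite conjC_eq0. Qed.

Let scale_step n (a b : C) (f h : series R n) :
  - f - a *: h + (- f - a *: (- h - b *: f)) = (a * b) *: f - f *+ 2.
Proof.
by rewrite scalerBr scalerN scalerA; move: (a *: h) ((a * b) *: f) => h' f'; ring.
Qed.

Lemma sigma_x k : eqd 2 (gmap (t1 * t2)%g (lshift p k) + gmap (t2 * t1)%g (lshift p k))
  (block_trace k *: x k).
Proof.
rewrite (gmM t1 t2) (gmM t2 t1) !mcompE t1_x (pscomp_psX _ t20).
have H : eqd 2 (pscomp (gmap t2 (lshift p k)) t1)
    (- x k - (g' k)^-1 *: (- y k - (g k)^-1 *: x k)).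
  apply: (eqd_trans (eqd_compl t10 (t2_x k))).
  rewrite (pscompB _ _ t10) (pscompN _ t10) (pscompZ _ _ t10) !(pscomp_psX _ t10) t1_x.
  by apply: eqdB; [apply: eqd_refl|apply: eqdZ; apply: t1_y].
apply: (eqd_trans (eqdD (t2_x k) H)).
by rewrite scale_step /block_trace scalerBl scaler_nat invfM (mulrC (g k)^-1); apply: eqd_refl.
Qed.

Lemma sigma_y k : eqd 2
  (gmap (t1 * t2)%g (rshift p (pt k)) + gmap (t2 * t1)%g (rshift p (pt k)))
  (block_trace k *: y k).
Proof.
rewrite (gmM t1 t2) (gmM t2 t1) !mcompE t2_y (pscomp_psX _ t10).
have H : eqd 2 (pscomp (gmap t1 (rshift p (pt k))) t2)
    (- y k - (g k)^-1 *: (- x k - (g' k)^-1 *: y k)).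
  apply: (eqd_trans (eqd_compl t20 (t1_y k))).
  rewrite (pscompB _ _ t20) (pscompN _ t20) (pscompZ _ _ t20) !(pscomp_psX _ t20) t2_y.
  by apply: eqdB; [apply: eqd_refl|apply: eqdZ; apply: t2_x].
apply: (eqd_trans (eqdD H (t1_y k))).
by rewrite addrC scale_step /block_trace scalerBl scaler_nat invfM; apply: eqd_refl.
Qed.

Definition blk : 'I_(p + p) -> 'I_p := lrfun id id.
(** [blk] pairs xi_j with eta_j, whereas [blkE] pairs z'_k with the w'-coordinate of index [pt k],
    the one that occurs in u_k. *)
Definition blkE : 'I_(p + p) -> 'I_p := lrfun id pt.

Lemma sigma_form c : eqd 2 (gmap (t1 * t2)%g c + gmap (t2 * t1)%g c)
  (block_trace (blkE c) *: psX R c).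
Proof.
move: c; apply: ord_lr => l; rewrite /blkE ?lrfunL ?lrfunR; first exact: sigma_x.
by have := sigma_y (pt l); rewrite ptK.
Qed.

Section Normalized.
Variables (lam : 'I_p -> C) (M L : formal_map R p p).
Hypothesis ind : independent (fun j => lam j ^+ 2).
Hypothesis lam0 : forall j, lam j != 0.
Hypothesis M0 : forall j, M j 0%MM = lam j ^+ 2.
Hypothesis L0 : nz L.
Hypothesis traceE : forall k, block_trace k = lam k ^+ 2 + lam k ^- 2.
Variable G : germ R (p + p).
Hypothesis Gsigma : (G * (t1 * t2))%g = (torus M * G)%g.
Hypothesis Gt1 : (G * t1)%g = (tau1_hat L * G)%g.
Hypothesis t1K : (t1 * t1)%g = 1%g.

Let G0 := germ0 G.
Let nzM : nz M. Proof. by move=> j; rewrite M0 expf_neq0. Qed.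

Lemma tw_inj (i i' : 'I_(p + p)) : @tw p i = tw i' -> i = i'.
Proof.
have N (j k : 'I_p) : (delta_mx 0 j : 'rV[int]_p) <> - delta_mx 0 k.
  move=> /rowP/(_ j); rewrite !mxE !eqxx /=; case: eqP => _; lia.
have I (j k : 'I_p) : (delta_mx 0 j : 'rV[int]_p) = delta_mx 0 k -> j = k.
  by move=> /rowP/(_ j); rewrite !mxE !eqxx /=; case: eqP.
move: i i'; apply: ord_lr => j; apply: ord_lr => k; rewrite /tw ?lrfunL ?lrfunR.
- by move/I ->.
- by move/N.
- by move/esym/N.
- by move/oppr_inj/I ->.
Qed.

Lemma torus_eigen_inj : injective (torus_eigen (fun j => lam j ^+ 2)).
Proof.
move=> i i' E; apply: tw_inj; rewrite -(wtU _ i); apply: (torus_nonresonance ind).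
rewrite -E (bigD1 i isT) /= mnm1E eqxx expr1 big1 ?mulr1 // => j ji.
by rewrite mnm1E eq_sym (negbTE ji) expr0.
Qed.

(** mu + 1/mu determines mu up to inversion, and independence excludes both mu_k = mu_l and mu_k =
    1/mu_l for distinct k and l. *)
Lemma trace_inj k l : block_trace k = block_trace l -> k = l.
Proof.
rewrite !traceE => E; have a0 : lam k ^+ 2 != 0 by rewrite expf_neq0.
have b0 : lam l ^+ 2 != 0 by rewrite expf_neq0.
have [e1 [_ [e3 _]]] := @lrE p.
have: (lam k ^+ 2 - lam l ^+ 2) * (lam k ^+ 2 - (lam l ^+ 2)^-1) = 0.
  move: a0 b0 E; move: (lam k ^+ 2) (lam l ^+ 2) => a b a0 b0 E.
  have -> : (a - b) * (a - b^-1) = a * (a + a^-1 - (b + b^-1)).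
    by field; rewrite ?a0 ?b0.
  by rewrite E subrr mulr0.
move/eqP; rewrite mulf_eq0 !subr_eq0 => /orP[]/eqP E2.
  have := @torus_eigen_inj (lshift p k) (lshift p l).
  by rewrite /torus_eigen !lrfunL => /(_ E2)/eqP; rewrite e1 => /eqP.
have := @torus_eigen_inj (lshift p k) (rshift p l).
by rewrite /torus_eigen lrfunL lrfunR => /(_ E2)/eqP; rewrite e3.
Qed.

Lemma lin_mod2 n (f : series R n) : f 0%MM = 0 -> eqd 2 f (linpart f).
Proof.
move=> f0; rewrite {1}[f]hipart_split f0 scale0r add0r -[X in eqd _ _ X]addr0.
by apply: eqdD; [apply: eqd_refl|apply: hipart_ord].
Qed.

Lemma lin_comp n k (f : series R n) (F : formal_map R k n) : pointed F ->
  f 0%MM = 0 -> eqd 2 (pscomp f F) (\sum_c f U_(c)%MM *: F c).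
Proof.
move=> F0 f0; apply: (eqd_trans (eqd_compl F0 (lin_mod2 f0))).
rewrite /linpart (pscomp_sum _ _ _ F0); apply: eqd_sum => c.
by rewrite (pscompZ _ _ F0) (pscomp_psX _ F0); apply: eqd_refl.
Qed.

Lemma torus_lin a i : nz a -> eqd 2 (pscomp (gmap (torus a) i) G)
  (lrfun (fun j => a j 0%MM) (fun j => (a j 0%MM)^-1) i *: gmap G i).
Proof.
move=> a0; rewrite (gmtorus a0).
apply: (eqd_trans (eqd_compl G0 (@emap_lin _ _ a (vinv a) i))).
rewrite /dmap (pscompZ _ _ G0) (pscomp_psX _ G0).
have -> : lrfun (fun j => a j 0%MM) (fun j => vinv a j 0%MM) i =
    lrfun (fun j => a j 0%MM) (fun j => (a j 0%MM)^-1) i.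
  by move: i; apply: ord_lr => j; rewrite ?lrfunL // !lrfunR /vinv psinv0.
exact: eqd_refl.
Qed.

(** G intertwines sigma with [torus M], and likewise their inverses. In the sum of the two
    relations, the entry (i, c) of the linear part of G is multiplied on one side by the scalar of
    the block of c, on the other by that of i; by [trace_inj] a nonzero entry forces equal
    blocks. *)
Lemma G_block i c : gmap G i U_(c)%MM != 0 -> blkE c = blk i.
Proof.
have Gs' : (G * (t2 * t1))%g = (torus (vinv M) * G)%g.
  have t2K : (t2 * t2)%g = 1%g by rewrite t2E -anticonjM t1K anticonj1.
  rewrite -(torusV nzM); apply: (mulgI (torus M)); rewrite mulgA mulKVg.
  rewrite -Gsigma -!mulgA (mulgA t2 t2) t2K mul1g t1K mulg1.
  by [].
have E1 : pscomp (gmap G i) (t1 * t2)%g = pscomp (gmap (torus M) i) G.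
  by have := congr1 (fun z => gmap z i) Gsigma; rewrite (gmM G) (gmM (torus M)) !mcompE.
have E2 : pscomp (gmap G i) (t2 * t1)%g = pscomp (gmap (torus (vinv M)) i) G.
  by have := congr1 (fun z => gmap z i) Gs'; rewrite (gmM G) (gmM (torus _)) !mcompE.
have H : eqd 2 (\sum_c gmap G i U_(c)%MM *: (block_trace (blkE c) *: psX R c))
    (block_trace (blk i) *: linpart (gmap G i)).
  have Gi := G0 i.
  have A := lin_comp (germ0 (t1 * t2)%g) Gi; have B := lin_comp (germ0 (t2 * t1)%g) Gi.
  have AB := eqdD A B; rewrite -big_split /= E1 E2 in AB.
  have S : eqd 2 (\sum_c gmap G i U_(c)%MM *: (block_trace (blkE c) *: psX R c))
    (\sum_c (gmap G i U_(c)%MM *: gmap (t1 * t2)%g c + gmap G i U_(c)%MM *: gmap (t2 * t1)%g c)).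
    apply: eqd_sum => c'; rewrite -scalerDr; apply: eqdZ; apply: eqd_sym.
    exact: sigma_form.
  apply: (eqd_trans S); apply: (eqd_trans (eqd_sym AB)).
  apply: (eqd_trans (eqdD (torus_lin i nzM) (torus_lin i (nz_vinv nzM)))).
  rewrite -scalerDl; have -> : lrfun (fun j => M j 0%MM) (fun j => (M j 0%MM)^-1) i +
     lrfun (fun j => vinv M j 0%MM) (fun j => (vinv M j 0%MM)^-1) i = block_trace (blk i).
    move: i {Gi A B AB S E1 E2}; apply: ord_lr => j; rewrite /blk ?lrfunL ?lrfunR traceE.
      by rewrite /vinv (psinv0 (nzM j)) M0.
    by rewrite /vinv (psinv0 (nzM j)) M0 invrK addrC.
  exact/eqdZ/lin_mod2.
have := H U_(c)%MM; rewrite mdeg1 => /(_ isT).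
rewrite pszE linpart_coef mdeg1 eqxx pssumE (bigD1 c isT) /= big1 => [|d dc].
  rewrite !pszE psX_coef eqxx mulr1 addr0 => E G1; apply: trace_inj.
  by apply: (mulIf G1); rewrite -E mulrC.
by rewrite !pszE psX_coef mnmU_eq eq_sym (negbTE dc) !mulr0.
Qed.

Lemma tau1_hat_flip : gmap (tau1_hat L) = flip L (fun=> true).
Proof.
rewrite /tau1_hat -lock gmM gmswap (gmtorus L0); apply: map_lr => j; rewrite mcompE.
  rewrite emapL flipL (pscompM _ _ Psw) (pscomp_psX _ Psw) /pmap swL.
  by rewrite /zcomp (pscompA _ (@pointed_xi_eta R p) Psw) xi_eta_sw.
rewrite emapR flipR (pscompM _ _ Psw) (pscomp_psX _ Psw) /pmap swR.
by rewrite /zcomp (pscompA _ (@pointed_xi_eta R p) Psw) xi_eta_sw.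
Qed.

Lemma flip_block k i : flip L (fun j => j == k) i =
  if blk i == k then gmap (tau1_hat L) i else psX R i.
Proof.
by rewrite tau1_hat_flip; move: i; apply: ord_lr => j; rewrite /blk ?lrfunL ?lrfunR
  ?flipL ?flipR.
Qed.

(** To first order G respects the planes. On the plane k, T agrees with t1 and the standard
    reflection with [tau1_hat], and G intertwines these; on the other planes both reflections are
    the identity. *)
Lemma reflection_lin k (T : germ R (p + p)) : (X * T)%g = (@gZ R p k * X)%g ->
  eqdm 2 (mcomp G T) (mcomp (tau_hat L k) G).
Proof.
move=> XT i; have T0 := germ0 T; rewrite !mcompE.
have s0 (l : 'I_p) : ((-1) ^+ (l == k) : C) != 0 by rewrite signr_eq0.
have Tx := T_x s0 XT.
have Ty := T_y_id s0 XT; have Ty' := T_y_neg s0 XT.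
have fix_other c : blkE c != k -> eqd 2 (gmap T c) (psX R c).
  move: c; apply: ord_lr => l; rewrite /blkE ?lrfunL ?lrfunR => lk.
    by rewrite Tx; apply: eqd_refl.
  by have := Ty (pt l); rewrite ptK; apply; rewrite (negbTE lk) expr0.
have same c : blkE c = k -> eqd 2 (gmap T c) (gmap t1 c).
  move: c; apply: ord_lr => l; rewrite /blkE ?lrfunL ?lrfunR => lk.
    by rewrite Tx t1_x; apply: eqd_refl.
  have := Ty' (pt l); rewrite lk eqxx expr1 => /(_ erefl) H1.
  have := t1_y k; rewrite -lk !ptK in H1 * => H2.
  exact: eqd_trans H1 (eqd_sym H2).
have Gi := G0 i; apply: (eqd_trans (lin_comp T0 Gi)); rewrite tau_hat_flip flip_block.
case: (eqVneq (blk i) k) => [ik|ik].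
  have := congr1 (fun z => gmap z i) Gt1; rewrite !gmM !mcompE => <-.
  apply: eqd_sym; apply: (eqd_trans (lin_comp t10 Gi)); apply: eqd_sum => c.
  case: (eqVneq (gmap G i U_(c)%MM) 0) => [->|Gc]; first by rewrite !scale0r; apply: eqd_refl.
  by apply/eqdZ/eqd_sym/same; rewrite (G_block Gc).
rewrite (pscomp_psX _ G0).
apply: eqd_sym; apply: (eqd_trans (lin_mod2 Gi)); apply: eqd_sum => c.
case: (eqVneq (gmap G i U_(c)%MM) 0) => [->|Gc]; first by rewrite !scale0r; apply: eqd_refl.
by apply/eqdZ/eqd_sym/fix_other; rewrite (G_block Gc).
Qed.

End Normalized.
End LinearPart.

(** * Existence of the normal form *)

Section MapCongruence.
Variable R : realType.

Lemma eqdm_compl d j k n (F F' : formal_map R k n) (G : formal_map R j k) :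
  pointed G -> eqdm d F F' -> eqdm d (mcomp F G) (mcomp F' G).
Proof. by move=> G0 FF i; rewrite !mcompE; apply: eqd_compl. Qed.

Lemma eqdm_compr d j k n (F : formal_map R k n) (G G' : formal_map R j k) :
  pointed G -> pointed G' -> eqdm d G G' -> eqdm d (mcomp F G) (mcomp F G').
Proof. by move=> G0 G0' GG i; rewrite !mcompE; apply: eqd_compr. Qed.

Lemma eqdm_trans d k n (F G H : formal_map R k n) :
  eqdm d F G -> eqdm d G H -> eqdm d F H.
Proof. by move=> FG GH i; apply: eqd_trans (FG i) (GH i). Qed.

Lemma eqdm_sym d k n (F G : formal_map R k n) : eqdm d F G -> eqdm d G F.
Proof. by move=> FG i; apply/eqd_sym/FG. Qed.

Lemma eqdm_jacobian n (F G : formal_map R n n) : eqdm 2 F G -> jacobian0 F = jacobian0 G.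
Proof. by move=> FG; apply/matrixP => i j; rewrite !mxE (FG i) ?mdeg1. Qed.

Lemma eqdm_biholo n (F G : formal_map R n n) : eqdm 2 F G -> biholo F -> biholo G.
Proof.
move=> FG [F0 uF]; split; last by rewrite -(eqdm_jacobian FG).
by move=> i; rewrite -(FG i) ?F0 ?mdeg0.
Qed.

End MapCongruence.

Lemma mulg_conj_commute (gT : groupType) (x y t : gT) :
  (y * t = t * y)%g -> (x * t ^ (y^-1 * x) = t * x)%g.
Proof.
by move=> ty; rewrite conjgE invMg invgK !mulgA mulgV mul1g ty mulgK.
Qed.

Section Admissible.
Variables (R : realType) (p : nat) (D : submanifold R p).
Local Notation C := R[i].
Hypothesis hD : admissible D.
Local Notation sg := (sub_sig D).
Local Notation lam := (sub_lam D).
Local Notation E := (sub_E D).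
Local Notation tau := (sub_tau D).
Local Notation M := (sub_Mhat D).
Local Notation L := (sub_Lhat D).
Local Notation g := (coeff_g sg (sub_gam D)).
Local Notation pt := (@partner p sg).

Lemma adm_params : quadric_params sg (sub_gam D) lam. Proof. by case: hD => [[]]. Qed.
Lemma adm_nonres : non_resonant lam. Proof. by case: hD => [[]]. Qed.
Lemma adm_quadric : quadric_perturbation sg (sub_gam D) E. Proof. by case: hD => [[]]. Qed.
Lemma adm_max : max_deck E. Proof. by case: hD => [[]]. Qed.
Lemma adm_gen : deck_generators E tau. Proof. by case: hD => [[]]. Qed.
Lemma adm_theta : exists Theta, normalizes_sigma D Theta. Proof. by case: hD => _ []. Qed.
Lemma adm_log : normalized_log sg M. Proof. by case: hD => _ []. Qed.
Lemma adm_sq j : M j = L j * L j. Proof. by case: hD => _ [_ _ /(_ j)[]]. Qed.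
Lemma adm_L0 j : L j 0%MM = lam j. Proof. by case: hD => _ [_ _ /(_ j)[]]. Qed.

Lemma adm_sum : (ne sg + nh sg + (ns sg).*2)%N = p.
Proof. exact: params_sum adm_params. Qed.

Lemma adm_nzL : nz L. Proof. exact: (nzL (lam_neq0 adm_params) adm_L0). Qed.
Lemma adm_M0 j : M j 0%MM = lam j ^+ 2. Proof. exact: (M0E adm_sq adm_L0). Qed.
Lemma adm_nzM : nz M. Proof. by move=> j; rewrite adm_M0 expf_neq0 // (lam_neq0 adm_params). Qed.
Lemma adm_ind : independent (fun j => lam j ^+ 2).
Proof. exact: lam_independent adm_params adm_nonres. Qed.

Lemma adm_ptK : involutive pt. Proof. exact: partnerK adm_sum. Qed.
Lemma adm_g0 k : g k != 0. Proof. exact: coeff_g_neq0 adm_params k. Qed.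
Lemma adm_E k : eqd 3 (E k) (uform g pt k ^+ 2). Proof. exact: quadric_uform adm_quadric k. Qed.

Lemma adm_deck j : biholo (tau j). Proof. by case: adm_gen => /(_ j)[]. Qed.

Definition tauG j : germ R (p + p) := Germ (adm_deck j).
Lemma gmtau j : gmap (tauG j) = tau j. Proof. by []. Qed.

(** The generators t are quantified after X, so that one X serves all systems of generators attached
    to the same E. *)
Lemma straighten_deck : exists X : germ R (p + p),
  [/\ forall k, gmap X (lshift p k) = psX R (lshift p k),
      forall k, eqd 2 (gmap X (rshift p k)) (uform g pt k)
    & forall (t : 'I_p -> germ R (p + p)), deck_generators E (fun j => gmap (t j)) ->
        exists2 pi : 'I_p -> 'I_p, injective pi &
          forall j, (X * t j)%g = (gZ R (pi j) * X)%g].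
Proof.
have [X [bX XL XR XT]] :=
  linearization adm_ptK adm_g0 adm_E (full_deck adm_ptK adm_g0 adm_E adm_max).
exists (Germ bX); split=> // t gt.
have [pi pi_inj piP] := generator_signs adm_ptK adm_g0 adm_E adm_max gt.
exists pi => // j; have [fd sd] := piP j.
by apply: germ_inj; rewrite !gmM gmZ; apply: XT.
Qed.

Lemma adm_gen_germ : deck_generators E (fun j => gmap (tauG j)).
Proof. exact: adm_gen. Qed.

Definition tau1 : germ R (p + p) := (\prod_(j < p) tauG j)%g.
Definition sigmaG : germ R (p + p) := locked (tau1 * anticonj (@swK p) tau1)%g.

Lemma gmtau1 : gmap tau1 = compose_all tau.
Proof. by rewrite /tau1 -compose_all_germ. Qed.

Lemma gmsigma : gmap sigmaG = sigma tau.
Proof. by rewrite /sigmaG -lock /anticonj !gmM gmconj gmpmap gmtau1 /sigma rho0E. Qed.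

Lemma prod_straightened (X : germ R (p + p)) (t : 'I_p -> germ R (p + p)) pi :
  injective pi -> (forall j, (X * t j)%g = (gZ R (pi j) * X)%g) ->
  (X * \prod_(j < p) t j)%g = (Zall R p * X)%g.
Proof.
move=> pi_inj XT; rewrite -(prod_gZ R pi_inj).
have -> : (\prod_(j < p) t j)%g = (\prod_(j < p) (gZ R (pi j)) ^ X)%g.
  by apply: eq_bigr => j _; rewrite conjgE -XT mulKg.
by rewrite -conjg_prod conjgE mulVKg.
Qed.

Lemma ZallK : (Zall R p * Zall R p)%g = 1%g.
Proof.
apply: germ_inj; rewrite gmM gm1 gmdmap ?dmap_dmap -?dmap1.
  congr dmap; apply/funext; apply: ord_lr => j; rewrite ?lrfunL ?lrfunR ?mulr1 //.
  by rewrite mulrNN mulr1.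
by apply: ord_lr => j; rewrite ?lrfunL ?lrfunR ?oppr_eq0 oner_neq0.
Qed.

Lemma tau1_Zall (X : germ R (p + p)) pi : injective pi ->
  (forall j, (X * tauG j)%g = (gZ R (pi j) * X)%g) -> (X * tau1)%g = (Zall R p * X)%g.
Proof. exact: prod_straightened. Qed.

Lemma tau1K : (tau1 * tau1)%g = 1%g.
Proof.
have [X [_ _ /(_ _ adm_gen_germ)[pi pi_inj XT]]] := straighten_deck.
have E1 := tau1_Zall pi_inj XT; apply: (mulgI X).
by rewrite mulgA E1 -mulgA E1 mulgA ZallK mul1g mulg1.
Qed.

Local Notation rhK := (rhK adm_sum).
Local Notation alpha := (@anticonj R (p + p) (@rh p sg) rhK).
Local Notation tau1h := (@tau1_hat R p L).

Lemma gmtorusM : gmap (torus M) = sigma_hat M.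
Proof. exact: gmtorus adm_nzM. Qed.

Section Theta.
Variable Th : germ R (p + p).
Hypothesis Th_anti : conj_anti Th (@rho0 R p) (rho R sg).
Hypothesis Th_sigma : (Th * sigmaG)%g = (torus M * Th)%g.

Let t1 := (Th * tau1 * Th^-1)%g.

Lemma Th_anti' : conj_anti Th (pmap R (@sw p)) (pmap R (@rh p sg)).
Proof. by rewrite -rho0E -rhoE. Qed.

Lemma Th_t1K : (t1 * t1)%g = 1%g.
Proof. by rewrite /t1 -!mulgA mulKg (mulgA tau1) tau1K mul1g mulgV. Qed.

Lemma Th_t1_sigma : torus M = (t1 * alpha t1)%g.
Proof.
have E1 : (Th * tau1)%g = (t1 * Th)%g by rewrite /t1 mulgVK.
have E2 := anticonj_transport (@swK p) rhK Th_anti' E1.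
apply: (mulIg Th); rewrite -Th_sigma /sigmaG -lock mulgA E1 -mulgA E2 mulgA.
by [].
Qed.

End Theta.

Lemma theta_germ Theta : normalizes_sigma D Theta -> exists2 Th : germ R (p + p),
  gmap Th = Theta & conj_anti Th (@rho0 R p) (rho R sg) /\ (Th * sigmaG)%g = (torus M * Th)%g.
Proof.
move=> [bT aT sT]; exists (Germ bT); first by [].
split; first exact: aT.
apply: germ_inj; rewrite (gmM (Germ bT)) (gmM (torus M)) gmsigma gmtorusM; exact: sT.
Qed.

(** The reality of L for rho, needed here, comes from the existence of some normalizing Theta,
    although the relation does not involve it. *)
Lemma adm_tau1_hat_sigma : torus M = (tau1h * alpha tau1h)%g.
Proof.
have [Theta hT] := adm_theta; have [Th _ [aT sT]] := theta_germ hT.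
exact: (tau1_hat_sigma (lam_neq0 adm_params) (lam_e adm_params) (lam_h adm_params)
  (lam_s adm_params) adm_sq adm_L0 (Th_t1K Th) (Th_t1_sigma aT sT)).
Qed.

Lemma core_sigma (G : germ R (p + p)) : conj_anti G (@rho0 R p) (rho R sg) ->
  (G * tau1)%g = (tau1h * G)%g -> (G * sigmaG)%g = (torus M * G)%g.
Proof.
move=> /Th_anti' aG E1; have E2 := anticonj_transport (@swK p) rhK aG E1.
by rewrite /sigmaG -lock mulgA E1 -mulgA E2 mulgA -adm_tau1_hat_sigma.
Qed.

Definition strG : germ R (p + p) := Germ (biholo_straighten adm_nzL).

(** Taken as a conjugate of Z_k, so that relations between the Z_k carry over; [gmtauh] identifies
    it with [tau_hat]. *)
Definition tauhG k : germ R (p + p) := locked (gZ R k ^ strG)%g.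

Lemma strG_tauh k : (strG * tauhG k)%g = (gZ R k * strG)%g.
Proof. by rewrite /tauhG -lock conjgE mulVKg. Qed.

Lemma gmtauh k : gmap (tauhG k) = tau_hat L k.
Proof.
apply: (mcomp_inj (germP strG)); [exact: germ0|rewrite tau_hat_flip; exact: pointed_flip|].
rewrite -gmM strG_tauh gmM gmZ tau_hat_flip (straighten_flip adm_nzL).
by [].
Qed.

Lemma strG_tau1h : (strG * tau1h)%g = (Zall R p * strG)%g.
Proof.
apply: germ_inj; rewrite (gmM strG) (gmM (Zall R p)) (tau1_hat_flip adm_nzL) (straighten_flip adm_nzL).
rewrite gmdmap //.
by apply: ord_lr => j; rewrite ?lrfunL ?lrfunR ?oppr_eq0 oner_neq0.
Qed.

Lemma prod_tauh pi : injective pi -> (\prod_(j < p) tauhG (pi j))%g = tau1h.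
Proof.
move=> pi_inj; apply: (mulgI strG); rewrite strG_tau1h.
apply: (prod_straightened pi_inj) => j; exact: strG_tauh.
Qed.

Lemma gmtau1h : gmap tau1h = compose_all (tau_hat L).
Proof.
have -> : tau_hat L = fun k => gmap (tauhG k) by apply/funext => k; rewrite gmtauh.
by rewrite compose_all_germ (prod_tauh (@inj_id _)).
Qed.

Lemma gm_conj_tau_hat (Ph : germ R (p + p)) k :
  conj_tau_hat L Ph k = gmap (Ph * tauhG k * Ph^-1)%g.
Proof. by rewrite /conj_tau_hat -mulgA (gmM Ph) (gmM (tauhG k)) gmV gmtauh. Qed.

Definition conj_family_germ (G Ph : germ R (p + p)) (kf : 'I_p -> 'I_p) :=
  forall j, (G * tauG j)%g = (Ph * tauhG (kf j) * Ph^-1 * G)%g.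

Lemma tauG_inj : injective tauG.
Proof.
have [X [_ _ /(_ _ adm_gen_germ)[pi pi_inj XT]]] := straighten_deck.
move=> j k jk; apply: pi_inj; apply: (@gZ_inj R p); apply: (mulIg X).
by rewrite -!XT jk.
Qed.

Lemma Cc_tau_hatP (Ph : formal_map R (p + p) (p + p)) : Cc_tau_hat L Ph <->
  exists psi : germ R (p + p), [/\ tangent_to_id psi, zproj psi = mid
    & Ph = gmap (psi ^ strG)%g].
Proof.
split=> [[psi /Cc_ZP[tpsi zpsi] PhE]|[psi [tpsi zpsi PhE]]].
  by exists (Germ (tangent_biholo tpsi)); split=> //; rewrite PhE conjgE !gmM gmV.
exists (gmap psi); first exact/Cc_ZP.
by rewrite PhE conjgE !gmM gmV.
Qed.

Lemma family_germ (G Ph : germ R (p + p)) :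
  conj_family G tau (@rho0 R p) (conj_tau_hat L Ph) (rho R sg) ->
  conj_anti G (@rho0 R p) (rho R sg) /\
  exists2 kf : 'I_p -> 'I_p, injective kf & conj_family_germ G Ph kf.
Proof.
move=> [_ aG H _]; split; first exact: aG.
have [kf kfP] := boolp.choice H.
have cf : conj_family_germ G Ph kf.
  move=> j; apply: germ_inj; rewrite (gmM G) (gmM _ G) -gm_conj_tau_hat; exact: kfP.
exists kf; last exact: cf.
move=> j j' jj; apply: tauG_inj; apply: (mulgI G).
by rewrite !cf jj.
Qed.

(** The product of the reflections does not depend on their numbering, so kf disappears; Phi then
    drops out by commutation with [tau1_hat]. *)
Lemma family_tau1 (G Ph : germ R (p + p)) kf : injective kf -> conj_family_germ G Ph kf ->
  (Ph * tau1h)%g = (tau1h * Ph)%g -> (G * tau1)%g = (tau1h * G)%g.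
Proof.
move=> kf_inj cf PhE.
have tE j : tauG j = (tauhG (kf j) ^ (Ph^-1 * G))%g.
  apply: (mulgI G); rewrite cf conjgE invMg invgK !mulgA mulgV mul1g.
  by [].
have -> : tau1 = (tau1h ^ (Ph^-1 * G))%g.
  rewrite -(prod_tauh kf_inj) conjg_prod; apply: eq_bigr => j _; exact: tE.
exact: mulg_conj_commute.
Qed.

Section Existence.
Variable G : germ R (p + p).
Hypothesis G_anti : conj_anti G (@rho0 R p) (rho R sg).
Hypothesis G_tau1 : (G * tau1)%g = (tau1h * G)%g.

Lemma existence : exists Ph, normal_form D Ph.
Proof.
have [X [XL XR /(_ _ adm_gen_germ)[pi pi_inj XT]]] := straighten_deck.
have Xt1 := tau1_Zall pi_inj XT.
have Gsig := core_sigma G_anti G_tau1; rewrite /sigmaG -lock in Gsig.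
have lin k T : (X * T)%g = (gZ R k * X)%g -> eqdm 2 (mcomp G T) (mcomp (tau_hat L k) G).
  apply: (reflection_lin adm_ptK adm_g0 XL XR Xt1 (erefl _) adm_ind (lam_neq0 adm_params)
    adm_M0 adm_nzL (trace_eq adm_params) Gsig G_tau1 tau1K).
pose psi0 := (strG * G * X^-1)%g.
have psi0_conj j : (psi0 * gZ R (pi j))%g = (strG * (G * tauG j * X^-1))%g.
  rewrite /psi0 -!mulgA; congr (_ * (_ * _))%g; apply: (mulgI X).
  by rewrite mulVKg mulgA XT mulgK.
(* To first order psi0 commutes with the Z_k, so its part of the right parity has the same linear
   part and is invertible. *)
have psi0_lin k : eqdm 2 (mcomp psi0 (Zmap R k)) (mcomp (Zmap R k) psi0).
  have [j <-] : exists j, pi j = k by exists (invF pi_inj k); rewrite f_invF.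
  rewrite -gmZ -!gmM psi0_conj.
  have -> : (gZ R (pi j) * psi0)%g = (strG * (tauhG (pi j) * G * X^-1))%g.
    by rewrite /psi0 !mulgA strG_tauh.
  rewrite (gmM strG) (gmM strG); apply: eqdm_compr; [exact: germ0|exact: germ0|].
  rewrite (gmM (G * _)%g) (gmM (_ * G)%g); apply: eqdm_compl; first exact: germ0.
  by rewrite (gmM G) (gmM _ G) gmtauh; apply: lin.
have klin := zproj_lin (germ0 psi0) psi0_lin.
have [ka kaE] : exists ka : germ R (p + p), gmap ka = zproj psi0.
  by exists (Germ (eqdm_biholo (eqdm_sym klin) (germP psi0))).
have [psi psiE] : exists psi, psi = (psi0 * ka^-1)%g by eexists.
have ka_w : weightedm (@zw p) (@zw p) (gmap ka) by rewrite kaE; apply: zproj_weighted.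
have psi_t : tangent_to_id psi.
  apply/tangent_eqd; rewrite -gm1 -(mulgV ka) psiE (gmM psi0) (gmM ka).
  apply: eqdm_compl; first exact: germ0.
  rewrite kaE; exact: eqdm_sym klin.
have psi_z : zproj psi = mid.
  apply: (mcomp_injr (germP ka)); rewrite -(zproj_comp _ ka_w (germ0 ka)) -gmM psiE mulgVK -kaE.
  by rewrite (mid_mcomp (germ0 ka)).
have ka_Z k : commute ka (gZ R k).
  by apply: germ_inj; rewrite !gmM gmZ; apply: weighted_comm_Z ka_w (germ0 ka).
(* psi and psi0 differ on the right by [ka], which commutes with x, so they conjugate x to the same
   map. *)
have psiZ x : commute ka x -> (psi * x * psi^-1)%g = (psi0 * x * psi0^-1)%g.
  move=> kx; rewrite psiE invMg invgK -!mulgA; congr (_ * _)%g.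
  by rewrite (mulgA x) -kx -!mulgA mulKg.
have ka_Zall : commute ka (Zall R p).
  by rewrite -(prod_gZ R (@inj_id _)); apply: commute_prod => k _; apply: ka_Z.
have [Ph PhE] : exists Ph, Ph = (psi ^ strG)%g by eexists.
(* This is [G_tau1] read through X and the straightening map. *)
have psi_Zall : (psi * Zall R p)%g = (Zall R p * psi)%g.
  apply: (mulIg (psi^-1)%g); rewrite mulgK (psiZ _ ka_Zall).
  have {1}-> : Zall R p = (X * tau1 * X^-1)%g by rewrite Xt1 mulgK.
  rewrite /psi0 !invMg invgK -!mulgA !mulKg (mulgA G) G_tau1 -!mulgA mulVKg.
  by rewrite mulgA strG_tau1h mulgK.
exists (gmap Ph); split.
- apply/Cc_tau_hatP; exists psi; split; [exact: psi_t|exact: psi_z|by rewrite PhE].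
- rewrite -gmtau1h -!gmM; congr gmap; apply: (mulgI strG).
  have psE : (strG * Ph)%g = (psi * strG)%g by rewrite PhE conjgE mulVKg.
  rewrite mulgA psE -mulgA strG_tau1h mulgA psi_Zall -mulgA -psE mulgA -strG_tau1h -mulgA.
  by [].
exists (gmap G); have fam j : (G * tauG j)%g = (Ph * tauhG (pi j) * Ph^-1 * G)%g.
  apply: (mulIg (G^-1)%g); rewrite mulgK; apply: (mulgI strG); apply: (mulIg (strG^-1)%g).
  have -> : (strG * (Ph * tauhG (pi j) * Ph^-1) * strG^-1)%g = (psi * gZ R (pi j) * psi^-1)%g.
    by rewrite PhE /tauhG -lock -!conjMg -conjVg -!conjMg conjgE !mulgA mulgV mul1g -!mulgA mulgV mulg1.
  rewrite (psiZ _ (ka_Z _)) psi0_conj /psi0 !invMg invgK -!mulgA.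
  by rewrite (mulKg X).
have famm j : mcomp G (tau j) = mcomp (conj_tau_hat L Ph (pi j)) G.
  by rewrite gm_conj_tau_hat -gmtau -!gmM fam.
split; [exact: germP|exact: G_anti|move=> j; exists (pi j); exact: famm|].
move=> k; exists (invF pi_inj k); rewrite famm f_invF; exact: erefl.
Qed.

End Existence.

(** The torus element K that normalizes the conjugate of tau_1 commutes with rho, so K Theta still
    takes rho_0 to rho. *)
Lemma part_existence Theta : normalizes_sigma D Theta -> oriented D Theta ->
  exists Ph, normal_form D Ph.
Proof.
move=> hT oT; have [Th ThE [aT sT]] := theta_germ hT.
have [|K KK Kt] := @normalize_tau1 R p sg adm_sum lam M L (lam_neq0 adm_params)
  (lam_e adm_params) (lam_h adm_params) (lam_s adm_params) adm_sq adm_L0 adm_ind adm_log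
  (Th * tau1 * Th^-1)%g (Th_t1K Th) (Th_t1_sigma aT sT).
  move=> j hj; have := oT j hj; rewrite -ThE -gmV -gmtau1 -!gmM mulgA.
  by [].
apply: (@existence (K * Th)%g); last by rewrite mulgA -Kt -!mulgA mulVg mulg1 mulgA.
have := Th_anti' aT; rewrite (conj_anti_germ (@swK p) rhK) => E1.
rewrite rho0E rhoE; apply/(conj_anti_germ (@swK p) rhK).
have /(conj_antiE rhK) : alpha K = K by exact: KK.
rewrite (conj_anti_germ rhK rhK) => E2.
by rewrite gconjM -mulgA E1 mulgA E2 mulgA.
Qed.

End Admissible.

(** * Uniqueness of the normal form *)

Section QuadricRigidity.
Variable R : realType.
Local Notation C := R[i].

Section Position.
Variables (p : nat) (sg : signature) (gam lam : 'I_p -> C).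
Hypothesis hq : quadric_params sg gam lam.
Local Notation sgp := (params_sum hq).

Lemma lam_re_im j : 0 < 'Re (lam j) /\ (is_e sg j = false -> 0 < 'Im (lam j)).
Proof.
case: (kindP sg j) => h.
- have l0 := lam_e hq h; split; last by rewrite h.
  by rewrite (Creal_ReP _ _) // gtr0_real.
- by have [_ _ re im _] := params_h hq h.
- by have [_ [_ re im]] := params_s hq h.
have hs : is_s sg (partner sg j) by rewrite (is_s_partner sgp).
have [_ [_ re im]] := params_s hq hs; have l0 := lam_neq0 hq (partner sg j).
have n0 : 0 < `|lam (partner sg j)| ^+ 2 by rewrite exprn_gt0 // normr_gt0.
have -> : lam j = ((lam (partner sg j))^*)^-1 by rewrite -(lam_s hq hs) (partnerK sgp).
by split=> [|_]; rewrite ?ReV ?ImV ?Re_conj ?Im_conj norm_conjC ?opprK divr_gt0.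
Qed.

Lemma mu_im j : is_e sg j = false -> 0 < 'Im (lam j ^+ 2).
Proof.
by move=> h; have [re /(_ h) im] := lam_re_im j; rewrite expr2 ImM addr_gt0 ?mulr_gt0.
Qed.

Lemma mu_norm j : is_e sg j = false -> (`|lam j ^+ 2| == 1) = is_h sg j.
Proof.
rewrite normrX sqrp_eq1 ?normr_ge0 //.
case: (kindP sg j) => h he; first by rewrite h in he.
- by have [_ -> _ _ _] := params_h hq h; rewrite eqxx h.
- by have [_ [l1 _ _]] := params_s hq h; rewrite gt_eqF // (is_s_notP sgp h).
have hs : is_s sg (partner sg j) by rewrite (is_s_partner sgp).
have [_ [l1 _ _]] := params_s hq hs.
rewrite -{1}(partnerK sgp j) (lam_s hq hs) (is_s'_notP sgp h) normfV norm_conjC.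
by rewrite lt_eqF // invf_lt1 // (lt_trans _ l1) ?ltr01.
Qed.

Lemma mu_e j : is_e sg j -> 1 < lam j ^+ 2.
Proof.
by move=> h; have [_ l1 _] := params_e hq h; rewrite exprn_egt1.
Qed.

End Position.

Variables (p : nat) (sg sg' : signature) (gam gam' lam lam' : 'I_p -> C).
Hypotheses (hq : quadric_params sg gam lam) (hq' : quadric_params sg' gam' lam').

Lemma signature_eq : (forall j : 'I_p, is_e sg j = is_e sg' j) ->
  (forall j : 'I_p, is_h sg j = is_h sg' j) -> sg = sg'.
Proof.
have := params_sum hq; have := params_sum hq'.
case: sg sg' => [e h s] [e' h' s'] /= E' E He Hh.
have ee : e = e'.
  apply/eqP; rewrite eqn_leq; apply/andP; split; rewrite leqNgt; apply/negP => lt.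
    have ep : (e' < p)%N by lia.
    by have := He (Ordinal ep); rewrite /is_e /= lt ltnn.
  have ep : (e < p)%N by lia.
  by have := He (Ordinal ep); rewrite /is_e /= lt ltnn.
subst e'; have hh : h = h'.
  apply/eqP; rewrite eqn_leq; apply/andP; split; rewrite leqNgt; apply/negP => lt.
    have ep : (e + h' < p)%N by lia.
    by have := Hh (Ordinal ep); rewrite /is_h /=; lia.
  have ep : (e + h < p)%N by lia.
  by have := Hh (Ordinal ep); rewrite /is_h /=; lia.
by subst h'; congr Signature; lia.
Qed.

Hypothesis mu_eq : forall j, lam' j ^+ 2 = lam j ^+ 2 \/ lam' j ^+ 2 = lam j ^- 2.

(** Elliptic eigenvalues are real, all others have positive imaginary part, and inversion preserves
    reality. *)
Lemma mu_is_e (j : 'I_p) : is_e sg j = is_e sg' j.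
Proof.
have im0 (q : C) : 1 < q -> 'Im q = 0.
  by move=> q1; apply/Creal_ImP; rewrite gtr0_real // (lt_trans _ q1) ?ltr01.
have imV (q : C) : 'Im q = 0 -> 'Im q^-1 = 0 by move=> q0; rewrite ImV q0 oppr0 mul0r.
case e: (is_e sg j); case e': (is_e sg' j) => //.
- have := mu_im hq' e'; have i0 := im0 _ (mu_e hq e).
  by case: (mu_eq j) => ->; rewrite ?(imV _ i0) ?i0 ltxx.
- have := mu_im hq e; have i0 := im0 _ (mu_e hq' e').
  case: (mu_eq j) => E; first by rewrite -E i0 ltxx.
  by rewrite -[lam j ^+ 2]invrK -E (imV _ i0) ltxx.
Qed.

(** Among the non-elliptic indices the hyperbolic ones are those with |mu_j| = 1, a property stable
    under inversion. *)
Lemma mu_sig : sg = sg'.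
Proof.
apply: signature_eq => [|j]; first exact: mu_is_e.
have ee := mu_is_e j; case e: (is_e sg j).
  rewrite (is_e_notP (params_sum hq) e); rewrite ee in e.
  by rewrite (is_e_notP (params_sum hq') e).
rewrite -(mu_norm hq e); rewrite ee in e; rewrite -(mu_norm hq' e).
by case: (mu_eq j) => ->; rewrite // normfV invr_eq1.
Qed.

(** The conditions mu_j > 1, or Im mu_j > 0, exclude inversion, and Re lambda_j > 0 selects the
    square root. *)
Lemma mu_lam j : lam' j = lam j.
Proof.
have E : lam' j ^+ 2 = lam j ^+ 2.
  case: (mu_eq j) => // E; case e: (is_e sg j).
    have e' := e; rewrite mu_is_e in e'; have := mu_e hq' e'; rewrite E invf_gt1.
      by move/lt_trans/(_ (mu_e hq e)); rewrite ltxx.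
    exact: lt_trans ltr01 (mu_e hq e).
  have e' := e; rewrite mu_is_e in e'; have := mu_im hq' e'; rewrite E ImV.
  rewrite mulNr oppr_gt0 => neg.
  have n0 : 0 < `|lam j ^+ 2| ^+ 2 by rewrite exprn_gt0 // normr_gt0 expf_neq0 // (lam_neq0 hq).
  by rewrite (lt_gtF (divr_gt0 (mu_im hq e) n0)) in neg.
have [re _] := lam_re_im hq j; have [re' _] := lam_re_im hq' j.
move/eqP: E; rewrite eqf_sqr => /orP[/eqP//|/eqP E].
by move: re'; rewrite E raddfN oppr_gt0 (lt_gtF re).
Qed.

End QuadricRigidity.

Section FamilyUniqueness.
Variables (R : realType) (p : nat).
Local Notation C := R[i].

(** Factor the difference of squares: u + u' has coefficient 2 at z'_k and cannot vanish to first
    order. So u - u' does, and the coefficients can be compared. *)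
Lemma uform_sq_inj (g g' : 'I_p -> C) pt pt' k :
  eqd 3 (uform g pt k ^+ 2) (uform g' pt' k ^+ 2) -> g k != 0 ->
  g k = g' k /\ pt k = pt' k.
Proof.
have [_ [rr [lr rl]]] := lrE p.
have uU (h : 'I_p -> C) (q : 'I_p -> 'I_p) i :
    uform h q k U_(i)%MM = (i == lshift p k)%:R + 2 * h k * (i == rshift p (q k))%:R.
  by rewrite /uform psaddE pszE !psX_coef !mnmU_eq.
have u0 (h : 'I_p -> C) (q : 'I_p -> 'I_p) : uform h q k 0%MM = 0.
  by rewrite /uform psaddE pszE !psX0 mulr0 addr0.
move=> E g0; have : eqd 3 ((uform g pt k - uform g' pt' k) * (uform g pt k + uform g' pt' k)) 0.
  rewrite -subr_sqr; exact: eqd_subl E.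
case/(@ord_mul _ _ 1 1).
- by apply/eqd1; rewrite psaddE psoppE !u0 subr0.
- by apply/eqd1; rewrite psaddE !u0 addr0.
- move=> H; have HU i : uform g pt k U_(i)%MM = uform g' pt' k U_(i)%MM.
    have := H U_(i)%MM; rewrite mdeg1 psaddE psoppE ps0E => /(_ isT)/eqP.
    by rewrite subr_eq0 => /eqP.
  have := HU (rshift p (pt k)); rewrite !uU rl rr eqxx !add0r mulr1 rr.
  case: eqP => [-> E2|_ /eqP]; last by rewrite mulr0 mulf_eq0 pnatr_eq0 (negbTE g0).
  split=> //; apply: (@mulfI _ 2); first by rewrite pnatr_eq0.
  by rewrite E2 mulr1.
move=> /(_ U_(lshift p k)%MM); rewrite mdeg1 psaddE !uU ps0E => /(_ isT)/eqP.
rewrite eqxx !lr !mulr0 !addr0.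
by rewrite -(natrD _ 1 1) pnatr_eq0.
Qed.

(* The linear parts of psi1 and psi2 being the identity, conjugation by them does not
   permute the reflections, so psi2^-1 * psi1 commutes with all of them. *)
Lemma Cc_unique (psi1 psi2 : germ R (p + p)) (k1 k2 : 'I_p -> 'I_p) :
  tangent_to_id psi1 -> zproj psi1 = mid -> tangent_to_id psi2 -> zproj psi2 = mid ->
  injective k1 ->
  (forall j, psi1 * gZ R (k1 j) * psi1^-1 = psi2 * gZ R (k2 j) * psi2^-1)%g ->
  psi1 = psi2.
Proof.
move=> t1 z1 t2 z2 k1_inj E.
have [ka kaD] : exists ka, ka = (psi2^-1 * psi1)%g by eexists.
have kaE j : (ka * gZ R (k1 j) = gZ R (k2 j) * ka)%g.
  have := congr1 (fun x => psi2^-1 * (x * psi1))%g (E j).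
  by rewrite kaD !mulgVK mulgA => ->; rewrite -!mulgA mulKg.
have t : eqdm 2 (gmap ka) mid.
  rewrite -gm1 -(mulVg psi2) kaD (gmM _ psi1) (gmM _ psi2).
  apply: eqdm_compr; [exact: germ0|exact: germ0|].
  apply: (eqdm_trans (G := mid)); first exact/tangent_eqd.
  exact/eqdm_sym/tangent_eqd.
have kk j : k1 j = k2 j.
  apply: (@gZ_inj R p); apply: germ_inj; rewrite !gmZ !ZmapE.
  have : eqdm 2 (gmap (gZ R (k1 j))) (gmap (gZ R (k2 j))).
    rewrite -(mid_mcomp (germ0 (gZ R (k1 j)))) -(mcomp_mid (gmap (gZ R (k2 j)))).
    apply: (eqdm_trans (G := mcomp ka (gZ R (k1 j)))).
      by apply: eqdm_compl; [exact: germ0|apply: eqdm_sym].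
    rewrite -gmM kaE (gmM (gZ R (k2 j))); apply: eqdm_compr; [exact: germ0|exact: pointed_mid|exact: t].
  rewrite !gmZ !ZmapE => H; congr dmap; apply/funext => i.
  have m1 : (mdeg U_(i)%MM < 2)%N by rewrite mdeg1.
  have := H i _ m1; rewrite /dmap !pszE psX_coef eqxx !mulr1.
  by [].
have ka_w : weightedm (@zw p) (@zw p) (gmap ka).
  apply: comm_Z_weighted; first exact: germ0.
  move=> k; have [j <-] : exists j, k1 j = k by exists (invF k1_inj k); rewrite f_invF.
  by rewrite -gmZ -!gmM kaE kk.
have : ka = 1%g; last by move/(congr1 (mulg psi2)); rewrite kaD mulVKg mulg1.
apply: germ_inj; rewrite gm1 -z1.
have -> : psi1 = (psi2 * ka)%g by rewrite kaD mulVKg.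
by rewrite gmM (zproj_comp _ ka_w (germ0 ka)) z2 (mid_mcomp (germ0 ka)).
Qed.

End FamilyUniqueness.

Section NormalFormData.
Variables (R : realType) (p : nat) (D : submanifold R p).
Hypothesis hD : admissible D.
Local Notation tau1h := (@tau1_hat R p (sub_Lhat D)).

(* A normal form of D: Phi is the conjugate of psi by straighten L. *)
Record nf_data (Phi : formal_map R (p + p) (p + p)) (psi G : germ R (p + p))
    (kf : 'I_p -> 'I_p) : Prop := NFData {
  nf_tangent : tangent_to_id psi;
  nf_zproj : zproj psi = mid;
  nf_Phi : Phi = gmap (psi ^ strG hD)%g;
  nf_normal : normalizes_family D Phi G;
  nf_anti : conj_anti G (@rho0 R p) (rho R (sub_sig D));
  nf_inj : injective kf;
  nf_family : conj_family_germ hD G (psi ^ strG hD)%g kf;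
  nf_tau1 : (G * tau1 hD)%g = (tau1h * G)%g;
  nf_sigma : (G * sigmaG hD)%g = (torus (sub_Mhat D) * G)%g }.

Lemma normal_form_data Phi : normal_form D Phi -> exists psi G kf, nf_data Phi psi G kf.
Proof.
case=> /(Cc_tau_hatP hD)[psi [tpsi zpsi PhiE]] comm [F nF].
have bF : biholo F by case: nF.
subst Phi.
have [aG [kf kf_inj fam]] := family_germ hD (G := Germ bF) nF.
have Pht : ((psi ^ strG hD) * tau1h = tau1h * (psi ^ strG hD))%g.
  by apply: germ_inj; rewrite (gmM (psi ^ _)%g) (gmM tau1h) (gmtau1h hD).
have Gt := family_tau1 kf_inj fam Pht.
exists psi, (Germ bF), kf; split; [exact: tpsi|exact: zpsi|exact: erefl|exact: nF|exact: aG|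
  exact: kf_inj|exact: fam|exact: Gt|apply: core_sigma; [exact: aG|exact: Gt]].
Qed.

End NormalFormData.

Lemma conj_family_transport (gT : groupType) (F H G t psi psi' z z' : gT) :
  (F * H = H * F -> H * z = z * H ->
   G * t = psi ^ F * z ^ F * (psi ^ F)^-1 * G ->
   H * G * t = psi' ^ F * z' ^ F * (psi' ^ F)^-1 * (H * G) ->
   (psi ^ H^-1) * z * (psi ^ H^-1)^-1 = psi' * z' * psi'^-1)%g.
Proof.
move=> FH Hz E E'; have HF : (H ^ F)%g = H by rewrite conjgE -FH mulKg.
have zH : (z ^ H^-1)%g = z by rewrite conjgE invgK mulgA Hz mulgK.
have E1 : ((H * (psi * z * psi^-1)) ^ F = (psi' * z' * psi'^-1 * H) ^ F)%g.
  by rewrite !conjMg !conjVg HF; apply: (mulIg G); rewrite -mulgA -E mulgA E' mulgA.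
apply: (mulIg H); rewrite -(conjg_inj F E1).
have -> : (psi ^ H^-1 * z * (psi ^ H^-1)^-1 = (psi * z * psi^-1) ^ H^-1)%g.
  by rewrite !conjMg conjVg zH.
by rewrite conjgE invgK mulgA mulgVK.
Qed.

Section Uniqueness.
Variables (R : realType) (p : nat) (D D' : submanifold R p).
Hypotheses (hD : admissible D) (hD' : admissible D').
Hypothesis EE : sub_E D' = sub_E D.
Local Notation M := (sub_Mhat D).
Local Notation M' := (sub_Mhat D').
Local Notation L := (sub_Lhat D).
Local Notation L' := (sub_Lhat D').
Local Notation lam := (sub_lam D).
Local Notation lam' := (sub_lam D').

(** E determines its quadratic part, hence the coefficients g and the pairing of indices, hence mu_j
    + 1/mu_j. *)
Lemma same_mu j : lam' j ^+ 2 = lam j ^+ 2 \/ lam' j ^+ 2 = lam j ^- 2.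
Proof.
have gE k : coeff_g (sub_sig D) (sub_gam D) k = coeff_g (sub_sig D') (sub_gam D') k /\
    partner (sub_sig D) k = partner (sub_sig D') k.
  apply: uform_sq_inj (adm_g0 hD k); apply: eqd_trans (eqd_sym (adm_E hD k)) _.
  rewrite -EE; exact: adm_E hD' k.
have l0 := lam_neq0 (adm_params hD) j; have l0' := lam_neq0 (adm_params hD') j.
have := trace_eq (adm_params hD) j; have [ptE] := gE j; rewrite ptE => ->.
have [-> _] := gE (partner (sub_sig D') j).
rewrite (trace_eq (adm_params hD') j) => E.
have : (lam' j ^+ 2 - lam j ^+ 2) * (lam' j ^+ 2 - lam j ^- 2) = 0.
  have -> : (lam' j ^+ 2 - lam j ^+ 2) * (lam' j ^+ 2 - lam j ^- 2) =
      lam' j ^+ 2 * (lam' j ^+ 2 + lam' j ^- 2 - (lam j ^+ 2 + lam j ^- 2)).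
    by field; rewrite l0 l0'.
  by rewrite E subrr mulr0.
by move/eqP; rewrite mulf_eq0 !subr_eq0 => /orP[/eqP|/eqP]; [left|right].
Qed.

Lemma same_sig : sub_sig D' = sub_sig D.
Proof. exact/esym/(mu_sig (adm_params hD) (adm_params hD') same_mu). Qed.

Lemma same_lam j : lam' j = lam j.
Proof. exact: mu_lam (adm_params hD) (adm_params hD') same_mu j. Qed.

Lemma same_generators : exists2 s : 'I_p -> 'I_p, injective s &
  forall j, tauG hD' j = tauG hD (s j).
Proof.
have [X [_ _ H]] := straighten_deck hD.
have [pi pi_inj XT] := H _ (adm_gen_germ hD).
have gen' : deck_generators (sub_E D) (fun j => gmap (tauG hD' j)).
  by rewrite -EE; exact: adm_gen_germ hD'.
have [pi' pi_inj' XT'] := H _ gen'.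
exists (fun j => invF pi_inj (pi' j)).
  by move=> j k /(can_inj (f_invF pi_inj)) /pi_inj'.
by move=> j; apply: (mulgI X); rewrite XT XT' f_invF.
Qed.

(** X conjugates the product of either system of generators to [Zall], whatever the numbering. *)
Lemma same_tau1 : tau1 hD' = tau1 hD.
Proof.
have [X [_ _ H]] := straighten_deck hD; apply: (mulgI X).
have [pi pi_inj XT] := H _ (adm_gen_germ hD).
have gen' : deck_generators (sub_E D) (fun j => gmap (tauG hD' j)).
  by rewrite -EE; exact: adm_gen_germ hD'.
have [pi' pi_inj' XT'] := H _ gen'.
by rewrite /tau1 (prod_straightened pi_inj XT) (prod_straightened pi_inj' XT').
Qed.

Lemma same_sigma : sigmaG hD' = sigmaG hD.
Proof. by rewrite /sigmaG same_tau1. Qed.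

Lemma const_series_sq (c : series R p) : c * c = 1 -> c = c 0%MM *: 1 /\ c 0%MM * c 0%MM = 1.
Proof.
move=> cc; have e2 : c 0%MM * c 0%MM = 1 by rewrite -psmul0 cc ps1E eqxx.
have e0 : c 0%MM != 0.
  by apply/eqP => z; move: e2; rewrite z mulr0 => /eqP; rewrite eq_sym oner_eq0.
split=> //; apply: sqrt_uniq e0; last by rewrite pszE ps1E eqxx mulr1.
by rewrite cc -scalerAl mul1r scalerA e2 scale1r.
Qed.

Variables (Phi Phi' : formal_map R (p + p) (p + p)).
Variables (psi psi' G G' : germ R (p + p)) (kf kf' : 'I_p -> 'I_p).
Hypotheses (nf : nf_data hD Phi psi G kf) (nf' : nf_data hD' Phi' psi' G' kf').

(** The transition H is diagonal over zeta by non-resonance; rigidity, applied to M and M', then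
    gives at once that H fixes zeta and that M' = M. *)
Lemma transition_torus : [/\ M' = M, L' = L & exists eps : 'I_p -> R[i],
  (forall j, eps j * eps j = 1) /\ (G' * G^-1)%g = torus (fun j => eps j *: 1)].
Proof.
have [H HD] : exists H, H = (G' * G^-1)%g by eexists.
rewrite -HD.
have muE j : M' j 0%MM = lam j ^+ 2 by rewrite (adm_M0 hD') same_lam.
have HG : (H * G = G')%g by rewrite HD mulgVK.
have HM : (H * torus M = torus M' * H)%g.
  apply: (mulIg G); rewrite -!mulgA -(nf_sigma nf) HG mulgA HG -same_sigma.
  exact: nf_sigma nf'.
have nM := adm_nzM hD; have nM' := adm_nzM hD'.
have [c [d [c0 d0 HE]]] :=
  gemap_of_commutation (adm_ind hD) nM nM' (adm_M0 hD) muE HM.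
rewrite HE in HM; have MM := gemap_conj_torus c0 d0 nM nM' HM.
have nl' : normalized_log (sub_sig D) M' by rewrite -same_sig; exact: adm_log hD'.
have cdm := normalized_rigid (adm_log hD) nl' nM' MM.
have cd := act_mid1 cdm.
have EM : M' = M.
  apply/funext => j; rewrite -MM cdm.
  by have := mcomp_mid M' => /(congr1 (fun F : formal_map R p p => F j)); rewrite mcompE.
have EL : L' = L.
  apply/funext => j; apply: sqrt_uniq; first by rewrite -!adm_sq // EM.
    by rewrite (adm_L0 hD') (adm_L0 hD) same_lam.
  by rewrite (adm_L0 hD') (lam_neq0 (adm_params hD')).
split; [exact: EM|exact: EL|].
have HT : H = torus c by rewrite HE (gemap_torus c0 d0 cd).
have Ht : (H * tau1_hat L = tau1_hat L * H)%g.
  apply: (mulIg G); rewrite -!mulgA -(nf_tau1 nf) (mulgA H G) HG -same_tau1 (nf_tau1 nf') EL.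
  by [].
have nL := adm_nzL hD; have c0' := nz_vinv c0.
(* Passing [torus c] through [swap] inverts c; as H commutes with [torus L * swap], c is its own
   inverse. *)
have cc j : c j * c j = 1.
  move: Ht; rewrite HT /tau1_hat -!lock -mulgA (swap_torus c0) !mulgA => /mulIg.
  rewrite (torusM c0 nL) (torusM nL c0') => /(torus_inj (nz_vmul c0 nL) (nz_vmul nL c0')).
  rewrite (vmulC c) => /(vmul_cancel nL) => E.
  by rewrite {1}E (vmulVl c0).
exists (fun j => c j 0%MM); split=> [j|]; first by have [] := const_series_sq (cc j).
by rewrite HT; congr torus; apply/funext => j; have [] := const_series_sq (cc j).
Qed.

Section Sign.
Variable eps : 'I_p -> R[i].
Hypothesis eps2 : forall j, eps j * eps j = 1.
Local Notation ceps := (fun j => eps j *: (1 : series R p)).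

Lemma ceps1 j : ceps j * ceps j = 1.
Proof. by rewrite -scalerAl mul1r scalerA eps2 scale1r. Qed.

Lemma nz_ceps : nz ceps.
Proof.
move=> j; rewrite pszE ps1E eqxx mulr1; apply/eqP => z.
by have := eps2 j; rewrite z mulr0 => /eqP; rewrite eq_sym oner_eq0.
Qed.

Lemma gmtorus_sign : gmap (torus ceps) = emap ceps ceps.
Proof.
rewrite (gmtorus nz_ceps); congr emap; apply/funext => j.
exact: psinv_uniq (nz_ceps j) (ceps1 j).
Qed.

Lemma emap_sign : emap ceps ceps = dmap (lrfun eps eps).
Proof.
apply/map_lr => j; rewrite /dmap ?lrfunL ?lrfunR ?emapL ?emapR /zcomp.
  by rewrite (pscompZ _ _ (@pointed_xi_eta R p)) (pscomp1 (@pointed_xi_eta R p)) -scalerAl mul1r.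
by rewrite (pscompZ _ _ (@pointed_xi_eta R p)) (pscomp1 (@pointed_xi_eta R p)) -scalerAl mul1r.
Qed.

Lemma R_epsE : R_eps eps = gmap (torus ceps).
Proof.
rewrite gmtorus_sign emap_sign; apply/map_lr => j; rewrite /R_eps /dmap ?lrfunL ?lrfunR.
  exact: glueL.
exact: glueR.
Qed.

Lemma sign_straighten : (strG hD * torus ceps = torus ceps * strG hD)%g.
Proof.
have P := pointed_emap ceps ceps; have zs f : pscomp (zcomp f) (emap ceps ceps) = zcomp f.
  by rewrite zcomp_emap (act1 ceps1) -[f in RHS](pscomp_mid f).
apply: germ_inj; rewrite (gmM (strG hD)) (gmM (torus ceps)) gmtorus_sign.
rewrite {2}emap_sign (dmap_comp _ (germ0 (strG hD))).
have -> : gmap (strG hD) = straighten L by exact: erefl.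
apply/map_lr => j; rewrite mcompE ?lrfunL ?lrfunR ?straightenL ?straightenR.
  rewrite (pscompD _ _ P) (pscompM _ _ P) zs !(pscomp_psX _ P) emap_sign /dmap lrfunL lrfunR.
  by rewrite scalerDr scalerAr.
rewrite (pscompB _ _ P) (pscompM _ _ P) zs !(pscomp_psX _ P) emap_sign /dmap lrfunL lrfunR.
by rewrite scalerBr scalerAr.
Qed.

Lemma sign_gZ k : (torus ceps * gZ R k = gZ R k * torus ceps)%g.
Proof.
apply: germ_inj; rewrite !gmM gmtorus_sign emap_sign gmZ ZmapE !dmap_dmap.
by congr dmap; apply/funext => i; rewrite mulrC.
Qed.

End Sign.

Lemma uniqueness : exists2 eps : 'I_p -> R[i],
  mcomp (R_eps eps) (R_eps eps) = mid &
  Phi' = mcomp (R_eps eps) (mcomp Phi (minv (R_eps eps))).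
Proof.
have [_ EL [eps [eps2 HE]]] := transition_torus; exists eps; rewrite !(R_epsE eps2).
  rewrite -gmM (torusM (nz_ceps eps2) (nz_ceps eps2)) -gm1 -torus1.
  congr (gmap (torus _)); apply/funext => j; exact: ceps1.
have [h hE] : exists h, h = torus (fun j => eps j *: (1 : series R p)) by eexists.
have hG : (h * G)%g = G' by rewrite hE -HE mulgVK.
have sh := sign_straighten eps2; have zh k := sign_gZ eps2 k; rewrite -!hE in sh zh *.
have SE : strG hD' = strG hD.
  apply: germ_inj; have -> : gmap (strG hD') = straighten L' by exact: erefl.
  by rewrite EL.
have TE k : tauhG hD' k = tauhG hD k by rewrite /tauhG SE.
have [s s_inj sE] := same_generators.
have hh : (h * h)%g = 1%g.
  rewrite hE (torusM (nz_ceps eps2) (nz_ceps eps2)) -torus1.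
  congr torus; apply/funext => j; exact: ceps1.
have hV : (h^-1)%g = h by apply: (mulgI h); rewrite mulgV hh.
(* Conjugation by a diagonal sign map multiplies each coefficient by a sign, so it preserves the
   conditions defining C^c, and [Cc_unique] applies. *)
have psiE : (psi ^ h^-1)%g = psi'.
  have gm : gmap (psi ^ h^-1)%g = fun i => lrfun eps eps i *: pscomp (gmap psi i) (dmap (lrfun eps eps)).
    have P := germ0 (psi * h)%g; rewrite gmM hE (gmtorus_sign eps2) emap_sign in P.
    rewrite conjgE invgK (gmM h) (gmM psi) hV hE (gmtorus_sign eps2) emap_sign.
    by rewrite (dmap_comp _ P); apply/funext => i; rewrite mcompE.
  have coefE i m : gmap (psi ^ h^-1)%g i m =
      lrfun eps eps i * (gmap psi i m * \prod_l lrfun eps eps l ^+ m l).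
    by rewrite gm pszE pscomp_dmap.
  have ll i : lrfun eps eps i * lrfun eps eps i = 1.
    by move: i; apply: ord_lr => j; rewrite ?lrfunL ?lrfunR.
  have midE i m : lrfun eps eps i * (@mid R (p + p) i m * \prod_l lrfun eps eps l ^+ m l) =
      mid i m.
    rewrite /mid psX_coef; case: eqP => [->|_]; last by rewrite mul0r mulr0.
    rewrite mul1r (bigD1 i isT) big1 => [|l /negbTE li]; last by rewrite mnm1E eq_sym li expr0.
    by rewrite /= mulr1 mnm1E eqxx expr1 ll.
  (* [s] reads the generators of D' among those of D, so that both families get the same index. *)
  apply: (Cc_unique (k1 := kf \o s) (k2 := kf')).
  - by move=> i m m1; rewrite coefE (nf_tangent nf) // -/(@mid R (p + p) i m) midE.
  - apply/funext => i; apply/funext => m; rewrite zprojP coefE -midE.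
    have := congr1 (fun F : formal_map R _ _ => F i m) (nf_zproj nf); rewrite zprojP => <-.
    case: (_ == _); first exact: erefl.
    by rewrite mul0r mulr0.
  - exact: nf_tangent nf'.
  - exact: nf_zproj nf'.
  - by apply: inj_comp s_inj; exact: nf_inj nf.
  move=> j; apply: (conj_family_transport (F := strG hD) (G := G) (t := tauG hD (s j))).
  - exact: sh.
  - exact: zh.
  - have := nf_family nf (s j); rewrite /tauhG -lock; exact.
  have := nf_family nf' j; rewrite hG sE SE TE /tauhG -lock; exact.
rewrite (nf_Phi nf') (nf_Phi nf) -gmV -!gmM -psiE SE; congr gmap.
have shV : (h ^ strG hD)%g = h by rewrite conjgE -sh mulKg.
have -> : (psi ^ h^-1)%g = (h * psi * h^-1)%g by rewrite conjgE invgK mulgA.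
by rewrite !conjMg conjVg shV -mulgA.
Qed.

End Uniqueness.

(** * Reconstruction of the submanifold *)

Section SquareMap.
Variables (R : realType) (p : nat).
Local Notation C := R[i].

Definition sqmap : formal_map R (p + p) (p + p) :=
  lrfun (fun j => psX R (lshift p j)) (fun j => psX R (rshift p j) ^+ 2).

Definition sqexp (a : 'X_{1..p + p}) : 'X_{1..p + p} :=
  [multinom lrfun (fun j => a (lshift p j)) (fun j => (a (rshift p j)).*2) i | i < p + p].

Lemma sqexpL a j : sqexp a (lshift p j) = a (lshift p j).
Proof. by rewrite mnmE lrfunL. Qed.
Lemma sqexpR a j : sqexp a (rshift p j) = (a (rshift p j)).*2.
Proof. by rewrite mnmE lrfunR. Qed.

Lemma sqexp_inj : injective sqexp.
Proof.
move=> a b /mnmP E; apply/mnmP; apply: ord_lr => j; first by rewrite -(sqexpL a) -(sqexpL b) E.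
by apply: double_inj; rewrite -(sqexpR a) -(sqexpR b) E.
Qed.

Lemma sqexp_deg a : (mdeg (sqexp a) <= (mdeg a).*2)%N.
Proof.
rewrite !mdegE -addnn -big_split; apply: leq_sum => i _ /=.
move: i; apply: ord_lr => j; first by rewrite sqexpL leq_addr.
by rewrite sqexpR -(addnn (a _)).
Qed.

Lemma pointed_sqmap : pointed sqmap.
Proof.
apply: ord_lr => j; rewrite /sqmap ?lrfunL ?lrfunR ?psX0 //.
by rewrite expr2 psmul0 psX0 mul0r.
Qed.

Lemma mono_sqmap a m : mono sqmap a m = (sqexp a == m)%:R.
Proof.
rewrite -mono_mid; congr (_ m); apply: eq_bigr => i _.
move: i; apply: ord_lr => j; rewrite /sqmap ?lrfunL ?lrfunR ?sqexpL ?sqexpR; first exact: erefl.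
by rewrite -exprM mul2n.
Qed.

Lemma sqmap_coef h a : pscomp h sqmap (sqexp a) = h a.
Proof.
rewrite (pscompE _ pointed_sqmap (ltnSn _)).
rewrite (@bsum1 _ _ _ a (fun c => h c * mono sqmap c (sqexp a))).
- by rewrite mono_sqmap eqxx mulr1.
- rewrite ltnS !mdegE; apply: leq_sum => i _; move: i; apply: ord_lr => j.
    by rewrite sqexpL.
  by rewrite sqexpR -addnn leq_addr.
- move=> c cb; rewrite mono_sqmap (_ : (_ == _) = false) ?mulr0 //.
  by apply: contraNF cb => /eqP /sqexp_inj ->.
Qed.

Lemma sqmap_comp_inj h h' : pscomp h sqmap = pscomp h' sqmap -> h = h'.
Proof. by move=> E; apply/funext => a; rewrite -(sqmap_coef h) E sqmap_coef. Qed.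

(** Invariance under Z_k kills the coefficients that are odd in the k-th second variable; the
    remaining exponents are the values of [sqexp]. *)
Lemma sqmap_factor F : (forall k, pscomp F (Zmap R k) = F) ->
  F = pscomp (fun a => F (sqexp a)) sqmap.
Proof.
move=> FZ; apply/funext => m; case: (boolP [forall k, ~~ odd (m (rshift p k))]) => [/forallP H|].
  have -> : m = sqexp [multinom lrfun (fun j => m (lshift p j)) (fun j => (m (rshift p j))./2) i
                        | i < p + p].
    apply/mnmP; apply: ord_lr => j; first by rewrite sqexpL mnmE lrfunL.
    by rewrite sqexpR mnmE lrfunR halfK (negbTE (H j)) subn0.
  by rewrite sqmap_coef.
move=> /forallPn[k /negPn odd_k].
have -> : F m = 0.
  have := congr1 (fun f : series R _ => f m) (FZ k).
  rewrite ZmapE pscomp_dmap zsgn_prod odd_k expr1 mulrN1 => /eqP.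
  by rewrite eqNr => /eqP.
rewrite (pscompE _ pointed_sqmap (ltnSn _)) big1 // => a _; rewrite mono_sqmap.
case: eqP => [E|_]; last by rewrite mulr0.
have := congr1 (fun b : 'X_{1..p + p} => odd (b (rshift p k))) E.
by rewrite /= sqexpR odd_double odd_k.
Qed.

End SquareMap.

(** * The projection pi_1 as a quotient map *)

Section DeckQuotient.
Variables (R : realType) (p : nat) (D : submanifold R p).
Hypothesis hD : admissible D.
Local Notation E := (sub_E D).
Local Notation gE := (graph E).

Lemma pointed_gE : pointed gE.
Proof.
apply: ord_lr => j; rewrite ?graphL ?graphR ?psX0 //.
rewrite (adm_E hD) ?mdeg0 // expr2 psmul0 /uform psaddE pszE !psX0 mulr0 addr0 mul0r.
by [].
Qed.

(* pi_1 is, up to coordinate changes, the quotient by the deck group. *)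
Lemma graph_factor : exists X e : germ R (p + p),
  gE = mcomp e (mcomp (@sqmap R p) X) /\
  forall k, exists j, (X * tauG hD j)%g = (gZ R k * X)%g.
Proof.
have [X [XL XR H]] := straighten_deck hD.
have [pi pi_inj XT] := H _ (adm_gen_germ hD).
have XV0 := germ0 (X^-1)%g; have PE := pointed_gE; have Psq := @pointed_sqmap R p.
have inv i k : pscomp (pscomp (gE i) (X^-1)%g) (Zmap R k) = pscomp (gE i) (X^-1)%g.
  have [j <-] : exists j, pi j = k by exists (invF pi_inj k); rewrite f_invF.
  have := germ0 (gZ R (pi j)); rewrite gmZ => Z0.
  rewrite (pscompA _ XV0 Z0) -gmZ -gmM.
  have -> : (X^-1 * gZ R (pi j) = tauG hD j * X^-1)%g.
    by apply: (mulgI X); rewrite mulVKg mulgA XT mulgK.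
  rewrite gmM -(pscompA _ (germ0 _) XV0); congr pscomp.
  have [dk _ _ _] := adm_gen hD; have [_ _ /(congr1 (fun F : formal_map R _ _ => F i))] := dk j.
  by rewrite mcompE.
have [e [eC eE]] : exists e : formal_map R (p + p) (p + p),
    (forall i a, e i a = pscomp (gE i) (X^-1)%g (sqexp a)) /\
    (forall i, pscomp (gE i) (X^-1)%g = pscomp (e i) (@sqmap R p)).
  exists (fun i a => pscomp (gE i) (X^-1)%g (sqexp a)); split=> [i a|i]; first exact: erefl.
  exact: sqmap_factor (inv i).
have XVL j : gmap (X^-1)%g (lshift p j) = psX R (lshift p j).
  have := congr1 (fun F => gmap F (lshift p j)) (mulgV X).
  by rewrite gmM mcompE XL (pscomp_psX _ XV0) gm1.
have eL j : e (lshift p j) = psX R (lshift p j).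
  apply: (@sqmap_comp_inj R p); rewrite -eE graphL (pscomp_psX _ XV0) (pscomp_psX _ Psq).
  by rewrite /sqmap lrfunL XVL.
have XVR k : eqd 2 (pscomp (uform (coeff_g (sub_sig D) (sub_gam D)) (partner (sub_sig D)) k) (X^-1)%g)
    (psX R (rshift p k)).
  have := congr1 (fun F => gmap F (rshift p k)) (mulgV X).
  rewrite gmM mcompE gm1 -/(@mid R (p + p) (rshift p k)) => <-.
  apply: eqd_compl XV0 _; exact/eqd_sym/XR.
have eR k : eqd 3 (pscomp (gE (rshift p k)) (X^-1)%g) (psX R (rshift p k) ^+ 2).
  rewrite graphR; apply: eqd_trans (eqd_compl XV0 (adm_E hD k)) _.
  rewrite (pscompXn _ _ XV0); move: (XVR k); set u := pscomp _ _ => uE.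
  apply/eqd_subr; rewrite subr_sqr -[3%N]/(2 + 1)%N; apply: eqd0M.
    exact: eqd_subl uE.
  apply/eqd1; rewrite psaddE psX0 addr0 uE ?mdeg0 //; exact: psX0.
have e_bij : biholo e.
  apply: tangent_biholo; apply: tangent_jacobian.
    apply: ord_lr => j; first by rewrite eL psX0.
    by rewrite -(pscomp_at0 (e _) Psq) -eE eR ?mdeg0 // expr2 psmul0 psX0 mul0r.
  rewrite -jacobian0_mid; apply/matrixP => i l; rewrite !mxE.
  move: i; apply: ord_lr => j; first by rewrite eL.
  (* [sqexp] at most doubles degrees, so the linear coefficients of e sit in degree at most 2 of
     pi_1 o X^-1, where the quadratic part of E decides. *)
  have d3 : (mdeg (sqexp U_(l)%MM) < 3)%N.
    by rewrite ltnS; apply: leq_trans (sqexp_deg _) _; rewrite mdeg1.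
  rewrite eC (eR j _ d3).
  rewrite -(sqmap_coef (mid (rshift p j))) (pscomp_psX _ Psq) /sqmap lrfunR.
  by [].
exists X, (Germ e_bij); split; last first.
  by move=> k; exists (invF pi_inj k); rewrite XT f_invF.
apply/funext => i; rewrite mcompE -(pscompA _ Psq (germ0 X)).
rewrite -eE (pscompA _ XV0 (germ0 X)) -gmM mulVg gm1.
by rewrite pscomp_mid.
Qed.

Lemma deck_invariant_factor f :
  (forall j, pscomp f (sub_tau D j) = f) -> exists P, f = pscomp P gE.
Proof.
move=> ft; have [X [e [gEE XT]]] := graph_factor.
have XV0 := germ0 (X^-1)%g; have Psq := @pointed_sqmap R p.
have inv k : pscomp (pscomp f (X^-1)%g) (Zmap R k) = pscomp f (X^-1)%g.
  have [j Xj] := XT k; have := germ0 (gZ R k); rewrite gmZ => Z0.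
  rewrite (pscompA _ XV0 Z0) -gmZ -gmM.
  have -> : (X^-1 * gZ R k = tauG hD j * X^-1)%g.
    by apply: (mulgI X); rewrite mulVKg mulgA Xj mulgK.
  by rewrite gmM -(pscompA _ (germ0 _) XV0) gmtau ft.
have [h hE] : exists h, pscomp f (X^-1)%g = pscomp h (@sqmap R p).
  by eexists; apply: sqmap_factor inv.
have PsX := pointed_comp Psq (germ0 X).
exists (pscomp h (e^-1)%g); rewrite gEE (pscompA _ (germ0 (e^-1)%g)); last first.
  exact: pointed_comp (germ0 e) PsX.
have -> : mcomp (e^-1)%g (mcomp e (mcomp (@sqmap R p) X)) = mcomp (@sqmap R p) X.
  apply: (etrans (mcompA (gmap (e^-1)%g) (germ0 e) PsX)).
  rewrite -gmM mulVg gm1; exact: mid_mcomp PsX.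
rewrite -(pscompA _ Psq (germ0 X)) -hE (pscompA _ XV0 (germ0 X)) -gmM mulVg gm1.
by rewrite pscomp_mid.
Qed.

(** Invertible substitutions lose nothing, and [sqmap] moves coefficients to distinct places. *)
Lemma graph_comp_inj P P' : pscomp P gE = pscomp P' gE -> P = P'.
Proof.
have [X [e [gEE XT]]] := graph_factor; have Psq := @pointed_sqmap R p.
have PsX := pointed_comp Psq (germ0 X).
have A Q : pscomp Q gE = pscomp (pscomp (pscomp Q e) (@sqmap R p)) X.
  rewrite gEE; apply: (etrans (esym (pscompA Q (germ0 e) PsX))).
  exact: esym (pscompA (pscomp Q e) Psq (germ0 X)).
have B (y : germ R (p + p)) Q : pscomp (pscomp Q y) (y^-1)%g = Q.
  by rewrite (pscompA _ (germ0 y) (germ0 (y^-1)%g)) -gmM mulgV gm1 pscomp_mid.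
move=> E0; have E1 := etrans (esym (A P)) (etrans E0 (A P')).
have E2 := etrans (esym (B _ _)) (etrans (congr1 (fun f => pscomp f (X^-1)%g) E1) (B _ _)).
have E3 := sqmap_comp_inj E2.
exact: etrans (esym (B _ _)) (etrans (congr1 (fun f => pscomp f (e^-1)%g) E3) (B _ _)).
Qed.

End DeckQuotient.

(** * Equivalence of submanifolds with equal normal forms *)

Section Classification.
Variable (R : realType) (p : nat).

(** The projection pi_1 of D', composed with H, is invariant under the deck group of D, hence
    factors through the pi_1 of D. *)
Lemma transition_factor (D D' : submanifold R p) (hD : admissible D) (hD' : admissible D')
    (H : germ R (p + p)) (s : 'I_p -> 'I_p) :
  (forall j, (H * tauG hD j)%g = (tauG hD' (s j) * H)%g) ->
  exists Psi, mcomp (graph (sub_E D')) H = mcomp Psi (graph (sub_E D)).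
Proof.
move=> Hs; have [|Psi PsiE] := @boolp.choice _ _ (fun i P =>
    pscomp (graph (sub_E D') i) H = pscomp P (graph (sub_E D))).
  move=> i; apply: (deck_invariant_factor hD) => j.
  rewrite (pscompA _ (germ0 H) (germ0 (tauG hD j))) -gmM Hs gmM.
  rewrite -(pscompA _ (germ0 _) (germ0 H)) gmtau; congr pscomp.
  have [dk _ _ _] := adm_gen hD'.
  have [_ _ /(congr1 (fun F : formal_map R _ _ => F i))] := dk (s j).
  by rewrite mcompE.
by exists Psi; apply/funext => i; rewrite !mcompE PsiE.
Qed.

(** H and its inverse both descend, which makes Psi invertible. As H commutes with rho_0, its
    w'-components are the conjugates of its z'-components, the substitution required by
    [maps_submanifold]. *)
Lemma transition_equivalence (D D' : submanifold R p) (hD : admissible D)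
    (hD' : admissible D') (H : germ R (p + p)) (s s' : 'I_p -> 'I_p) :
  anticonj (@swK p) H = H ->
  (forall j, (H * tauG hD j)%g = (tauG hD' (s j) * H)%g) ->
  (forall j, (H^-1 * tauG hD' j)%g = (tauG hD (s' j) * H^-1)%g) ->
  formally_equivalent (sub_E D) (sub_E D').
Proof.
move=> aH Hs Hs'; have [Psi PsiE] := transition_factor Hs.
have [Psi' PsiE'] := transition_factor Hs'.
have P1 := pointed_gE hD; have P2 := pointed_gE hD'.
have H0 := germ0 H; have H0' := germ0 (H^-1)%g.
have Psi0 : pointed Psi.
  move=> i; rewrite -(pscomp_at0 (Psi i) P1) -mcompE -PsiE mcompE (pscomp_at0 _ H0); exact: P2.
have Psi0' : pointed Psi'.
  move=> i; rewrite -(pscomp_at0 (Psi' i) P2) -mcompE -PsiE' mcompE (pscomp_at0 _ H0'); exact: P1.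
have KK : mcomp Psi' Psi = mid.
  apply/funext => i; apply: (graph_comp_inj hD); rewrite mcompE (pscompA _ Psi0 P1) -PsiE.
  rewrite -(pscompA _ P2 H0) -mcompE -PsiE' mcompE (pscompA _ H0' H0) -gmM mulVg gm1 pscomp_mid.
  by rewrite (pscomp_psX _ P1).
have bPsi : biholo Psi.
  split; first exact: Psi0.
  have := jacobian0_comp Psi' Psi0; rewrite KK jacobian0_mid => /esym/mulmx1_unit[_].
  by [].
exists Psi; first exact: bPsi.
move=> j; have PL k : pscomp (Psi (lshift p k)) (graph (sub_E D)) = gmap H (lshift p k).
  by rewrite -mcompE -PsiE mcompE graphL (pscomp_psX _ H0).
rewrite -mcompE -PsiE mcompE graphR; congr pscomp.
apply/map_lr => k; rewrite ?glueL ?glueR; first by rewrite PL.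
rewrite -{1}aH anticonj_coef swR -PL (psconj_comp _ P1) /conj_graph rho0E.
by rewrite (pscompA _ (mconj_pointed P1) (@pointed_sw R p)).
Qed.

Variables (D D' : submanifold R p).
Hypotheses (hD : admissible D) (hD' : admissible D').
Hypothesis EM : sub_Mhat D' = sub_Mhat D.

Lemma Mhat_sig : sub_sig D' = sub_sig D /\ forall j, sub_lam D' j = sub_lam D j.
Proof.
have muE j : sub_lam D' j ^+ 2 = sub_lam D j ^+ 2 \/ sub_lam D' j ^+ 2 = sub_lam D j ^- 2.
  by left; rewrite -(adm_M0 hD) -(adm_M0 hD') EM.
split; first exact/esym/(mu_sig (adm_params hD) (adm_params hD') muE).
exact: (mu_lam (adm_params hD) (adm_params hD') muE).
Qed.

Lemma Mhat_Lhat : sub_Lhat D' = sub_Lhat D.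
Proof.
have [_ lE] := Mhat_sig; apply/funext => j; apply: sqrt_uniq.
- by rewrite -[LHS](adm_sq hD') -[RHS](adm_sq hD) EM.
- by rewrite (adm_L0 hD') (adm_L0 hD) lE.
by rewrite (adm_L0 hD') (lam_neq0 (adm_params hD')).
Qed.

Lemma classification Phi : normal_form D Phi -> normal_form D' Phi ->
  formally_equivalent (sub_E D) (sub_E D').
Proof.
move=> /(normal_form_data hD)[psi [G [kf nf]]] /(normal_form_data hD')[psi' [G' [kf' nf']]].
have [sgE _] := Mhat_sig; have EL := Mhat_Lhat.
have SE : strG hD' = strG hD.
  apply: germ_inj; have -> : gmap (strG hD') = straighten (sub_Lhat D') by exact: erefl.
  by rewrite EL.
have TE k : tauhG hD' k = tauhG hD k by rewrite /tauhG SE.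
have PE : (psi' ^ strG hD')%g = (psi ^ strG hD)%g.
  by apply: germ_inj; rewrite -(nf_Phi nf) -(nf_Phi nf').
have kfI := nf_inj nf; have kfI' := nf_inj nf'.
have fam := nf_family nf; have fam' := nf_family nf'.
pose s j := invF kfI' (kf j); pose s' j := invF kfI (kf' j).
have [Q QE] : exists Q, Q = (psi ^ strG hD)%g by eexists.
have E1 j : (G * tauG hD j * G^-1 = Q * tauhG hD (kf j) * Q^-1)%g.
  by rewrite (fam j) mulgK QE.
have E2 j : (G' * tauG hD' j * G'^-1 = Q * tauhG hD (kf' j) * Q^-1)%g.
  by rewrite (fam' j) mulgK TE PE QE.
apply: (@transition_equivalence _ _ hD hD' (G'^-1 * G)%g s s').
- have a1 := nf_anti nf; have a2 := nf_anti nf'; rewrite sgE rho0E rhoE in a2.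
  rewrite rho0E rhoE in a1.
  have rK := rhK (adm_sum hD).
  move/(conj_anti_germ (@swK p) rK): a1 => a1; move/(conj_anti_germ (@swK p) rK): a2 => a2.
  apply/(conj_antiE (@swK p))/(conj_anti_germ (@swK p) (@swK p)).
  rewrite -mulgA a1 gconjM; apply: (mulgI G'); rewrite mulVKg !mulgA a2.
  have gV : (gconj G' * gconj (G'^-1) = 1)%g by rewrite -gconjM mulgV gconj1.
  by rewrite -(mulgA _ (gconj G')) gV mulg1.
- move=> j; apply: (mulgI G'); apply: (mulIg (G^-1)%g).
  rewrite !mulgA mulgV mul1g mulgK E1.
  have sE : kf j = kf' (s j) by rewrite /s f_invF.
  by rewrite sE -(E2 (s j)).
move=> j; rewrite invMg invgK; apply: (mulgI G); apply: (mulIg (G'^-1)%g).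
rewrite !mulgA mulgV mul1g mulgK E2.
have sE : kf' j = kf (s' j) by rewrite /s' f_invF.
by rewrite sE -(E1 (s' j)).
Qed.

End Classification.

(** * Convergent power series *)

Section Convergence.
Variable R : realType.
Local Notation C := R[i].

Section Norm.
Variable n : nat.
Implicit Types (f g : series R n) (r s t : C) (d : nat).

Definition psnorm d r f : C := \sum_(m : 'X_{1..n < d}) `|f m| * r ^+ mdeg m.

Lemma psnorm_ge0 d r f : 0 <= r -> 0 <= psnorm d r f.
Proof. by move=> r0; apply: sumr_ge0 => m _; rewrite mulr_ge0 // exprn_ge0. Qed.

Lemma psnorm_eqd d r f g : eqd d f g -> psnorm d r f = psnorm d r g.
Proof. by move=> fg; apply: eq_bigr => m _; rewrite fg // bmdeg. Qed.

Lemma psnormD d r f g : 0 <= r -> psnorm d r (f + g) <= psnorm d r f + psnorm d r g.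
Proof.
move=> r0; rewrite -big_split; apply: ler_sum => m _ /=; rewrite -mulrDl.
by apply: ler_wpM2r; [exact: exprn_ge0|rewrite psaddE; exact: ler_normD].
Qed.

Lemma psnormZ d r (c : C) f : psnorm d r (c *: f) = `|c| * psnorm d r f.
Proof. by rewrite mulr_sumr; apply: eq_bigr => m _; rewrite pszE normrM mulrA. Qed.

Lemma psnorm_conj d r f : psnorm d r (psconj f) = psnorm d r f.
Proof. by apply: eq_bigr => m _; rewrite psconjE norm_conjC. Qed.

Lemma psmul_coef_lt d f g m : (mdeg m < d)%N -> (f * g) m =
  \sum_(k : 'X_{1..n < d, d} | m == (k.1 + k.2)%MM) f k.1 * g k.2.
Proof.
move=> md; rewrite -psmulE -(mcoeffM_agree (leqnn _) (@agree_trunc _ _ _ f) (@agree_trunc _ _ _ g)).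
apply: (etrans (mcoeff_poly_mul (trunc _ f) (trunc _ g) md)); apply: eq_bigr => -[a b] /= /eqP E.
by rewrite !truncE // E mdegD ?leq_addr ?leq_addl.
Qed.

(** The right-hand side expands over all pairs of exponents; those of total degree at least d are a
    nonnegative surplus. *)
Lemma psnormM d r f g : 0 <= r -> psnorm d r (f * g) <= psnorm d r f * psnorm d r g.
Proof.
move=> r0; pose w (k : 'X_{1..n < d, d}) := (`|f k.1| * r ^+ mdeg k.1) * (`|g k.2| * r ^+ mdeg k.2).
have w0 k : 0 <= w k by rewrite !mulr_ge0 ?exprn_ge0.
have -> : psnorm d r f * psnorm d r g = \sum_k w k.
  by rewrite /psnorm big_distrlr /= pair_bigA.
have S1 : psnorm d r (f * g) <=
    \sum_(m : 'X_{1..n < d}) \sum_(k : 'X_{1..n < d, d}) (if val m == (k.1 + k.2)%MM then w k else 0).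
  apply: ler_sum => m _; rewrite (@psmul_coef_lt d) ?bmdeg // -big_mkcond /=.
  apply: (@le_trans _ _ ((\sum_(k : 'X_{1..n < d, d} | val m == (k.1 + k.2)%MM) `|f k.1 * g k.2|) * r ^+ mdeg m)).
    by apply: ler_wpM2r; [exact: exprn_ge0|exact: ler_norm_sum].
  rewrite mulr_suml; apply: ler_sum => k /eqP ->.
  by rewrite /w normrM mdegD exprD mulrACA.
apply: (le_trans S1); rewrite exchange_big; apply: ler_sum => k _.
case: (ltnP (mdeg (k.1 + k.2)%MM) d) => [kd|kd].
  rewrite (@bsum1 _ _ _ _ (fun m => if m == (k.1 + k.2)%MM then w k else 0) kd) ?eqxx //.
  by move=> b /negbTE ->.
rewrite big1 // => m _; case: eqP => // E.
by have := bmdeg m; rewrite -[X in (mdeg X < _)%N]/(val m) E ltnNge kd.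
Qed.

Lemma psnorm1 d r : psnorm d r 1 <= 1.
Proof.
case: d => [|d]; first by rewrite /psnorm big1 ?ler01 // => m; have := bmdeg m.
rewrite /psnorm (@bsum1 _ _ _ 0%MM (fun m => `|(1 : series R n) m| * r ^+ mdeg m)) ?mdeg0 //.
  by rewrite ps1E eqxx normr1 ?mdeg0 expr0 mulr1.
by move=> b /negbTE b0; rewrite ps1E b0 normr0 mul0r.
Qed.

Lemma psnorm_psX d r i : 0 <= r -> psnorm d r (psX R i) <= r.
Proof.
move=> r0; case: (ltnP 1 d) => [d1|d1].
  rewrite /psnorm (@bsum1 _ _ _ U_(i)%MM (fun m => `|psX R i m| * r ^+ mdeg m)) ?mdeg1 //.
    by rewrite psX_coef eqxx normr1 ?mdeg1 expr1 mul1r.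
  by move=> b /negbTE b0; rewrite psX_coef b0 normr0 mul0r.
rewrite /psnorm big1 // => m _; rewrite psX_coef; case: eqP => [E|]; last by rewrite normr0 mul0r.
by have := leq_trans (bmdeg m) d1; rewrite E mdeg1.
Qed.

Lemma psnormX d r f e : 0 <= r -> psnorm d r (f ^+ e) <= psnorm d r f ^+ e.
Proof.
move=> r0; elim: e => [|e IH]; first by rewrite !expr0 psnorm1.
rewrite !exprS; apply: le_trans (psnormM _ _ _ r0) _.
by apply: ler_wpM2l; rewrite ?psnorm_ge0.
Qed.

Lemma psnorm_shrink k d r t f : 0 <= r -> 0 <= t <= 1 -> eqd k f 0 ->
  psnorm d (r * t) f <= t ^+ k * psnorm d r f.
Proof.
move=> r0 /andP[t0 t1] fk; rewrite mulr_sumr; apply: ler_sum => m _.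
case: (ltnP (mdeg m) k) => [/fk ->|km]; first by rewrite ps0E normr0 !mul0r mulr0.
rewrite exprMn mulrA [leRHS]mulrC; apply: ler_wpM2l; last exact: ler_wiXn2l.
by rewrite mulr_ge0 // exprn_ge0.
Qed.

Lemma psnorm_trunc d r f :
  psnorm d.+1 r (fun m => if (mdeg m < d)%N then f m else 0) = psnorm d r f.
Proof.
rewrite /psnorm (@bsum_widen _ _ d _
  (fun m => `|if (mdeg m < d)%N then f m else 0| * r ^+ mdeg m)) //.
  by apply: eq_bigr => m _; rewrite bmdeg.
by move=> a; rewrite leqNgt => /negbTE ->; rewrite normr0 mul0r.
Qed.

End Norm.

Lemma psnorm_prod k (I : Type) (q : seq I) (F : I -> series R k) (s : I -> C) d r :
  0 <= r -> (forall i, psnorm d r (F i) <= s i) ->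
  psnorm d r (\prod_(i <- q) F i) <= \prod_(i <- q) s i.
Proof.
move=> r0 Fs; elim: q => [|i q IH]; first by rewrite !big_nil psnorm1.
rewrite !big_cons; apply: le_trans (psnormM _ _ _ r0) _.
by apply: ler_pM => //; apply: psnorm_ge0.
Qed.

Lemma psnorm_comp k n (f : series R n) (G : formal_map R k n) d r s :
  pointed G -> 0 <= r -> (forall i, psnorm d r (G i) <= s) ->
  psnorm d r (pscomp f G) <= psnorm d s f.
Proof.
move=> G0 r0 Gs.
apply: (@le_trans _ _ (\sum_(a : 'X_{1..n < d}) `|f a| * psnorm d r (mono G a))); last first.
  apply: ler_sum => a _; apply: ler_wpM2l => //.
  have -> : s ^+ mdeg a = \prod_(i < n) s ^+ (a : 'X_{1..n}) i by rewrite mdegE expr_sum.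
  apply: psnorm_prod => // i; apply: le_trans (psnormX _ _ _ r0) _.
  by apply: lerXn2r; rewrite ?nnegrE ?psnorm_ge0 // (le_trans _ (Gs i)) ?psnorm_ge0.
apply: (@le_trans _ _ (\sum_(m : 'X_{1..k < d}) \sum_(a : 'X_{1..n < d})
    `|f a| * (`|mono G a m| * r ^+ mdeg m))).
  apply: ler_sum => m _; rewrite (pscompE _ G0 (bmdeg m)).
  apply: (@le_trans _ _ ((\sum_(a : 'X_{1..n < d}) `|f a * mono G a m|) * r ^+ mdeg m)).
    by apply: ler_wpM2r; [exact: exprn_ge0|exact: ler_norm_sum].
  by rewrite mulr_suml; apply: ler_sum => a _; rewrite normrM mulrA.
by rewrite exchange_big; apply: ler_sum => a _; rewrite -mulr_sumr.
Qed.

Section Closure.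
Variable n : nat.
Implicit Types (f g : series R n).

Lemma convergent_family q (F : 'I_q -> series R n) : (forall i, convergent (F i)) ->
  exists2 r : C, 0 < r & exists2 B : C, 0 < B & forall i d, psnorm d r (F i) <= B.
Proof.
move=> cF; have [|r rP] := @boolp.choice _ _ (fun i (rB : C * C) =>
    0 < rB.1 /\ forall d, psnorm d rB.1 (F i) <= rB.2).
  by move=> i; have [r r0 [B HB]] := cF i; exists (r, B).
have r0 i : 0 < (r i).1 by case: (rP i).
have B0 i : 0 <= (r i).2.
  by have [_ /(_ 0%N)] := rP i; apply: le_trans; apply: psnorm_ge0; apply: ltW.
(* The order on [R[i]] is partial, so no minimum of the radii is taken: t_i is at most 1 and at most
   r_i, and the product of the t_i is then at most each r_i. *)
pose t i := (r i).1 / (1 + (r i).1).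
have s0 i : 0 < 1 + (r i).1 by rewrite addr_gt0 ?ltr01.
have t0 i : 0 < t i by rewrite divr_gt0.
have t1 i : t i <= 1 by rewrite ler_pdivrMr // mul1r lerDr ler01.
have tr i : t i <= (r i).1 by rewrite ler_pdivrMr // mulrDr mulr1 lerDl mulr_ge0 // ltW.
exists (\prod_i t i); first by apply: prodr_gt0.
exists (1 + \sum_i (r i).2); first by rewrite ltr_wpDr ?ltr01 // sumr_ge0.
move=> i d; have [_ /(_ d) H] := rP i.
apply: (@le_trans _ _ (r i).2); last first.
  rewrite (bigD1 i) //= addrCA lerDl addr_ge0 ?ler01 // sumr_ge0 //.
apply: le_trans H; apply: ler_sum => m _; apply: ler_wpM2l => //.
apply: lerXn2r; rewrite ?nnegrE ?prodr_ge0 //; try by [exact: ltW|move=> j _; exact: ltW].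
rewrite (bigD1 i) //=; apply: le_trans (tr i); rewrite ler_piMr ?(ltW (t0 i)) //.
by apply: prodr_ile1 => j _; rewrite t1 ltW.
Qed.

Lemma convergent_small q (F : 'I_q -> series R n) s : (forall i, convergent (F i)) ->
  (forall i, F i 0%MM = 0) -> 0 < s ->
  exists2 r : C, 0 < r & forall i d, psnorm d r (F i) <= s.
Proof.
move=> cF F0 s0; have [r r0 [B B0 H]] := convergent_family cF.
have sB : 0 < s + B by rewrite addr_gt0.
(* The factor t = s / (s + B) is at most 1 and satisfies t B <= s. *)
exists (r * (s / (s + B))); first by rewrite mulr_gt0 ?divr_gt0.
move=> i d; apply: le_trans (@psnorm_shrink _ 1 _ _ _ _ (ltW r0) _ _) _.
- apply/andP; split; first by apply: divr_ge0; apply: ltW.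
  by rewrite ler_pdivrMr // mul1r lerDl; apply: ltW.
- exact/eqd1.
rewrite expr1 mulrAC ler_pdivrMr //; apply: ler_wpM2l; first exact: ltW.
by apply: le_trans (H i d) _; rewrite lerDr ltW.
Qed.

Lemma convergent_pair f g : convergent f -> convergent g ->
  exists2 r : C, 0 < r & exists2 B : C, 0 < B &
    forall d, psnorm d r f <= B /\ psnorm d r g <= B.
Proof.
move=> cf cg; have [|r r0 [B B0 H]] := @convergent_family 2 (fun i => if i == 0 then f else g).
  by move=> i; case: ifP.
exists r => //; exists B => // d; have := H 0 d; have := H 1 d; rewrite eqxx.
by split.
Qed.

Lemma convergentD f g : convergent f -> convergent g -> convergent (f + g).
Proof.
move=> cf cg; have [r r0 [B B0 H]] := convergent_pair cf cg; exists r => //; exists (B + B) => d.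
have [Hf Hg] := H d; apply: le_trans (psnormD _ _ _ (ltW r0)) _; exact: lerD.
Qed.

Lemma convergentM f g : convergent f -> convergent g -> convergent (f * g).
Proof.
move=> cf cg; have [r r0 [B B0 H]] := convergent_pair cf cg; exists r => //; exists (B * B) => d.
have [Hf Hg] := H d; apply: le_trans (psnormM _ _ _ (ltW r0)) _.
by apply: ler_pM => //; apply: psnorm_ge0; apply: ltW.
Qed.

Lemma convergentZ (c : C) f : convergent f -> convergent (c *: f).
Proof.
move=> [r r0 [B H]]; exists r => //; exists (`|c| * B) => d.
by have := psnormZ d r c f; rewrite /psnorm => ->; apply: ler_wpM2l => //; apply: H.
Qed.

Lemma convergent1 : convergent (1 : series R n).
Proof. by exists 1; [exact: ltr01|exists 1 => d; exact: psnorm1]. Qed.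

Lemma convergent_psX i : convergent (psX R i : series R n).
Proof. by exists 1; [exact: ltr01|exists 1 => d; apply: psnorm_psX; exact: ler01]. Qed.

Lemma convergentN f : convergent f -> convergent (- f).
Proof. by move=> cf; rewrite -scaleN1r; apply: convergentZ. Qed.

Lemma convergentB f g : convergent f -> convergent g -> convergent (f - g).
Proof. by move=> cf cg; apply: convergentD => //; apply: convergentN. Qed.

Lemma convergent0 : convergent (0 : series R n).
Proof. by rewrite -(scale0r 1); apply/convergentZ/convergent1. Qed.

Lemma convergent_sum (I : Type) (q : seq I) (P : pred I) (F : I -> series R n) :
  (forall i, convergent (F i)) -> convergent (\sum_(i <- q | P i) F i).
Proof.
move=> cF; elim/big_rec: _ => [|i x _ cx]; first exact: convergent0.
exact: convergentD.
Qed.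

Lemma convergent_conj f : convergent f -> convergent (psconj f).
Proof.
move=> [r r0 [B H]]; exists r => //; exists B => d.
have := psnorm_conj d r f; rewrite /psnorm => ->; exact: H.
Qed.

Lemma convergent_hipart f : convergent f -> convergent (hipart f).
Proof.
move=> cf; apply: convergentB; first apply: convergentB => //.
  exact/convergentZ/convergent1.
by apply: convergent_sum => i; apply/convergentZ/convergent_psX.
Qed.

End Closure.

Lemma convergent_comp k n (f : series R n) (G : formal_map R k n) :
  convergent f -> pointed G -> mconvergent G -> convergent (pscomp f G).
Proof.
move=> [s s0 [B H]] G0 cG; have [r r0 Hr] := convergent_small cG G0 s0.
exists r => //; exists B => d; apply: le_trans (H d); apply: psnorm_comp => //.
exact: ltW.
Qed.

(* If the coefficients of degree < d of G are bounded, on a small polydisc, by a small s,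
   so are those of degree d, since the f_i are quadratically small. *)
Lemma convergent_fixpoint k n (G l : formal_map R k n) (f : formal_map R n n) :
  pointed G -> mconvergent l -> pointed l -> mconvergent f -> (forall i, eqd 2 (f i) 0) ->
  (forall i m, `|G i m| <= `|l i m| + `|pscomp (f i) G m|) -> mconvergent G.
Proof.
move=> G0 cl l0 cf f2 HG; have [s0 s0_gt [B B0 Hf]] := convergent_family cf.
(* With t = s0 / b and s = s0 t = t^2 b, the order 2 of f bounds its norm at radius s by t^2 B, at
   most s / 2 because 2 B <= b. The other half is left to l. *)
pose b := s0 + 2 * B; have b0 : 0 < b by rewrite addr_gt0 // mulr_gt0.
pose t := s0 / b; have t0 : 0 < t by rewrite divr_gt0.
pose s := s0 * t; have s_gt : 0 < s by rewrite mulr_gt0.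
have fs i d : psnorm d s (f i) <= s / 2.
  apply: le_trans (@psnorm_shrink _ 2 _ _ _ _ (ltW s0_gt) _ (f2 i)) _.
    rewrite (ltW t0) /= ler_pdivrMr // mul1r lerDl; apply: mulr_ge0; [exact: ler0n|exact: ltW].
  apply: (@le_trans _ _ (t ^+ 2 * B)).
    by apply: ler_wpM2l; [apply: exprn_ge0; exact: ltW|exact: Hf].
  have sE : s = t ^+ 2 * b by rewrite /s /t expr2 -mulrA (divfK (lt0r_neq0 b0)) mulrC.
  rewrite ler_pdivlMr ?ltr0n // sE -mulrA; apply: ler_wpM2l; first by apply: exprn_ge0; apply: ltW.
  by rewrite /b mulrC lerDr; apply: ltW.
have s2 : 0 < s / 2 by rewrite divr_gt0.
have [r r0 Hl] := convergent_small cl l0 s2; have r0' := ltW r0.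
have main d : forall i, psnorm d r (G i) <= s.
  elim: d => [|d IH] i.
    rewrite /psnorm big1 ?(ltW s_gt) // => m; have := bmdeg m.
    by [].
  (* Up to degree d, f_i o G only involves G below degree d, because f_i has order 2; the induction
     hypothesis bounds that part. *)
  pose H : formal_map R k n := fun i m => if (mdeg m < d)%N then G i m else 0.
  have H0 : pointed H by move=> l'; rewrite /H G0; case: ifP.
  have GH : eqd d.+1 (pscomp (f i) G) (pscomp (f i) H).
    by apply: eqd_compr2 => // l' m md; rewrite /H md.
  apply: (@le_trans _ _ (psnorm d.+1 r (l i) + psnorm d.+1 r (pscomp (f i) G))).
    rewrite -big_split; apply: ler_sum => m _ /=; rewrite -mulrDl.
    by apply: ler_wpM2r; [exact: exprn_ge0|exact: HG].
  rewrite [leRHS]splitr.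
  apply: lerD; first exact: Hl.
  rewrite (psnorm_eqd _ GH); apply: le_trans (fs i d.+1).
  by apply: psnorm_comp => // l'; rewrite psnorm_trunc.
by move=> i; exists r => //; exists s => d; apply: main.
Qed.

End Convergence.

(** * Convergence of inverses, square roots and logarithms *)

Section ConvergentInverse.
Variable R : realType.
Local Notation C := R[i].

(** The inverse Y solves Y = J^-1 (id - hipart F o Y), an equation of the type controlled by
    [convergent_fixpoint]. *)
Lemma minv_convergent n (F : formal_map R n n) :
  biholo F -> mconvergent F -> mconvergent (minv F).
Proof.
move=> bF cF; have [F0 uJ] := bF; have Y0 := pointed_minv bF.
have FY := mcompKV bF; move: (minv F) Y0 FY => Y Y0 FY; pose K := invmx (jacobian0 F).
pose l : formal_map R n n := fun k => \sum_i K k i *: psX R i.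
pose f : formal_map R n n := fun k => - \sum_i K k i *: hipart (F i).
have YE k : Y k = l k + pscomp (f k) Y.
  have E i : \sum_j F i U_(j)%MM *: Y j = psX R i - pscomp (hipart (F i)) Y.
    have := congr1 (fun G : formal_map R n n => G i) FY.
    rewrite mcompE (pscomp_split _ Y0) F0 scale0r add0r -[mid i]/(psX R i) => <-.
    by rewrite addrK.
  rewrite /l /f (pscompN _ Y0) (pscomp_sum _ _ _ Y0) -sumrB.
  transitivity (\sum_i K k i *: \sum_j F i U_(j)%MM *: Y j).
    under eq_bigr do rewrite scaler_sumr; rewrite exchange_big /=.
    have KJ j : \sum_i K k i * F i U_(j)%MM = (k == j)%:R.
      have := congr1 (fun A : 'M_n => A k j) (mulVmx uJ); rewrite !mxE => <-.
      by apply: eq_bigr => i _; rewrite mxE.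
    rewrite (bigD1 k isT) /= [X in _ + X]big1 => [|j /negbTE jk]; last first.
      by under eq_bigr do rewrite scalerA; rewrite -scaler_suml KJ eq_sym jk scale0r.
    by under eq_bigr do rewrite scalerA; rewrite -scaler_suml KJ eqxx scale1r addr0.
  by apply: eq_bigr => i _; rewrite E scalerBr (pscompZ _ _ Y0).
apply: (convergent_fixpoint (l := l) (f := f) Y0).
- by move=> k; apply: convergent_sum => i; apply/convergentZ/convergent_psX.
- by move=> k; rewrite /l pssumE big1 // => i _; rewrite pszE psX0 mulr0.
- move=> k; apply/convergentN/convergent_sum => i.
  exact/convergentZ/convergent_hipart.
- move=> k m md; rewrite /f psoppE pssumE big1 => [|i _]; first by rewrite oppr0.
  by rewrite pszE (@hipart_ord _ _ (F i) m md) mulr0.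
move=> k m; rewrite {1}YE psaddE; exact: ler_normD.
Qed.

Lemma square_expansion (A : comNzRingType) (y q : A) :
  (y + q) * (y + q) - q * q - y ^+ 2 = q * y + q * y.
Proof. by ring. Qed.

(** y = a - a(0) satisfies y = l - y^2 / (2 a(0)), with l built from a^2; this is quadratic in y, so
    [convergent_fixpoint] applies. *)
Lemma sqrt_convergent n (a : series R n) :
  a 0%MM != 0 -> convergent (a * a) -> convergent a.
Proof.
move=> a0 ca; set a' := a 0%MM in a0; have b0 : 2 * a' != 0 by rewrite mulf_neq0 ?pnatr_eq0.
pose y := a - a'%:A; have y0 : y 0%MM = 0.
  by rewrite /y psaddE psoppE pszE ps1E eqxx mulr1 subrr.
have ay : a = y + a'%:A by rewrite /y subrK.
pose l : series R n := (2 * a')^-1 *: (a * a - a'%:A * a'%:A).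
pose f : series R 1 := - ((2 * a')^-1 *: psX R 0 ^+ 2).
have P : pointed (fun _ : 'I_1 => y) by [].
have fE : pscomp f (fun _ => y) = - ((2 * a')^-1 *: y ^+ 2).
  by rewrite /f (pscompN _ P) (pscompZ _ _ P) (pscompXn _ _ P) (pscomp_psX _ P).
have yE : y = l + pscomp f (fun _ => y).
  rewrite fE /l -scalerN -scalerDr {1 2}ay square_expansion mulr_algl -mulr2n.
  by rewrite scalerMnl -(mulr_natl a' 2) scalerA mulVf // scale1r.
rewrite ay; apply: convergentD; last exact/convergentZ/convergent1.
have := @convergent_fixpoint R n 1 (fun _ => y) (fun _ => l) (fun _ => f) P.
move=> H; apply: (H _ _ _ _ _ 0).
- move=> _; apply/convergentZ/convergentB => //.
  by apply: convergentM; apply/convergentZ/convergent1.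
- by move=> _; rewrite /l pszE psaddE psoppE !psmul0 pszE ps1E eqxx mulr1 subrr mulr0.
- move=> _; apply/convergentN/convergentZ; rewrite expr2; apply: convergentM; exact: convergent_psX.
- move=> _ m md; have e2 : eqd 2 (psX R (0 : 'I_1) ^+ 2) 0.
    by rewrite expr2; apply: (@eqd0M _ _ 1 1); apply/eqd1; apply: psX0.
  by rewrite /f psoppE pszE (e2 m md) mulr0 oppr0.
by move=> _ m; rewrite {1}yE psaddE; exact: ler_normD.
Qed.

Lemma inverse_expansion (A : comNzRingType) (x y c v : A) :
  c * v = 1 -> (c + x) * (v + y) = 1 -> y = - (v * v) * x + - v * (x * y).
Proof.
move=> cv H; have E : c * y = - (x * v) - x * y.
  have -> : c * y = (c + x) * (v + y) - c * v - x * v - x * y by ring.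
  by rewrite H cv subrr sub0r.
have Ey : y = v * (c * y) by rewrite mulrA (mulrC v) cv mul1r.
by rewrite {1}Ey E; ring.
Qed.

(** The deviations x of f and y of 1/f from their constant terms satisfy y = - v^2 x - v x y with v
    = 1 / f(0). The last term involves x too, so the fixpoint lemma is applied to the pair (x, y),
    with x = x as first equation. *)
Lemma psinv_convergent n (f : series R n) :
  f 0%MM != 0 -> convergent f -> convergent (psinv f).
Proof.
move=> f0 cf; set c := f 0%MM in f0; pose x := f - c%:A; pose y := psinv f - c^-1%:A.
have x0 : x 0%MM = 0 by rewrite /x psaddE psoppE pszE ps1E eqxx mulr1 subrr.
have y0 : y 0%MM = 0.
  by rewrite /y psaddE psoppE pszE ps1E eqxx mulr1 (psinv0 f0) subrr.
have cv : c%:A * c^-1%:A = 1 :> series R n by rewrite -scalerAl mul1r scalerA divff ?scale1r.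
have yE0 : y = - (c^-1%:A * c^-1%:A) * x + - c^-1%:A * (x * y).
  apply: (inverse_expansion cv); rewrite /x /y addrC subrK addrC subrK.
  exact: mulpsV f0.
pose G (i : 'I_2) := if i == 0 then x else y.
pose l (i : 'I_2) := if i == 0 then x else - (c^-1%:A * c^-1%:A) * x.
pose h (i : 'I_2) : series R 2 := if i == 0 then 0 else - c^-1%:A * (psX R 0 * psX R 1).
have cc (k : C) q : convergent (k%:A : series R q) by apply/convergentZ/convergent1.
have cx : convergent x by apply: convergentB.
have P : pointed G by move=> i; rewrite /G; case: (i == 0).
have hE : pscomp (- c^-1%:A * (psX R 0 * psX R 1)) G = - c^-1%:A * (x * y).
  rewrite (pscompM _ _ P) (pscompN _ P) (pscompZ _ _ P) (pscomp1 P) (pscompM _ _ P).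
  by rewrite !(pscomp_psX _ P).
have cG : mconvergent G.
  apply: (convergent_fixpoint (l := l) (f := h) P).
  - move=> i; rewrite /l; case: (i == 0) => //.
    by apply: convergentM => //; apply/convergentN/convergentM.
  - by move=> i; rewrite /l; case: (i == 0) => //; rewrite psmul0 x0 mulr0.
  - move=> i; rewrite /h; case: (i == 0); first exact: convergent0.
    by apply: convergentM; [apply: convergentN|apply: convergentM; apply: convergent_psX].
  - move=> i; rewrite /h; case: (i == 0); first exact: eqd_refl.
    rewrite -[2%N]/(0 + (1 + 1))%N; apply: eqd0M; first exact: eqd0_any.
    by apply: eqd0M; apply/eqd1; apply: psX0.
  move=> i m; rewrite /l /h /G; case: (i == 0); first by rewrite lerDl.
  by rewrite hE {1}yE0 psaddE; exact: ler_normD.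
have -> : psinv f = y + c^-1%:A by rewrite /y subrK.
by apply: convergentD => //; have := cG 1.
Qed.

Lemma sum_half_le (d : nat) : \sum_(0 <= k < d) (2^-1 : C) ^+ k <= 2.
Proof.
have -> : \sum_(0 <= k < d) (2^-1 : C) ^+ k = 2 - 2 * 2^-1 ^+ d.
  elim: d => [|d IH]; first by rewrite big_nil expr0 mulr1 subrr.
  rewrite big_nat_recr //= IH exprS; field; exact: isT.
by rewrite gerBl mulr_ge0 ?exprn_ge0 ?invr_ge0 ?ler0n.
Qed.

Lemma psnorm_sum n (I : Type) (q : seq I) (F : I -> series R n) d r : 0 <= r ->
  psnorm d r (\sum_(i <- q) F i) <= \sum_(i <- q) psnorm d r (F i).
Proof.
move=> r0; elim: q => [|i q IH].
  by rewrite !big_nil /psnorm big1 // => m _; rewrite ps0E normr0 mul0r.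
by rewrite !big_cons; apply: le_trans (psnormD _ _ _ r0) _; apply: lerD.
Qed.

Lemma norm_log_coef k : `|log_coef R k| <= 1.
Proof.
case: k => [|k]; first by rewrite /log_coef normr0 ler01.
rewrite /log_coef normrM normrX normrN1 expr1n mul1r normfV normr_nat.
by rewrite invf_le1 ?ltr0n // ler1n.
Qed.

(** On a polydisc where u = f / f(0) - 1 has norm at most 1/2, the Mercator series is dominated by a
    geometric one whose partial sums are at most 2. *)
Lemma pslog_convergent n (f : series R n) :
  f 0%MM != 0 -> convergent f -> convergent (pslog f).
Proof.
move=> f0 cf; pose u := (f 0%MM)^-1 *: f - 1.
have u0 : u 0%MM = 0 by rewrite /u psaddE psoppE pszE ps1E eqxx mulVf ?subrr.
have cu : convergent u by apply: convergentB; [exact: convergentZ|exact: convergent1].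
have h0 : 0 < 2^-1 :> C by rewrite invr_gt0 ltr0n.
have [|//|r r0 H] := @convergent_small R n 1 (fun=> u) _ _ _ h0; first by [].
have r0' := ltW r0; exists r => //; exists 2 => d.
rewrite -/(psnorm d r (pslog f)) (psnorm_eqd r (@pslog_eqd _ _ f d f0)).
apply: le_trans (psnorm_sum _ _ _ r0') _; apply: le_trans (sum_half_le d).
apply: ler_sum => k _; rewrite psnormZ -[leRHS]mul1r; apply: ler_pM => //.
- exact: psnorm_ge0.
- exact: norm_log_coef.
apply: le_trans (psnormX _ _ _ r0') _; apply: lerXn2r; rewrite ?nnegrE ?psnorm_ge0 ?(ltW h0) //.
exact: (H 0).
Qed.

Lemma bsum_inj_le n n' d d' (h : 'X_{1..n} -> 'X_{1..n'}) (F : 'X_{1..n'} -> C) :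
  injective h -> (forall m, (mdeg m < d)%N -> (mdeg (h m) < d')%N) ->
  (forall m, 0 <= F m) ->
  \sum_(m : 'X_{1..n < d}) F (h m) <= \sum_(m : 'X_{1..n' < d'}) F m.
Proof.
move=> h_inj hd F0.
have -> : \sum_(m : 'X_{1..n < d}) F (h m) =
    \sum_(m : 'X_{1..n < d}) \sum_(a : 'X_{1..n' < d'}) (if val a == h m then F a else 0).
  apply: eq_bigr => m _.
  rewrite (@bsum1 _ _ _ (h m) (fun a => if a == h m then F a else 0)) ?eqxx //.
    exact/hd/bmdeg.
  by move=> b /negbTE ->.
rewrite exchange_big; apply: ler_sum => a _ /=.
case: (pselect (exists m : 'X_{1..n < d}, val a = h m)) => [[m0 E]|H].
  rewrite (bigD1 m0 isT) /= {1}E eqxx big1 => [|m mm]; first by rewrite addr0.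
  case: eqP => [E2|_]; last exact: erefl.
  by move: mm; rewrite (_ : m = m0) ?eqxx //; apply/val_inj/h_inj; rewrite -E -E2.
by rewrite big1 // => m _; case: eqP => // E; case: H; exists m.
Qed.

Lemma convergent_factorX n (f : series R n) i : convergent (f * psX R i) -> convergent f.
Proof.
move=> [r r0 [B H]]; exists r => //; exists (B / r) => d.
rewrite ler_pdivlMr // mulr_suml; apply: le_trans (H d.+1).
pose F (m : 'X_{1..n}) := `|(f * psX R i) m| * r ^+ mdeg m.
apply: le_trans (@bsum_inj_le _ _ d d.+1 (fun m => m + U_(i))%MM F _ _ _).
- by apply: ler_sum => m _; rewrite /F psmulX_coef mdegD mdeg1 addn1 exprSr mulrA.
- exact: addIm.
- by move=> m md; rewrite mdegD mdeg1 addn1 ltnS.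
by move=> m; rewrite mulr_ge0 // exprn_ge0 // ltW.
Qed.

(** A monomial of degree k in zeta has degree 2k in (xi, eta), so a radius r there gives the radius
    r^2 in zeta. *)
Lemma convergent_zcomp p (f : series R p) : convergent (zcomp f) <-> convergent f.
Proof.
split=> [[r r0 [B H]]|cf]; last first.
  apply: convergent_comp cf (@pointed_xi_eta R p) _ => j; rewrite xi_etaE.
  by apply: convergentM; apply: convergent_psX.
exists (r ^+ 2); first exact: exprn_gt0.
exists B => d; apply: le_trans (H d.*2).
pose F (m : 'X_{1..p + p}) := `|zcomp f m| * r ^+ mdeg m.
apply: le_trans (@bsum_inj_le _ _ d d.*2 (@dbl p) F _ _ _).
- by apply: ler_sum => m _; rewrite /F zcomp_dbl mdeg_dbl -mul2n exprM.
- exact: dbl_inj.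
- by move=> m; rewrite mdeg_dbl ltn_double.
by move=> m; rewrite mulr_ge0 // exprn_ge0 // ltW.
Qed.

End ConvergentInverse.

(** * Convergence of the normalization *)

Section GermConvergence.
Variables (R : realType) (n : nat).
Implicit Types x y : germ R n.

Lemma gmM_convergent x y :
  mconvergent (gmap x) -> mconvergent (gmap y) -> mconvergent (gmap (x * y)%g).
Proof.
move=> cx cy i; rewrite gmM mcompE; apply: convergent_comp (cx i) (germ0 y) cy.
Qed.

Lemma gmV_convergent x : mconvergent (gmap x) -> mconvergent (gmap (x^-1)%g).
Proof. by move=> cx; rewrite gmV; apply: minv_convergent (germP x) cx. Qed.

Lemma gm1_convergent : mconvergent (gmap (1%g : germ R n)).
Proof. by move=> i; rewrite gm1; apply: convergent_psX. Qed.

Lemma pmap_convergent k (s : 'I_n -> 'I_k) : mconvergent (pmap R s).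
Proof. by move=> i; apply: convergent_psX. Qed.

Lemma anticonj_convergent (s : 'I_n -> 'I_n) (sK : involutive s) x :
  mconvergent (gmap x) -> mconvergent (gmap (anticonj sK x)).
Proof.
move=> cx i; rewrite anticonj_coef; apply: convergent_comp (@pointed_pmap _ _ _ s) _.
  exact/convergent_conj/cx.
exact: pmap_convergent.
Qed.

End GermConvergence.

Section EmapConvergence.
Variables (R : realType) (p : nat).
Implicit Types a b : 'I_p -> series R p.

Lemma emap_convergent a b : (forall j, convergent (a j)) -> (forall j, convergent (b j)) ->
  mconvergent (emap a b).
Proof.
move=> ca cb; apply: ord_lr => j; rewrite ?emapL ?emapR; apply: convergentM;
  by [apply/convergent_zcomp|apply: convergent_psX].
Qed.

Lemma convergent_of_emap a b j : mconvergent (emap a b) -> convergent (a j).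
Proof.
move=> /(_ (lshift p j)); rewrite emapL => c; apply/convergent_zcomp.
exact: convergent_factorX c.
Qed.

End EmapConvergence.

Lemma biholo_of_left_inverse (R : realType) n (F G : formal_map R n n) :
  pointed F -> mcomp G F = mid -> biholo F.
Proof.
move=> F0 GF; split; first exact: F0.
by have := jacobian0_comp G F0; rewrite GF jacobian0_mid => /esym/mulmx1_unit[].
Qed.

(** * Matching of eigenvalues *)

Section Permutation.
Variables (R : realType) (p : nat).
Local Notation C := R[i].
Variables (lam : 'I_p -> C) (M M0 : 'I_p -> series R p) (H0 : germ R (p + p)).
Hypothesis ind : independent (fun j => lam j ^+ 2).
Hypotheses (nzM : nz M) (M_0 : forall j, M j 0%MM = lam j ^+ 2) (nzM0 : nz M0).
Hypothesis HM : (H0 * torus M0 = torus M * H0)%g.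

Local Notation D := (torus_eigen (fun j => lam j ^+ 2)).
Let d : 'I_(p + p) -> C := lrfun (fun j => M0 j 0%MM) (fun j => vinv M0 j 0%MM).

Lemma eigen_sw i : D (sw i) = (D i)^-1.
Proof.
by move: i; apply: ord_lr => j; rewrite ?swL ?swR /torus_eigen ?lrfunL ?lrfunR ?invrK.
Qed.

Lemma d_sw i : d (sw i) = (d i)^-1.
Proof.
by move: i; apply: ord_lr => j; rewrite ?swL ?swR /d ?lrfunL ?lrfunR /vinv (psinv0 (nzM0 j)) ?invrK.
Qed.

Lemma torus_linear_relation i l : gmap H0 i U_(l)%MM * d l = D i * gmap H0 i U_(l)%MM.
Proof.
have := congr1 (fun x => gmap x i U_(l)%MM) HM.
rewrite (gmM H0) (gmM (torus M)) (gmtorus nzM0) (gmtorus nzM) !mcompE.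
rewrite (pscomp_linear_coef _ _ (@pointed_emap _ _ _ _)) (pscomp_linear_coef _ _ (germ0 H0)).
under eq_bigr do rewrite (eqd_dmap_coef _ _ (emap_lin _ _)).
under [in RHS]eq_bigr do rewrite (eqd_dmap_coef _ _ (emap_lin _ _)).
rewrite (bigD1 l isT) /= big1 => [|k kl]; last by rewrite eq_sym (negbTE kl) !mulr0.
rewrite (bigD1 i isT) /= [X in _ = _ + X]big1 => [|k kl]; last by rewrite (negbTE kl) mulr0 mul0r.
rewrite !eqxx !mulr1 !addr0 => ->; congr (_ * _).
by move: i; apply: ord_lr => j; rewrite /torus_eigen ?lrfunL ?lrfunR /vinv ?(psinv0 (nzM j)) M_0.
Qed.

(** An invertible Jacobian has no zero row, and a nonzero entry (i, l) forces d_l = D_i. *)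
Lemma eigenvalue_match i : exists l, d l = D i.
Proof.
have [l nl] : exists l, gmap H0 i U_(l)%MM != 0.
  apply/not_existsP => H; have [_ uJ] := germP H0.
  have := congr1 (fun A : 'M_(p + p) => A i i) (mulmxV uJ); rewrite !mxE eqxx big1 => [/eqP|l _].
    by rewrite eq_sym oner_eq0.
  by have /negP/negPn/eqP := H l; rewrite mxE => ->; rewrite mul0r.
exists l; apply: (mulfI nl); rewrite torus_linear_relation mulrC; exact: erefl.
Qed.

(** A diagonalization of sigma may list the mu_j in another order and exchange some of them with
    their inverses. The matching f commutes with [sw], since [sw] inverts eigenvalues on both sides;
    so f permutes the zeta_j and carries one torus map to another. *)
Lemma permute_eigenvalues : exists (f : 'I_(p + p) -> 'I_(p + p)) (M1 : 'I_p -> series R p),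
  [/\ injective f, nz M1, forall j, M1 j 0%MM = lam j ^+ 2
    & mcomp (pmap R f) (emap M0 (vinv M0)) = mcomp (emap M1 (vinv M1)) (pmap R f)].
Proof.
have [f fP] := boolp.choice eigenvalue_match; exists f.
have f_inj : injective f by move=> i k E; apply: (torus_eigen_inj ind); rewrite -!fP E.
have d_inj i k : d i = d k -> i = k.
  rewrite -(f_invF f_inj i) -(f_invF f_inj k) !fP => /(torus_eigen_inj ind).
  by move->.
have f_sw i : f (sw i) = sw (f i) by apply: d_inj; rewrite fP d_sw fP eigen_sw.
pose idx (i : 'I_(p + p)) : 'I_p := lrfun id id i.
have idxP i : i = lshift p (idx i) \/ i = rshift p (idx i).
  by move: i; apply: ord_lr => j; rewrite /idx ?lrfunL ?lrfunR; [left|right].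
pose ka j := idx (f (lshift p j)).
have ka_inj : injective ka.
  have sw2 i k : idx i = idx k -> i = k \/ i = sw k.
    by case: (idxP i) => ->; case: (idxP k) => ->; rewrite /idx ?lrfunL ?lrfunR => ->;
      rewrite ?swL ?swR; auto.
  have [_ [_ [lr _]]] := lrE p.
  move=> j k /sw2[/f_inj/lshift_inj //|]; rewrite -f_sw swL => /f_inj E.
  by have := lr j k; rewrite E eqxx.
pose A : 'I_(p + p) -> series R p := lrfun M0 (vinv M0).
have A_sw i : A (sw i) = psinv (A i).
  move: i; apply: ord_lr => j; rewrite ?swL ?swR /A ?lrfunL ?lrfunR; first exact: erefl.
  by rewrite /vinv (psinvK (nzM0 j)).
have A0 i : A i 0%MM = d i by move: i; apply: ord_lr => j; rewrite /A /d ?lrfunL ?lrfunR.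
pose g := invF ka_inj; have gP := @pointed_pmap R _ _ g; have fP' := @pointed_pmap R _ _ f.
pose M1 j := pscomp (A (f (lshift p j))) (pmap R g).
have M10 j : M1 j 0%MM = lam j ^+ 2.
  by rewrite /M1 (pscomp_at0 _ gP) A0 fP /torus_eigen lrfunL.
have nzA i : A i 0%MM != 0.
  by move: i; apply: ord_lr => j; rewrite /A ?lrfunL ?lrfunR; [apply: nzM0|apply: (nz_vinv nzM0)].
have nz1 : nz M1 by move=> j; rewrite /M1 (pscomp_at0 _ gP).
exists M1; split; [exact: f_inj|exact: nz1|exact: M10|].
have xf : mcomp (@xi_eta R p) (pmap R f) = mcomp (pmap R ka) (@xi_eta R p).
  rewrite (pmap_comp _ (@pointed_xi_eta R p)); apply/funext => j; rewrite mcompE !xi_etaE.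
  rewrite (pscompM _ _ fP') !(pscomp_psX _ fP') /pmap -swL f_sw.
  rewrite -/(ka j) /ka; case: (idxP (f (lshift p j))) => {1 2}->; rewrite ?swL ?swR //.
  exact: mulrC.
have zc h : pscomp (zcomp (pscomp h (pmap R g))) (pmap R f) = zcomp h.
  rewrite /zcomp (pscompA _ (@pointed_xi_eta R p) fP') xf.
  rewrite -(pscompA _ (@pointed_pmap R _ _ ka) (@pointed_xi_eta R p)) (pscompA _ gP (@pointed_pmap R _ _ ka)).
  rewrite pmap_pmap; congr pscomp; rewrite -[RHS]pscomp_mid; congr pscomp; apply/funext => j.
  by rewrite /pmap /= f_invF.
have emE i : emap M0 (vinv M0) i = zcomp (A i) * psX R i.
  by move: i; apply: ord_lr => j; rewrite ?emapL ?emapR /A ?lrfunL ?lrfunR.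
rewrite (pmap_comp _ (@pointed_emap _ _ _ _)); apply/funext => i; rewrite emE mcompE.
move: i; apply: ord_lr => j; rewrite ?emapL ?emapR (pscompM _ _ fP') (pscomp_psX _ fP').
  by rewrite /M1 zc.
rewrite /vinv /M1 -(psinv_comp gP (nzA _)) zc.
by rewrite -A_sw -f_sw swL.
Qed.

End Permutation.

Section ConvergentNormalization.
Variables (R : realType) (p : nat) (D : submanifold R p).
Hypothesis hD : admissible D.
Local Notation C := R[i].
Local Notation sg := (sub_sig D).
Local Notation lam := (sub_lam D).
Local Notation M := (sub_Mhat D).
Local Notation L := (sub_Lhat D).
Local Notation tau1h := (@tau1_hat R p L).
Local Notation s := (@swap R p).

Lemma tau1_convergent : mconvergent (gmap (tau1 hD)).
Proof.
rewrite /tau1; elim/big_rec: _ => [|j x _ cx]; first exact: gm1_convergent.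
apply: gmM_convergent cx; have [dk _ _ _] := adm_gen hD; have [c _ _] := dk j; exact: c.
Qed.

Lemma sigma_convergent : mconvergent (gmap (sigmaG hD)).
Proof.
rewrite /sigmaG -lock; apply: gmM_convergent; first exact: tau1_convergent.
exact/anticonj_convergent/tau1_convergent.
Qed.

Variable G : germ R (p + p).
Hypothesis Gt : (G * tau1 hD = tau1h * G)%g.
Hypothesis Gs : (G * sigmaG hD = torus M * G)%g.

Lemma convergent_diagonalization (Psi : formal_map R (p + p) (p + p)) (M0 : formal_map R p p) :
  mconvergent Psi -> biholo Psi ->
  mcomp Psi (sigma (sub_tau D)) = mcomp (sigma_hat M0) Psi ->
  exists (Ps : germ R (p + p)) (M1 : 'I_p -> series R p),
    [/\ mconvergent (gmap Ps), nz M1, forall j, M1 j 0%MM = lam j ^+ 2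
      & (Ps * sigmaG hD = torus M1 * Ps)%g].
Proof.
move=> cP bP E; pose Ps0 := Germ bP.
have sE : sigma_hat M0 = emap M0 (vinv M0) by exact: erefl.
(* [sigma_hat M0] is conjugate to sigma, hence invertible, which forces the constant terms of M0 to
   be nonzero. *)
have [y yE] : exists y, y = (Ps0 * sigmaG hD * Ps0^-1)%g by eexists.
have yM : gmap y = emap M0 (vinv M0).
  apply: (mcomp_injr bP); rewrite -sE -E.
  have E2 : gmap (y * Ps0)%g = gmap (Ps0 * sigmaG hD)%g by rewrite yE mulgVK.
  rewrite (gmM y) (gmM Ps0) gmsigma in E2; exact: E2.
have [nz0 _] : nz M0 /\ nz (vinv M0) by apply: biholo_emap_nz; rewrite -yM; exact: germP.
have E0 : (Ps0 * sigmaG hD = torus M0 * Ps0)%g.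
  have -> : torus M0 = y by apply: germ_inj; rewrite (gmtorus nz0) yM.
  by rewrite yE mulgVK.
have E1 : ((G * Ps0^-1) * torus M0 = torus M * (G * Ps0^-1))%g.
  have -> : torus M0 = (Ps0 * sigmaG hD * Ps0^-1)%g by rewrite E0 mulgK.
  by rewrite -!mulgA mulKg (mulgA G) Gs -!mulgA.
have [f [M1 [f_inj nz1 M10 fE]]] :=
  permute_eigenvalues (adm_ind hD) (adm_nzM hD) (adm_M0 hD) nz0 E1.
have bf : biholo (pmap R f).
  apply: (@biholo_of_left_inverse _ _ _ (pmap R (invF f_inj))); first exact: pointed_pmap.
  by rewrite pmap_pmap; apply/funext => i; rewrite /pmap /= f_invF.
pose Q := Germ bf; exists (Q * Ps0)%g, M1; split.
- apply: gmM_convergent; [exact: pmap_convergent|exact: cP].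
- exact: nz1.
- exact: M10.
have QE : (Q * torus M0 = torus M1 * Q)%g.
  apply: germ_inj; rewrite (gmM Q) (gmM (torus M1)) (gmtorus nz0) (gmtorus nz1); exact: fE.
by rewrite -mulgA E0 mulgA QE mulgA.
Qed.

Variables (Ps : germ R (p + p)) (M1 : 'I_p -> series R p).
Hypotheses (cPs : mconvergent (gmap Ps)) (nz1 : nz M1).
Hypothesis M10 : forall j, M1 j 0%MM = lam j ^+ 2.
Hypothesis Ps_sigma : (Ps * sigmaG hD = torus M1 * Ps)%g.

Lemma M1_convergent j : convergent (M1 j).
Proof.
have E : torus M1 = (Ps * sigmaG hD * Ps^-1)%g by rewrite Ps_sigma mulgK.
apply: (@convergent_of_emap _ _ _ (vinv M1)); rewrite -(gmtorus nz1) E.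
apply: gmM_convergent; last exact: gmV_convergent.
apply: gmM_convergent; [exact: cPs|exact: sigma_convergent].
Qed.

Lemma transition_sigma : ((G * Ps^-1) * torus M1 = torus M * (G * Ps^-1))%g.
Proof.
have -> : torus M1 = (Ps * sigmaG hD * Ps^-1)%g by rewrite Ps_sigma mulgK.
by rewrite -!mulgA mulKg (mulgA G) Gs -!mulgA.
Qed.

Section Transition.
Variables a b : 'I_p -> series R p.
Hypotheses (a0 : nz a) (b0 : nz b) (HE : (G * Ps^-1)%g = gemap a b).
Let c j := a j * b j.
Let T := act c.

Lemma nzc : nz c. Proof. exact: nz_vmul a0 b0. Qed.

Lemma T_M j : pscomp (M j) T = M1 j.
Proof.
have := transition_sigma; rewrite HE => E.
exact: gemap_conj_torus a0 b0 nz1 (adm_nzM hD) E j.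
Qed.

Lemma act_linear : eqdm 2 T (dmap (fun j => c j 0%MM)).
Proof.
move=> j; rewrite /T /act /dmap; apply: eqd_subr; rewrite -mulr_algl -mulrBl.
apply: (@eqd0M _ _ 1 1); last by apply/eqd1; apply: psX0.
by apply/eqd1; rewrite psaddE psoppE pszE ps1E eqxx mulr1 subrr.
Qed.

Lemma T_biholo : biholo T.
Proof. exact: eqdm_biholo (eqdm_sym act_linear) (biholo_dmap nzc). Qed.

Local Notation th := (minv T).
Let th0 : pointed th. Proof. exact: pointed_minv T_biholo. Qed.
Let T0 : pointed T. Proof. exact: pointed_act. Qed.
Let N1 := logM sg M1.
Let N := logM sg M.

Lemma th_N j : pscomp (N1 j) th = N j.
Proof.
have -> : N1 j = pscomp (N j) T.
  by rewrite /N1 /N (logM_comp _ T0 (adm_nzM hD j)) T_M logME.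
rewrite (pscompA _ T0 th0) (mcompKV T_biholo); exact: pscomp_mid.
Qed.

Lemma th_M j : pscomp (M1 j) th = M j.
Proof. rewrite -T_M (pscompA _ T0 th0) (mcompKV T_biholo); exact: pscomp_mid. Qed.

Lemma th_coef0 j (m : 'X_{1..p}) : m j = 0%N -> th j m = 0.
Proof.
move=> mj; have E := congr1 (fun F : formal_map R p p => F j) (mcompKV T_biholo).
rewrite mcompE /T /act (pscompM _ _ th0) (pscomp_psX _ th0) in E.
have c0' : pscomp (c j) th 0%MM != 0 by rewrite (pscomp_at0 _ th0); exact: nzc.
have -> : th j = psinv (pscomp (c j) th) * psX R j.
  by rewrite -[psX R j]/(mid j) -E mulrA (mulVps c0') mul1r.
exact: psmulX_coef0.
Qed.

(** N is tangent to the identity, so N1 = N o T has the linear part of T, diagonal with entries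
    c_j(0). *)
Lemma N_split j : N j = c j 0%MM *: th j + pscomp (hipart (N1 j)) th.
Proof.
have [tN _] := adm_log hD.
have N0 : N1 j 0%MM = 0.
  by rewrite -(pscomp_at0 (N1 j) th0) th_N /N tN ?mdeg0 // psX0.
have NU i : N1 j U_(i)%MM = c j 0%MM * (i == j)%:R.
  have -> : N1 j = pscomp (N j) T.
    by rewrite /N1 /N (logM_comp _ T0 (adm_nzM hD j)) T_M logME.
  rewrite (pscomp_linear_coef _ _ T0) (bigD1 j isT) /= big1 => [|k kj].
    rewrite addr0 /N tN ?mdeg1 // psX_coef eqxx mul1r.
    exact: eqd_dmap_coef act_linear.
  by rewrite /N tN ?mdeg1 // psX_coef mnmU_eq (negbTE kj) mul0r.
rewrite -th_N (pscomp_split _ th0) N0 scale0r add0r; congr (_ + _).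
rewrite (bigD1 j isT) /= big1 => [|k kj]; last by rewrite NU (negbTE kj) mulr0 scale0r.
by rewrite NU eqxx mulr1 addr0.
Qed.

(* The coefficients of th_j vanish on exponents free of zeta_j, and N_j - zeta_j vanishes on
   all the others: N drops out of the equation N = N1 o th. *)
Lemma th_convergent : mconvergent th.
Proof.
have cN1 j : convergent (N1 j).
  rewrite /N1 logME; apply/convergentZ/pslog_convergent; [exact: nz1|exact: M1_convergent].
have [_ nN] := adm_log hD.
apply: (@convergent_fixpoint _ _ _ th (fun j => (c j 0%MM)^-1 *: psX R j)
  (fun j => - ((c j 0%MM)^-1 *: hipart (N1 j))) th0).
- by move=> j; apply/convergentZ/convergent_psX.
- by move=> j; rewrite pszE psX0 mulr0.
- by move=> j; apply/convergentN/convergentZ/convergent_hipart.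
- by move=> j m md; rewrite psoppE pszE (@hipart_ord _ _ (N1 j) m md) mulr0 oppr0.
move=> j m; case: (posnP (m j)) => [mj|mj].
  by rewrite (th_coef0 mj) normr0 addr_ge0.
rewrite (pscompN _ th0) (pscompZ _ _ th0).
have E : (c j 0%MM *: th j + pscomp (hipart (N1 j)) th) m = psX R j m.
  have E3 : N j m - psX R j m = 0 by exact: nN j m mj.
  by rewrite -N_split; apply/eqP; rewrite -subr_eq0 E3 eqxx.
rewrite psaddE pszE in E.
have -> : th j m = ((c j 0%MM)^-1 *: psX R j) m +
    (- ((c j 0%MM)^-1 *: pscomp (hipart (N1 j)) th)) m.
  by rewrite psoppE !pszE -E mulrDr mulKf ?addrK //; exact: nzc.
exact: ler_normD.
Qed.

Lemma T_convergent : mconvergent T.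
Proof.
rewrite -(minvK T_biholo); apply: minv_convergent th_convergent.
exact: biholo_minv T_biholo.
Qed.

Lemma c_convergent j : convergent (c j).
Proof. exact: convergent_factorX (T_convergent j). Qed.

Lemma Lhat_convergent j : convergent (L j).
Proof.
apply: sqrt_convergent; first exact: adm_nzL.
rewrite -(adm_sq hD j) -th_M.
exact: convergent_comp (M1_convergent j) th0 th_convergent.
Qed.

Let t1 := (Ps * tau1 hD * Ps^-1)%g.

Lemma transition_t1 : (gemap a b * (t1 * s) = torus L * gemap b a)%g.
Proof.
have E : (gemap a b * t1 = tau1h * gemap a b)%g.
  by rewrite -HE /t1 -!mulgA mulKg (mulgA G) Gt -!mulgA.
rewrite mulgA E /tau1_hat -lock -mulgA -(mulgA (torus L)) (mulgA s) (swap_gemap a0 b0).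
by rewrite -mulgA swapK mulg1.
Qed.

(** Both [gemap a b] and [gemap b a] intertwine [torus M1] with [torus M], and [torus L] commutes
    with the latter; so [transition_t1] makes [t1 * s] commute with [torus M1]. *)
Lemma t1_form : exists A B, [/\ nz A, nz B & (t1 * s)%g = gemap A B].
Proof.
apply: (gemap_of_commutation (adm_ind hD) nz1 nz1 M10 M10); apply: (mulgI (gemap a b)).
have nM := adm_nzM hD; have nL := adm_nzL hD; have nM1' := nz_vinv nz1.
have HM := transition_sigma; rewrite HE in HM.
have sH : (s * gemap a b * s = gemap b a)%g by rewrite (swap_gemap a0 b0) -mulgA swapK mulg1.
have HMV : (gemap a b * torus (vinv M1) = torus (vinv M) * gemap a b)%g.
  rewrite -(torusV nz1) -(torusV nM); apply: (mulgI (torus M)); rewrite mulVKg mulgA -HM.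
  by rewrite -mulgA mulgV mulg1.
have HM' : (gemap b a * torus M1 = torus M * gemap b a)%g.
  rewrite -sH -!mulgA (swap_torus nz1) (mulgA (gemap a b)) HMV -!mulgA (mulgA s).
  by rewrite (swap_torus (nz_vinv nM)) (vinvK nM) !mulgA.
rewrite mulgA transition_t1 -mulgA HM' mulgA (torus_comm nL nM) -mulgA -transition_t1.
by rewrite mulgA -HM -mulgA.
Qed.

Lemma mul_relations (A : comNzRingType) (x x' u u' l l' y y' : A) :
  x * u = l * y' -> x' * u' = l' * y -> l * l' = 1 -> x * x' * (u * u') = y * y'.
Proof. by move=> E E' ll; rewrite mulrACA E E' mulrACA ll mul1r mulrC. Qed.

Lemma vmulE (x y : 'I_p -> series R p) j : vmul x y j = x j * y j. Proof. by []. Qed.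

(** [transition_t1] gives a(AB zeta) A = L(c zeta) b and b(AB zeta) B = L(c zeta)^-1 a. Their
    product says that T o [act] of AB is T, whence AB = 1; the first relation times a is the
    claim. *)
Lemma sqrt_relation A B : nz A -> nz B -> (t1 * s)%g = gemap A B ->
  forall j, a j * a j * A j = pscomp (L j) T * c j.
Proof.
move=> A0 B0 tE; have nL := adm_nzL hD; have nL' := nz_vinv nL.
have := transition_t1; rewrite tE /torus (gemap_mul a0 b0 A0 B0) (gemap_mul nL nL' b0 a0).
have n1 := nz_vmul (nz_vact (vmul A B) a0) A0; have n2 := nz_vmul (nz_vact (vmul A B) b0) B0.
have n3 := nz_vmul (nz_vact (vmul b a) nL) b0; have n4 := nz_vmul (nz_vact (vmul b a) nL') a0.
move/(gemap_inj n1 n2 n3 n4) => [E1 E2].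
have P := @pointed_act R p (vmul A B); have P' := @pointed_act R p (vmul b a).
have F1 j : pscomp (a j) (act (vmul A B)) * A j = pscomp (L j) (act (vmul b a)) * b j.
  exact: (congr1 (fun F => F j) E1).
have F2 j : pscomp (b j) (act (vmul A B)) * B j = pscomp (psinv (L j)) (act (vmul b a)) * a j.
  exact: (congr1 (fun F => F j) E2).
have F j : pscomp (c j) (act (vmul A B)) * (A j * B j) = c j.
  have -> : pscomp (c j) (act (vmul A B)) =
      pscomp (a j) (act (vmul A B)) * pscomp (b j) (act (vmul A B)) by exact: pscompM _ _ P.
  have LL : pscomp (L j) (act (vmul b a)) * pscomp (psinv (L j)) (act (vmul b a)) = 1.
    apply: etrans (esym (pscompM _ _ P')) _; rewrite (mulpsV (nL j)); exact: pscomp1 P'.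
  exact: mul_relations (F1 j) (F2 j) LL.
have ABm : act (vmul A B) = mid.
  apply: (mcomp_inj T_biholo P (@pointed_mid _ _)); rewrite mcomp_mid; apply/funext => j.
  rewrite mcompE /T /act (pscompM _ _ P) (pscomp_psX _ P).
  by rewrite /act vmulE mulrA F.
move=> j; have := F1 j; rewrite ABm pscomp_mid vmulC -[vmul a b]/c => E.
by rewrite -mulrA E mulrCA /T /c; congr (_ * _).
Qed.

Lemma transition_convergent : mconvergent (gmap G).
Proof.
have [A [B [A0 B0 tE]]] := t1_form.
have cA j : convergent (A j).
  apply: (@convergent_of_emap _ _ _ B); rewrite -(gmemap A0 B0) -tE.
  apply: gmM_convergent; last by rewrite gmswap; exact: pmap_convergent.
  apply: gmM_convergent; last exact: gmV_convergent.
  apply: gmM_convergent; [exact: cPs|exact: tau1_convergent].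
have ca j : convergent (a j).
  apply: sqrt_convergent; first exact: a0.
  have -> : a j * a j = pscomp (L j) T * c j * psinv (A j).
    by rewrite -(sqrt_relation A0 B0 tE) -mulrA (mulpsV (A0 j)) mulr1.
  apply: convergentM; last by apply: psinv_convergent; [exact: A0|exact: cA].
  apply: convergentM; last exact: c_convergent.
  exact: convergent_comp (Lhat_convergent j) T0 T_convergent.
have cb j : convergent (b j).
  have -> : b j = c j * psinv (a j) by rewrite /c mulrAC (mulpsV (a0 j)) mul1r.
  apply: convergentM; first exact: c_convergent.
  by apply: psinv_convergent; [exact: a0|exact: ca].
have -> : G = (gemap a b * Ps)%g by rewrite -HE mulgVK.
apply: gmM_convergent; last exact: cPs.
by rewrite (gmemap a0 b0); apply: emap_convergent.
Qed.

End Transition.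

Lemma normalizer_convergent : mconvergent (gmap G).
Proof.
have [a [b [a0 b0 HE]]] :=
  gemap_of_commutation (adm_ind hD) nz1 (adm_nzM hD) M10 (adm_M0 hD) transition_sigma.
exact: transition_convergent a0 b0 HE.
Qed.

End ConvergentNormalization.

(** The formal G that comes with the normal form is itself shown to converge, through its transition
    to a convergent diagonalization. *)
Lemma part_convergence (R : realType) (p : nat) (D : submanifold R p) (hD : admissible D) :
  (exists Psi, [/\ mconvergent Psi, biholo Psi
     & exists M, mcomp Psi (sigma (sub_tau D)) = mcomp (sigma_hat M) Psi]) ->
  forall Phi, normal_form D Phi ->
    exists2 G, mconvergent G & normalizes_family D Phi G.
Proof.
move=> [Psi [cP bP [M0 E]]] Phi /(normal_form_data hD)[psi [G [kf nf]]].
have Gt := nf_tau1 nf; have Gs := nf_sigma nf.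
have [Ps [M1 [cPs nz1 M10 PsE]]] := convergent_diagonalization Gs cP bP E.
exists (gmap G); first exact: (@normalizer_convergent _ _ _ hD G Gt Gs Ps M1 cPs nz1 M10 PsE).
exact: nf_normal nf.
Qed.

Theorem theorem1p5 (R : realType) (p : nat) (D : submanifold R p)
    (hD : admissible D) :
  [/\ (* existence of Phi *)
      forall Theta, normalizes_sigma D Theta -> oriented D Theta ->
        exists Phi, normal_form D Phi,
      (* (\hat M, Phi) determines M *)
      forall (D' : submanifold R p) (Phi : formal_map R (p + p) (p + p)),
        admissible D' -> sub_Mhat D' = sub_Mhat D ->
        normal_form D Phi -> normal_form D' Phi ->
        formally_equivalent (sub_E D) (sub_E D'),
      (* uniqueness of Phi *)
      forall (D' : submanifold R p) (Phi Phi' : formal_map R (p + p) (p + p)),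
        admissible D' -> sub_E D' = sub_E D ->
        normal_form D Phi -> normal_form D' Phi' ->
        exists2 eps : 'I_p -> R[i],
          mcomp (R_eps eps) (R_eps eps) = mid &
          Phi' = mcomp (R_eps eps) (mcomp Phi (minv (R_eps eps)))
    & (* convergence *)
      (exists Psi, [/\ mconvergent Psi, biholo Psi
         & exists M, mcomp Psi (sigma (sub_tau D)) = mcomp (sigma_hat M) Psi]) ->
      forall Phi, normal_form D Phi ->
        exists2 G, mconvergent G & normalizes_family D Phi G].
Proof.
split.
- exact: part_existence hD.
- by move=> D' Phi hD' EM; apply: classification.
- move=> D' Phi Phi' hD' EE /(normal_form_data hD)[psi [G [kf nf]]].
  move=> /(normal_form_data hD')[psi' [G' [kf' nf']]].
  exact: (@uniqueness _ _ _ _ hD hD' EE _ _ _ _ _ _ _ _ nf nf').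
exact: part_convergence hD.
Qed.
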